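(* Suppose $P(V_1>x)\sim L(x)x^{-\alpha}$ as $x\to\infty$, where $\alpha>2$ and $L$ is slowly varying, and let $\mu=E[X_1]=E[V_1^2]/(2E[V_1])$. Define $\beta=(2\wedge(\alpha-1))^{-1}$, $M(x)=\lfloor (x-x^\beta)/\mu\rfloor$, and $$S(\rho,x)=\sum_{n=1}^{M(x)}(1-\rho)\rho^n\, n\,P\bigl(X_1>x-(n-1)\mu\bigr).$$ Then $$\sup_{0<\rho<1}\left|\frac{P(W_\infty(\rho)>x)}{S(\rho,x)+\rho^{x/\mu}}-1\right|\to 0\quad\text{as } x\to\infty.$$ Alternatively (that is, also), $$\sup_{x\ge 0}\left|\frac{P(W_\infty(\rho)>x)}{S(\rho,x)+\rho^{x/\mu}}-1\right|\to 0\quad\text{as } \rho\nearrow 1.$$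
   Context: Setting: for $\rho\in(0,1)$, $W_\infty(\rho)$ is the steady-state waiting time (exclusive of service) in the M/G/1 first-in first-out queue with i.i.d. nonnegative processing times $V_n$ (whose distribution does not depend on $\rho$) and an independent Poisson arrival process of rate $\lambda=\rho/E[V_1]$. Let $X_1,X_2,\dots$ be i.i.d. with density $g(t)=P(V_1>t)/E[V_1]$ on $(0,\infty)$, and $S_0=0$, $S_n=X_1+\cdots+X_n$. The distribution of $W_\infty(\rho)$ is given by the Pollaczek--Khintchine formula $$P(W_\infty(\rho)>x)=\sum_{n=0}^\infty(1-\rho)\rho^n P(S_n>x),\qquad x\ge 0.$$ Here $f(x)\sim h(x)$ means $f(x)/h(x)\to1$, $a\wedge b=\min(a,b)$, and a sum whose upper limit is less than $1$ is empty (equal to $0$). *)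

(* Defs.v *)
From HB Require Import structures.
From mathcomp Require Import all_boot all_order all_algebra.
From mathcomp Require Import all_classical all_reals all_analysis.

Set Implicit Arguments.
Unset Strict Implicit.
Unset Printing Implicit Defensive.

Import Order.TTheory GRing.Theory Num.Theory.
Import numFieldNormedType.Exports.

Local Open Scope classical_set_scope.
Local Open Scope ring_scope.

(* Sequences V_1, V_2, ... of the mathematical text are indexed from 0. *)

Section probability_notions.
Context {R : realType} {d : measure_display} {T : measurableType d}.
Variable P : probability T R.

Definition mutually_independent (I : eqType) (X : I -> {RV P >-> R}) : Prop :=
  forall (J : seq I) (B : I -> set R),
    uniq J -> (forall i, measurable (B i)) ->
    P (\bigcap_(i in [set i | i \in J]) (X i @^-1` B i)) =
    (\prod_(i <- J) P (X i @^-1` B i))%E.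

(* Laws are compared on Borel sets only: the value of a measure on a
   nonmeasurable set is unspecified. *)
Definition iid (X : nat -> {RV P >-> R}) : Prop :=
  mutually_independent X /\
  forall n (B : set R), measurable B ->
    distribution P (X n) B = distribution P (X 0%N) B.

Definition tail (Y : T -> R) (x : R) : R := fine (P [set w | x < Y w]).

Definition has_density (X : {RV P >-> R}) (g : R -> R) : Prop :=
  forall B : set R, measurable B ->
    distribution P X B = (\int[lebesgue_measure]_(t in B) (g t)%:E)%E.

Definition mean (X : {RV P >-> R}) : R := fine 'E_P[X].

(* g(t) = P(V > t) / E[V] on (0, oo), extended by 0. *)
Definition equilibrium_density (V : {RV P >-> R}) (t : R) : R :=
  if 0 < t then tail V t / mean V else 0.

End probability_notions.

(* L is positive and measurable on some neighbourhood [a, oo) of infinity, and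
   L(tx)/L(x) -> 1 as x -> oo for every t > 0. *)
Definition slowly_varying {R : realType} (L : R -> R) : Prop :=
  (exists a : R, measurable_fun `[a, +oo[ L /\
                 forall x, a <= x -> 0 < L x) /\
  forall t, 0 < t -> L (t * x) / L x @[x --> +oo] --> (1 : R).

Section mg1_queue.
Context {R : realType} {d : measure_display} {T : measurableType d}.
Variable P : probability T R.

(* A n is the time between the arrivals of customers n and n.+1; a Poisson
   arrival process of rate lambda is one whose interarrival times are i.i.d.
   exponential of rate lambda. *)
Definition mg1_inputs (V A : nat -> {RV P >-> R}) (rho : R) : Prop :=
  mutually_independent
    (fun i : nat + nat => match i with inl n => V n | inr n => A n end) /\
  forall n (B : set R), measurable B ->
    distribution P (A n) B = exponential_prob (rho / mean (V 0%N)) B.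

(* Lindley recursion: waiting time, exclusive of service, of customer n in the
   single-server first-in first-out queue that starts empty. *)
Fixpoint lindley (V A : nat -> T -> R) (n : nat) (w : T) : R :=
  if n is m.+1 then Num.max 0 (lindley V A m w + V m w - A m w) else 0.

(* W has the limit law, as n -> oo, of the waiting time of customer n:
   convergence in distribution, i.e. at the continuity points of the limit. *)
Definition steady_state_wait (V A : nat -> T -> R) (W : T -> R) : Prop :=
  forall x : R, P [set w | W w = x] = 0%E ->
    tail P (lindley V A n) x @[n --> \oo] --> tail P W x.

Definition partial_sum (X : nat -> T -> R) (n : nat) (w : T) : R :=
  \sum_(i < n) X i w.

(* P(W > x) = \sum_(n >= 0) (1 - rho) rho^n P(S_n > x) for x >= 0. *)
Definition pollaczek_khintchine (X : nat -> T -> R) (W : T -> R) (rho : R)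
    : Prop :=
  forall x : R, 0 <= x ->
    series (fun n => (1 - rho) * rho ^+ n * tail P (partial_sum X n) x) @ \oo
      --> tail P W x.

Definition beta (alpha : R) : R := (Num.min 2 (alpha - 1))^-1.

(* truncn y is the floor of y if y >= 0, and 0 if y < 0: in both cases the sum
   over 1 <= n <= truncn y is the sum over 1 <= n <= floor y. *)
Definition M (mu alpha x : R) : nat := Num.truncn ((x - x `^ beta alpha) / mu).

Definition Sapprox (X1 : {RV P >-> R}) (alpha rho x : R) : R :=
  let mu := mean X1 in
  \sum_(1 <= n < (M mu alpha x).+1)
    (1 - rho) * rho ^+ n * n%:R * tail P X1 (x - n.-1%:R * mu).

Definition relative_error (X1 : {RV P >-> R}) (W : T -> R) (alpha rho x : R)
    : R :=
  `| tail P W x / (Sapprox X1 alpha rho x + rho `^ (x / mean X1)) - 1 |.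

End mg1_queue.

(* Main.v *)
(** Put [s = 1 - rho], [G x = P(X_1 > x)] and [r = rho^(x / mu)].

    Large deviations.  For [n] up to a small multiple of [x] a single summand
    makes [S_n] large: [P(S_n > x)] is [n G(x)] up to a factor close to [1].  The
    lower bound is [S_n >= max X_i]; for the upper bound, either some [X_i]
    exceeds [(1 - eta) x], or some [X_i > eps x] while the other summands
    contribute [eta x] (Markov's inequality), or all [X_i <= eps x], which has
    polynomially negligible probability by exponential tilting.  Tilting also
    gives rough bounds for [n mu <= x - x^g] and a weak law for
    [n mu >= x + x^g], for any exponent [g < 1] close enough to [1].  Only
    doubling estimates on [G] are needed, never Karamata's theorem.

    Mixture.  The Pollaczek-Khintchine series is a geometric mixture of the
    [P(S_n > x)].  If [s x >= C log x], the terms [n > delta x] are negligible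
    against the term [n = 1].  If [s x <= C log x], the window
    [|n mu - x| <= x^g] has weight [o(r)], the terms above it add up to
    [r (1 + o(1))], the terms just below it are [o(r)], and the terms between
    [delta x] and [(1 - eta) x / mu] are [o(r)] when [s x <= c log x] with [c]
    small, and negligible against the terms [n <= delta x] otherwise.  The same
    splitting applies to [S(rho, x)].

    The second limit follows from the first, since for bounded [x] both
    [P(W > x)] and [S(rho, x) + r] tend to [1] uniformly as [rho] tends to [1]. *)
Require Import Defs.
From mathcomp Require Import all_boot all_order all_algebra.
From mathcomp Require Import all_classical all_reals all_analysis.
From mathcomp Require Import measurable_realfun lra ring.
Import Order.TTheory GRing.Theory Num.Theory.
Import numFieldNormedType.Exports.
Set Implicit Arguments.
Unset Strict Implicit.
Unset Printing Implicit Defensive.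
Local Open Scope classical_set_scope.
Local Open Scope ring_scope.

(** * Elementary estimates *)

(** The obstacle is uniformity in [rho]: all estimates on [P(S_n > x)] are uniform in [n] and free
    of [rho], and only the size of [s x] against [log x] separates cases.

    Origin of [beta]: the moments at hand have order [t <= 2] with [t < alpha - 1], and tilting
    controls [S_n] outside a window of width [x^g] when [g t > 1]. Such a [t] exists exactly when
    [g > beta]. The sum [S(rho, x)], however, runs beyond [x - x^g], up to [x - x^beta]. For its
    last terms the estimate is [G(x^beta) <= K x^(-beta q)] with some [q < alpha - 1]. Multiplied by
    [n <= x / mu] and by about [x^g] weights of order [r log x / x], it gives
    [r x^(g - beta q) log x]. Hence the requirement [beta < g < beta q], which
    [beta (alpha - 1) >= 1] permits once [g < 1]: [beta q] can be taken close enough to [1].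

    The lower bound [G(x) >= c x^(-q')] may hold with a very large [q'], since tilting yields any
    negative power of [x]. *)

Section elementary.
Context {R : realType}.
Implicit Types (a b e p q s t u x y rho : R) (k l n : nat).

Lemma powR_le1_le2 u p : 0 <= u <= 1 -> p <= 2 -> u ^+ 2 <= u `^ p.
Proof.
move=> /andP[]; rewrite le_eqVlt => /predU1P[<-|u0] u1 p2.
  by rewrite expr2 mul0r powR_ge0.
rewrite -powR_mulrn ?(ltW u0)//.
by rewrite ger_powR// u0.
Qed.

Lemma powR_ge1 u p : 1 <= u -> 0 <= p -> 1 <= u `^ p.
Proof. by move=> u1 p0; rewrite -[leLHS](powRr0 u) ler_powR. Qed.

(** A Taylor remainder of order [p] instead of [2], since only a moment of order [p] will be finite.
    For [u <= 1] the inequality [expR u <= 1 + u * expR u] is used twice; for [u >= 1] the last term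
    alone suffices. *)
Lemma expR_le1DxDpow u p : 0 <= u -> 1 <= p <= 2 ->
  expR u <= 1 + u + u `^ p * expR u.
Proof.
move=> u0 /andP[p1 p2]; have eu := expR_gt0 u.
have [u1|/ltW u1] := leP u 1; last first.
  have := le1r_powR u1 p1; nra.
have up := @powR_le1_le2 u p; rewrite u0 u1 /= in up.
have {}up := up isT p2.
have : (1 - u) * expR u <= 1.
  have := expR_ge1Dx (- u); rewrite expRN => h.
  have := ler_wpM2r (ltW eu) h; rewrite mulVf ?gt_eqF//.
rewrite expr2 in up; nra.
Qed.

Lemma expRN_le1BxDpow u p : 0 <= u -> 1 <= p <= 2 ->
  expR (- u) <= 1 - u + u `^ p.
Proof.
move=> u0 /andP[p1 p2].
have [u1|/ltW u1] := leP u 1; last first.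
  have := le1r_powR u1 p1.
  have : expR (- u) <= 1 by rewrite expR_le1; lra.
  lra.
have up := @powR_le1_le2 u p; rewrite u0 u1 /= in up.
have {}up := up isT p2.
apply: le_trans (_ : 1 - u + u ^+ 2 <= _); last by lra.
rewrite expRN -[leLHS]mul1r ler_pdivrMr ?expR_gt0//.
have := expR_ge1Dx u; have : 0 <= u ^+ 2 by rewrite sqr_ge0.
rewrite expr2; nra.
Qed.

Lemma near_powRN_le a e : 0 < a -> 0 < e ->
  \forall x \near +oo, x `^ (- a) <= e.
Proof.
move=> a0 e0; near=> x.
have x0 : 0 < x by near: x; exact: nbhs_pinfty_gt.
have xe : e `^ (- a^-1) <= x by near: x; apply: nbhs_pinfty_ge; rewrite num_real.
have -> : e = (e `^ (- a^-1)) `^ (- a).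
  by rewrite -powRrM mulrNN mulVf ?gt_eqF// powRr1// ltW.
rewrite !(powRN _ a) lef_pV2 ?posrE ?powR_gt0//.
by apply: ge0_ler_powR; rewrite ?nnegrE ?powR_ge0// ltW.
Unshelve. all: by end_near. Qed.

Lemma ln_le_powR a x : 0 < a -> 1 <= x -> ln x <= a^-1 * x `^ a.
Proof.
move=> a0 x1; rewrite ler_pdivlMl// -ln_powR ltW//.
by rewrite ln_sublinear// powR_gt0// (lt_le_trans ltr01).
Qed.

Lemma powR_expR x t : 0 < x -> x `^ t = expR (t * ln x).
Proof. by move=> x0; rewrite /powR gt_eqF. Qed.

Lemma near_ln_powRN_le a e C : 0 < a -> 0 < e ->
  \forall x \near +oo, C * ln x * x `^ (- a) <= e.
Proof.
move=> a0 e0.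
have D0 : 0 < (1 + `|C|) * (a / 2)^-1.
  by rewrite mulr_gt0 ?invr_gt0 ?divr_gt0// ltr_pwDl.
near=> x.
have x1 : 1 <= x by near: x; exact: nbhs_pinfty_ge.
have x0 : 0 < x by exact: lt_le_trans x1.
have h : x `^ (- (a/2)) <= e / ((1 + `|C|) * (a / 2)^-1).
  by near: x; apply: near_powRN_le; rewrite ?divr_gt0.
rewrite ler_pdivlMr// mulrC in h; apply: le_trans h.
have -> : - a = a / 2 + (- (a / 2) - a) by lra.
have xa : x `^ (- a) = x `^ (- (a/2)) * x `^ (- (a/2)).
  by rewrite -powRD ?(gt_eqF x0) ?implybT//; congr powR; lra.
have -> : a / 2 + (- (a / 2) - a) = - a by lra.
rewrite xa mulrA ler_wpM2r ?powR_ge0//.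
apply: le_trans (_ : (1 + `|C|) * ln x * x `^ (- (a / 2)) <= _).
  rewrite ler_wpM2r ?powR_ge0// ler_wpM2r ?ln_ge0//.
  by apply: le_trans (ler_norm C) _; lra.
rewrite -mulrA ler_wpM2l ?addr_ge0//.
rewrite powRN ler_pdivrMr ?powR_gt0//.
by apply: ln_le_powR => //; rewrite divr_gt0.
Unshelve. all: by end_near. Qed.

Lemma near_pinfty_ge (A : R) : \forall x \near +oo, A <= x.
Proof. by apply: nbhs_pinfty_ge; rewrite num_real. Qed.

Lemma near_powR_ge a (A : R) : 0 < a -> \forall x \near +oo, A <= x `^ a.
Proof.
move=> a0; have B0 : 0 < 1 + `|A| by rewrite ltr_pwDl.
near=> x.
have x0 : 0 < x by near: x; exact: nbhs_pinfty_gt.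
have : x `^ (- a) <= (1 + `|A|)^-1.
  by near: x; apply: near_powRN_le; rewrite ?invr_gt0.
rewrite powRN lef_pV2 ?posrE ?powR_gt0//; apply: le_trans.
by have := ler_norm A; lra.
Unshelve. all: by end_near. Qed.

Lemma sum_geo rho k l : (k <= l)%N ->
  \sum_(k <= n < l) (1 - rho) * rho ^+ n = rho ^+ k - rho ^+ l.
Proof.
move=> kl; rewrite -[RHS]opprB -(telescope_sumr (fun n => rho ^+ n) kl) -sumrN.
by apply: eq_bigr => n _; rewrite exprS; ring.
Qed.

(** Truncated mean of the geometric law, cleared of the denominator [1 - rho]. The subtracted part
    is the share of the indices from [k] on, so that blocks of the series can be compared
    exactly. *)
Lemma sum_nat_geo rho k :
  (1 - rho) * \sum_(0 <= n < k) n%:R * ((1 - rho) * rho ^+ n) =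
  rho - rho ^+ k * (rho + (1 - rho) * k%:R).
Proof.
elim: k => [|k IH]; first by rewrite big_nil expr0; ring.
by rewrite big_nat_recr//= mulrDr IH exprS -natr1; ring.
Qed.

Lemma rho_powR_le rho t : 0 < rho < 1 -> 0 <= t ->
  rho `^ t <= expR (- ((1 - rho) * t)).
Proof.
move=> /andP[r0 r1] t0; rewrite powR_expR// ler_expR.
have := @le_ln1Dx R (rho - 1); rewrite (addrC 1) subrK => h.
have {}h : ln rho <= rho - 1 by apply: h; lra.
nra.
Qed.

(** On [[1/2, 1)] one has [ln rho >= - 2 (1 - rho)]. With [D] of order [x^g] and [(1 - rho) x] of
    order [ln x] the extra factor tends to [1], so every [rho ^+ n] in the window can be exchanged
    for [rho^(x / mu)]. *)
Lemma rho_powR_shift rho t u (D : R) : 2^-1 <= rho < 1 -> 0 <= D -> u - t <= D ->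
  rho `^ t <= rho `^ u * expR (2 * (1 - rho) * D).
Proof.
move=> /andP[rh r1] D0 utD; have r0 : 0 < rho by lra.
rewrite !powR_expR// -expRD ler_expR.
have l0 : ln rho <= 0 by rewrite ln_le0// ltW.
have : - (2 * (1 - rho)) <= ln rho.
  rewrite -ler_expR lnK ?posrE// expRN -[leLHS]mul1r ler_pdivrMr ?expR_gt0//.
  apply: le_trans (_ : rho * (1 + 2 * (1 - rho)) <= _); first by nra.
  by rewrite ler_wpM2l ?expR_ge1Dx// ltW.
nra.
Qed.

Lemma powR_exprn a x k : 0 <= x -> (x ^+ k) `^ a = (x `^ a) ^+ k.
Proof.
by move=> x0; rewrite -powR_mulrn// -powRrM mulrC powRrM powR_mulrn ?powR_ge0.
Qed.

Lemma truncn_le_nat n x : 0 <= x -> (n < (Num.truncn x).+1)%N = (n%:R <= x).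
Proof. by move=> x0; rewrite ltnS truncn_ge_nat. Qed.
End elementary.

(** * Geometric mixtures *)

Section core.
Context {R : realType}.
(** [p n x] stands for [P(S_n > x)], [G] for the tail of [X_1], [b] for [beta alpha], and [x^g] is
    the half-width of the window. [gq1] makes [x G(x^g)] vanish, which settles the terms below the
    window; [gbq] settles the terms of [S] between [x - x^g] and [x - x^b]. *)
Variables (G : R -> R) (p : nat -> R -> R) (mu b g q q' : R).
Hypotheses (mu0 : 0 < mu) (b0 : 0 < b) (bg : b < g) (g1 : g < 1).
Hypotheses (q1 : 1 < q) (gbq : g < b * q) (gq1 : 1 < g * q) (q'0 : 0 < q').
Hypothesis G_ni : forall x y, x <= y -> G y <= G x.
Hypothesis G_ge0 : forall x, 0 <= G x.
Hypothesis G_le1 : forall x, G x <= 1.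
Hypothesis G_low : exists2 c : R, 0 < c & \forall x \near +oo, c * x `^ (- q') <= G x.
Hypothesis G_up : exists2 K : R, 0 < K & forall y : R, 0 < y -> G y <= K * y `^ (- q).
Hypothesis G_scale : forall eta : R, 0 < eta < 1 ->
  exists2 C : R, 0 < C & \forall x \near +oo, G (eta * x) <= C * G x.
Hypothesis G_cont : forall e : R, 0 < e ->
  exists2 delta : R, 0 < delta < 1 & \forall x \near +oo, G ((1 - delta) * x) <= (1 + e) * G x.
Hypothesis p_ge0 : forall n x, 0 <= p n x.
Hypothesis p_le1 : forall n x, p n x <= 1.
Hypothesis p_small : forall e : R, 0 < e -> exists2 delta : R, 0 < delta &
  \forall x \near +oo, forall n, n%:R <= delta * x ->
    `|p n x - n%:R * G x| <= e * (n%:R * G x).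
Hypothesis p_mid : forall eta : R, 0 < eta < 1 -> exists2 C : R, 0 < C &
  \forall x \near +oo, forall n, n%:R * mu <= (1 - eta) * x ->
    p n x <= C * (n%:R * G x).
Hypothesis p_below : exists2 K : R, 0 < K &
  \forall x \near +oo, forall n, n%:R * mu <= x - x `^ g ->
    p n x <= K * x `^ (1 - g * q).
Hypothesis p_above : forall e : R, 0 < e ->
  \forall x \near +oo, forall n, x + x `^ g <= n%:R * mu -> 1 - e <= p n x.

Implicit Types (n k : nat) (rho x e delta eta : R).

Let B n x : R := n%:R * G (x - n.-1%:R * mu).
Let wt rho n : R := (1 - rho) * rho ^+ n.
(** All that is retained of the Pollaczek-Khintchine series with value [w]: from [k] on the weights
    add up to [rho ^+ k], and the probabilities lie between [e] and [1]. In this form no limit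
    occurs in the estimates. *)
Definition mixture_bounds rho x w :=
  (forall k, w <= \sum_(0 <= n < k) (1 - rho) * rho ^+ n * p n x + rho ^+ k) /\
  (forall k e, (forall n, (k <= n)%N -> e <= p n x) ->
    \sum_(0 <= n < k) (1 - rho) * rho ^+ n * p n x + e * rho ^+ k <= w).

(** The range starts at [0], where [B 0 x] vanishes, so that [S] and the series split into the same
    blocks. *)
Let S rho x :=
  \sum_(0 <= n < (Num.truncn ((x - x `^ b) / mu)).+1) wt rho n * B n x.

Let wt_ge0 rho n : 0 < rho < 1 -> 0 <= wt rho n.
Proof. by move=> /andP[r0 r1]; rewrite mulr_ge0 ?subr_ge0 ?exprn_ge0// ltW. Qed.

Let B_ge0 n x : 0 <= B n x.
Proof. by rewrite mulr_ge0. Qed.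

Let B_geG n x : n%:R * G x <= B n x.
Proof.
by rewrite ler_wpM2l// G_ni// gerBl mulr_ge0// ltW.
Qed.

(** [G_cont] allows [x - (n - 1) mu] to be replaced by [x] when [n mu] is a small fraction of [x];
    then [p_small] applies. The bound [delta * mu <= 2^-1] keeps the cut at [delta x] well below
    [x / mu]. *)
Lemma B_small e : 0 < e -> exists2 delta : R, 0 < delta /\ delta * mu <= 2^-1 &
  \forall x \near +oo, forall n, n%:R <= delta * x -> `|p n x - B n x| <= e * B n x.
Proof.
move=> e0; have e20 : 0 < e / 2 by rewrite divr_gt0.
have [d1 d10 P1] := p_small e20.
have [d2 /andP[d20 d21] P2] := G_cont e20.
have m1 : 0 < d2 / mu by rewrite divr_gt0.
have m2 : 0 < (mu *+ 2)^-1 by rewrite invr_gt0 mulrn_wgt0.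
exists (Num.min d1 (Num.min (d2 / mu) (mu *+ 2)^-1)).
  split; first by rewrite !lt_min d10 m1 m2.
  rewrite -ler_pdivlMr//; apply: le_trans (_ : (mu *+ 2)^-1 <= _).
    by rewrite !ge_min lexx !orbT.
  by rewrite -(mulr_natr mu) invfM [leLHS]mulrC lexx.
near=> x => n.
have x0 : 0 <= x by near: x; exact: near_pinfty_ge.
have P1x : forall n, n%:R <= d1 * x -> `|p n x - n%:R * G x| <= e / 2 * (n%:R * G x) by near: x.
have P2x : G ((1 - d2) * x) <= (1 + e / 2) * G x by near: x.
move=> nx; have nx1 : n%:R <= d1 * x.
  by apply: le_trans nx _; rewrite ler_wpM2r// ge_min lexx.
have nx2 : n%:R * mu <= d2 * x.
  rewrite -ler_pdivlMr// mulrAC.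
  by apply: le_trans nx _; rewrite ler_wpM2r// !ge_min lexx orbT.
have Bu : B n x <= (1 + e / 2) * (n%:R * G x).
  rewrite mulrCA ler_wpM2l//; apply: le_trans P2x; apply: G_ni.
  rewrite mulrBl mul1r lerB//; apply: le_trans nx2.
  by rewrite ler_wpM2r ?(ltW mu0)// ler_nat leq_pred.
have := P1x _ nx1; have := B_geG n x.
set u := n%:R * G x in Bu *; rewrite !ler_norml => Bl /andP[h1 h2].
have u0 : 0 <= u by rewrite mulr_ge0.
by apply/andP; split; nra.
Unshelve. all: by end_near. Qed.

Let wsum_le rho k l (f h : nat -> R) : 0 < rho < 1 ->
  (forall n, (k <= n < l)%N -> f n <= h n) ->
  \sum_(k <= n < l) wt rho n * f n <= \sum_(k <= n < l) wt rho n * h n.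
Proof.
move=> rho01 fh; rewrite big_nat [leRHS]big_nat; apply: ler_sum => n /fh fhn.
by rewrite ler_wpM2l// wt_ge0.
Qed.

Let wsum_const rho k l a : 0 < rho < 1 -> 0 <= a -> (k <= l)%N ->
  \sum_(k <= n < l) wt rho n * a <= a * rho ^+ k.
Proof.
move=> /andP[r0 r1] a0 kl; rewrite -mulr_suml sum_geo// mulrC ler_wpM2l//.
by rewrite gerBl exprn_ge0// ltW.
Qed.

Let wsum_ge0 rho k l (f : nat -> R) : 0 < rho < 1 -> (forall n, 0 <= f n) ->
  0 <= \sum_(k <= n < l) wt rho n * f n.
Proof. by move=> r01 f0; apply: sumr_ge0 => n _; rewrite mulr_ge0 ?wt_ge0. Qed.

Let wsum_close rho k l e (f h : nat -> R) : 0 < rho < 1 ->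
  (forall n, (k <= n < l)%N -> `|f n - h n| <= e * h n) ->
  `|\sum_(k <= n < l) wt rho n * f n - \sum_(k <= n < l) wt rho n * h n|
    <= e * \sum_(k <= n < l) wt rho n * h n.
Proof.
move=> r01 fh; rewrite -sumrB mulr_sumr; apply: le_trans (ler_norm_sum _ _ _) _.
rewrite big_nat [leRHS]big_nat; apply: ler_sum => n /fh fhn.
by rewrite -mulrBr normrM ger0_norm ?wt_ge0// mulrCA ler_wpM2l// wt_ge0.
Qed.

Let trunc_le (a : R) n : (n < (Num.truncn a).+1)%N -> 0 <= a -> n%:R <= a.
Proof. by move=> na a0; rewrite -truncn_le_nat. Qed.

(* Everything beyond [n <= delta x] is superpolynomially small and loses
   against the single term [n = 1], which is at least [s rho c x^(-q')]. *)
Lemma light_traffic delta e : 0 < e -> 0 < delta -> delta * mu <= 2^-1 ->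
  (\forall x \near +oo, forall n, n%:R <= delta * x -> `|p n x - B n x| <= e * B n x) ->
  exists2 C1 : R, 0 < C1 &
    \forall x \near +oo, forall rho w, 0 < rho < 1 -> C1 * ln x <= (1 - rho) * x ->
    mixture_bounds rho x w ->
    `|w - (S rho x + rho `^ (x / mu))| <= 2 * e * (S rho x + rho `^ (x / mu)).
Proof.
move=> e0 d0 dmu near_small; have [c c0 near_low] := G_low.
(* This constant makes [rho^(delta x)] at most [x^(-(q' + 3))]. The power [q'] is for [G x], one
   more for [1 - rho >= 1 / x], one for the factor [x / mu + 3], and the last one beats the
   constants. *)
have C10 : 0 < (q' + 3) / delta by rewrite divr_gt0// addr_gt0.
exists ((q' + 3) / delta) => //; near=> x => rho w rho01.
have [r0 r1] := andP rho01.
have x1 : 1 <= x by near: x; exact: near_pinfty_ge.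
have x0 : 0 < x by exact: lt_le_trans x1.
have small : forall n, n%:R <= delta * x -> `|p n x - B n x| <= e * B n x by near: x.
have low : c * x `^ (- q') <= G x by near: x.
have dx1 : 1 <= delta * x.
  by rewrite mulrC -ler_pdivrMr.
have xmu2 : 2 * mu <= x by near: x; exact: near_pinfty_ge.
have xb : x `^ b <= x / 2.
  have : x `^ (- (1 - b)) <= 2^-1.
    by near: x; apply: near_powRN_le => //; rewrite subr_gt0 (lt_trans bg).
  rewrite opprB powRB ?(gt_eqF x0) ?implybT// powRr1 ?(ltW x0)//.
  by rewrite ler_pdivrMr// mulrC.
have C1ln : 1 <= (q' + 3) / delta * ln x.
  by rewrite mulrC -ler_pdivrMr// mul1r -ler_expR lnK ?posrE.
have xbig : (mu^-1 + 3) * expR 1 <= e * c * x.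
  by rewrite mulrC [leRHS]mulrC -ler_pdivrMr ?mulr_gt0.
move=> sx [w_up w_lo]; set s := 1 - rho in sx *.
have s0 : 0 < s by rewrite subr_gt0.
set k0 := (Num.truncn (delta * x)).+1.
set MM := (Num.truncn ((x - x `^ b) / mu)).+1.
have k0M : (k0 <= MM)%N.
  rewrite ltnS le_truncn// ler_pdivlMr// mulrAC.
  have : delta * mu * x <= 2^-1 * x by rewrite ler_wpM2r// ltW.
  lra.
have xmu0 : 0 < x / mu by rewrite divr_gt0.
have MMx : MM%:R <= x / mu + 1.
  rewrite -natr1 lerD2r; apply: le_trans (_ : (x - x `^ b) / mu <= _).
    rewrite truncn_le divr_ge0// ?(ltW mu0)// subr_ge0.
    by apply: le_trans xb _; lra.
  by rewrite ler_pM2r ?invr_gt0// gerBl powR_ge0.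
have k0x : k0%:R <= x / mu.
  rewrite -natr1; have : (Num.truncn (delta * x))%:R <= delta * x.
    by rewrite truncn_le mulr_ge0// ltW.
  have : delta * x <= x / mu / 2.
    rewrite mulrAC ler_pdivlMr// mulrAC [leRHS]mulrC ler_wpM2r// ltW.
  have : 1 <= x / mu / 2 by rewrite mulrAC ler_pdivlMr// mul1r; lra.
  lra.
have r_le : rho `^ (x / mu) <= rho ^+ k0.
  by rewrite -powR_mulrn ?(ltW r0)// ger_powR// r0 (ltW r1).
have tiny : (x / mu + 3) * rho ^+ k0 <= e * (wt rho 1 * G x).
  have sx1 : x^-1 <= s.
    rewrite -[leLHS]mul1r ler_pdivrMr//; exact: le_trans C1ln sx.
  (* Since [rho] may be close to [0], one factor of [rho ^+ k0] is set aside to match the [rho] in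
     [wt rho 1]. Rounding [delta x] down costs at most [expR 1]. *)
  have hK : rho ^+ (Num.truncn (delta * x)) <= expR 1 * x `^ (- (q' + 3)).
    rewrite -powR_mulrn ?(ltW r0)//; apply: le_trans (rho_powR_le rho01 _) _ => //.
    rewrite powR_expR// -expRD ler_expR -/s.
    have := truncnS_gt (delta * x); rewrite -natr1.
    set K := (Num.truncn (delta * x))%:R => hK.
    have : delta * ((q' + 3) / delta * ln x) <= delta * (s * x) by rewrite ler_pM2l.
    rewrite mulrA mulrCA divff ?gt_eqF// mulr1 => hh.
    have s1 : s <= 1 by rewrite gerBl ltW.
    nra.
  rewrite /k0 exprS /wt expr1 -/s.
  have : rho * ((x / mu + 3) * (expR 1 * x `^ (- (q' + 3)))) <=
         rho * (e * (x^-1 * (c * x `^ (- q')))).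
    rewrite ler_pM2l//.
    have -> : x `^ (- (q' + 3)) = x `^ (- q') / x ^+ 3.
      rewrite opprD powRB ?(gt_eqF x0) ?implybT//.
      by rewrite -powR_mulrn// ltW.
    rewrite [leLHS](_ : _ = (x / mu + 3) * expR 1 / x ^+ 2 * (x `^ (- q') / x)); last first.
      by field; rewrite !gt_eqF.
    rewrite [leRHS](_ : _ = e * c * (x `^ (- q') / x)); last first.
      by field; rewrite !gt_eqF.
    rewrite ler_wpM2r ?divr_ge0 ?powR_ge0 ?(ltW x0)//.
    rewrite ler_pdivrMr ?exprn_gt0// expr2 mulrA.
    apply: le_trans (_ : (mu^-1 + 3) * expR 1 * x <= _); last by rewrite ler_pM2r.
    rewrite mulrAC ler_pM2r ?expR_gt0// mulrDl mulrC lerD2l.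
    by rewrite -[leLHS]mulr1 ler_pM2l.
  have hL : (x / mu + 3) * (rho * rho ^+ Num.truncn (delta * x)) <=
     rho * ((x / mu + 3) * (expR 1 * x `^ (- (q' + 3)))).
    by rewrite mulrCA ler_pM2l// ler_wpM2l// addr_ge0// ltW.
  have hR : rho * (e * (x^-1 * (c * x `^ (- q')))) <= e * (s * rho * G x).
    rewrite [leRHS](_ : _ = rho * (e * (s * G x))); last by ring.
    rewrite ler_pM2l// ler_pM2l//; apply: ler_pM => //.
      by rewrite invr_ge0 ltW.
    by rewrite mulr_ge0 ?powR_ge0// ltW.
  by move=> hM; apply: le_trans hL (le_trans hM hR).
set A := \sum_(0 <= n < k0) wt rho n * p n x.
set Sb := \sum_(0 <= n < k0) wt rho n * B n x.
have ASb : `|A - Sb| <= e * Sb.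
  apply: wsum_close => // n /andP[_ nk]; apply: small.
  by apply: trunc_le nk _; rewrite mulr_ge0// ltW.
have Sb1 : wt rho 1 * G x <= Sb.
  rewrite /Sb (@big_cat_nat _ _ _ 2%N)//=; last first.
    by rewrite ltnS truncn_gt0.
  rewrite big_ltn// big_ltn// big_geq//= addr0.
  have -> : wt rho 1 * G x = wt rho 1 * (1%:R * G x) by rewrite mul1r.
  have := B_geG 1 x => hB.
  have h1 : wt rho 1 * (1%:R * G x) <= wt rho 1 * B 1 x by rewrite ler_wpM2l// wt_ge0.
  have h2 : 0 <= wt rho 0 * B 0 x by rewrite mulr_ge0// wt_ge0.
  have h3 : 0 <= \sum_(2 <= i < k0) wt rho i * B i x by exact: wsum_ge0.
  lra.
have [Sh0 Sh] : 0 <= S rho x - Sb /\ S rho x - Sb <= (x / mu + 1) * rho ^+ k0.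
  have -> : S rho x - Sb = \sum_(k0 <= n < MM) wt rho n * B n x.
    by rewrite /S (@big_cat_nat _ _ _ k0)//= [LHS]addrC addKr.
  split; first exact: wsum_ge0.
  apply: le_trans (@wsum_const rho k0 MM (x / mu + 1) rho01 _ k0M); last first.
    by rewrite addr_ge0// ltW.
  apply: wsum_le => // n /andP[_ nM]; apply: le_trans MMx.
  rewrite -[leRHS]mulr1; apply: ler_pM => //.
  by rewrite ler_nat ltnW.
have wu := w_up k0; have wl := w_lo k0 0 (fun n _ => p_ge0 n x).
rewrite mul0r addr0 in wl; rewrite -/(wt _ _) -/A in wu wl.
have r_ge0 : 0 <= rho `^ (x / mu) by exact: powR_ge0.
have : e * (wt rho 1 * G x) <= e * Sb by rewrite ler_pM2l.
move: ASb; rewrite !ler_norml => /andP[a1 a2] hSb.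
by apply/andP; split; nra.
Unshelve. all: by end_near. Qed.

Lemma middle_negligible delta (C C1 e : R) :
  0 < delta -> 0 < C -> 0 < C1 -> 0 < e ->
  \forall x \near +oo, forall rho k, 2^-1 <= rho < 1 -> (1 - rho) * x <= C1 * ln x ->
    ((Num.truncn (delta * x)).+1 <= k)%N -> k%:R <= x / mu + 1 ->
    C * \sum_((Num.truncn (delta * x)).+1 <= n < k) wt rho n * (n%:R * G x) <=
    e * (\sum_(0 <= n < (Num.truncn (delta * x)).+1) wt rho n * (n%:R * G x)
         + rho `^ (x / mu)).
Proof.
move=> d0 C0 C10 e0; have [K K0 GK] := G_up.
(* If [s x <= c ln x], then [r >= x^(-(q - 1) / 2)], while the block is [O(x G(x)) = O(x^(1 - q))]:
   half of the exponent [q - 1] is left over. *)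
set c := mu * (q - 1) / 4.
have c0 : 0 < c by rewrite /c divr_gt0// mulr_gt0// subr_gt0.
have q10 : 0 < (q - 1) / 2 by rewrite divr_gt0// subr_gt0.
have muK : 0 < (mu^-1 + 1) * K * C.
  by rewrite !mulr_gt0// addr_gt0// invr_gt0.
have [m m0 m_le] : exists2 m : R, 0 < m & m <= 4^-1 /\ m <= e / (4 * C).
  exists (Num.min (4^-1) (e / (4 * C))); last by rewrite !ge_min !lexx orbT.
  by rewrite lt_min invr_gt0 ltr0n divr_gt0// mulr_gt0.
near=> x => rho k /andP[rh r1] sx k0k kx.
have r0 : 0 < rho by lra.
have rho01 : 0 < rho < 1 by rewrite r0.
have x1 : 1 <= x by near: x; exact: near_pinfty_ge.
have x0 : 0 < x by exact: lt_le_trans x1.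
have xmu0 : 0 < x / mu by rewrite divr_gt0.
set s := 1 - rho in sx *.
have s0 : 0 < s by rewrite subr_gt0.
have lnx0 : 0 <= ln x by exact: ln_ge0.
set k0 := (Num.truncn (delta * x)).+1 in k0k *.
have [sxc|sxc] := leP (s * x) (c * ln x).
  have rlow : 1 <= rho `^ (x / mu) * x `^ ((q - 1) / 2).
    have := @rho_powR_shift R rho 0 (x / mu) (x / mu).
    rewrite rh r1 subr0 => /(_ isT (ltW xmu0) (lexx _)).
    rewrite powRr0; move/le_trans; apply; rewrite ler_wpM2l ?powR_ge0//.
    rewrite powR_expR// ler_expR -/s.
    have -> : (q - 1) / 2 * ln x = 2 * (c * ln x) / mu.
      by rewrite /c; field; rewrite gt_eqF.
    by rewrite mulrA ler_pM2r ?invr_gt0// -mulrA ler_pM2l.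
  have GxK : G x <= K * x `^ (- q) by exact: GK.
  have Q1 : \sum_(k0 <= n < k) wt rho n * (n%:R * G x) <= (x / mu + 1) * G x.
    apply: le_trans (@wsum_le _ _ _ _ (fun=> (x / mu + 1) * G x) rho01 _) _.
      move=> n /andP[_ nk]; rewrite ler_wpM2r//; apply: le_trans kx.
      by rewrite ler_nat ltnW.
    apply: le_trans (wsum_const rho01 _ k0k) _.
      by rewrite mulr_ge0// addr_ge0// ltW.
    rewrite -[leRHS]mulr1 ler_wpM2l//.
      by rewrite mulr_ge0// addr_ge0// ltW.
    by rewrite exprn_ile1// ltW.
  have small : (mu^-1 + 1) * K * C * x `^ (- ((q - 1) / 2)) <= e.
    rewrite mulrC -ler_pdivlMr//.
    by near: x; apply: near_powRN_le => //; rewrite divr_gt0.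
  apply: le_trans (_ : e * rho `^ (x / mu) <= _); last first.
    by rewrite ler_pM2l// lerDr; apply: wsum_ge0 => // n; rewrite mulr_ge0.
  apply: le_trans (_ : C * ((mu^-1 + 1) * x * (K * x `^ (- q))) <= _).
    rewrite ler_pM2l//; apply: le_trans Q1 _; apply: ler_pM => //.
      by rewrite addr_ge0// ltW.
    by rewrite mulrDl mulrC lerD2l mul1r.
  have -> : C * ((mu^-1 + 1) * x * (K * x `^ (- q))) =
      (mu^-1 + 1) * K * C * (x * x `^ (- q)) by ring.
  have -> : x * x `^ (- q) = x `^ (- ((q - 1) / 2)) * x `^ (- ((q - 1) / 2)).
    rewrite -powRD ?(gt_eqF x0) ?implybT// -[X in X * _]powRr1 ?(ltW x0)//.
    by rewrite -powRD ?(gt_eqF x0) ?implybT//; congr powR; lra.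
  rewrite mulrA; apply: ler_pM => //.
  - by rewrite mulr_ge0 ?powR_ge0// ltW.
  - exact: powR_ge0.
  - by rewrite powRN -[leLHS]mul1r ler_pdivrMr ?powR_gt0.
(* Here [s x > c ln x]. By [sum_nat_geo], [T] is [s] times the geometric mean restricted to
   [n >= k0], and it is small because [rho ^+ k0 <= x^(-c delta)]. The two bounds on [m] serve two
   purposes: [T <= 1/4] leaves [s * S0 = rho - T >= 1/4], and [C * T <= e / 4] bounds the middle
   block. *)
set T := rho ^+ k0 * (rho + s * k0%:R).
have T_le : T <= m.
  have k0x : k0%:R <= delta * x + 1.
    by rewrite -natr1 lerD2r truncn_le mulr_ge0// ltW.
  have xk0 : delta * x <= k0%:R by rewrite ltW// truncnS_gt.
  have rk : rho ^+ k0 <= x `^ (- (c * delta)).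
    rewrite -powR_mulrn ?(ltW r0)//; apply: le_trans (rho_powR_le rho01 _) _ => //.
    rewrite powR_expR// ler_expR -/s.
    have h1 : s * (delta * x) <= s * k0%:R by rewrite ler_pM2l.
    have h2 : delta * (c * ln x) <= delta * (s * x) by rewrite ler_pM2l// ltW.
    lra.
  have s1 : s <= 1 by rewrite gerBl ltW.
  have skx : rho + s * k0%:R <= 2 + C1 * delta * ln x.
    have h1 : s * k0%:R <= s * (delta * x + 1) by rewrite ler_pM2l.
    have h2 : delta * (s * x) <= delta * (C1 * ln x) by rewrite ler_pM2l.
    lra.
  apply: le_trans (_ : x `^ (- (c * delta)) * (2 + C1 * delta * ln x) <= _).
    apply: ler_pM => //; first by rewrite exprn_ge0// ltW.
    by rewrite addr_ge0 ?mulr_ge0// ltW.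
  have t1 : x `^ (- (c * delta)) <= m / 4.
    by near: x; apply: near_powRN_le; rewrite ?(mulr_gt0 c0)// (divr_gt0 m0).
  have t2 : C1 * delta * ln x * x `^ (- (c * delta)) <= m / 2.
    by near: x; apply: near_ln_powRN_le; rewrite ?(mulr_gt0 c0)// (divr_gt0 m0).
  rewrite mulrDr (mulrC (x `^ _) (_ * _ * _)); lra.
have [/(le_trans T_le) T4 /(le_trans T_le) TC] := m_le.
have TC' : C * T <= e / 4.
  rewrite mulrC -ler_pdivlMr//; apply: le_trans TC _.
  by rewrite invfM mulrA.
have sumG i j : \sum_(i <= n < j) wt rho n * (n%:R * G x) =
    (\sum_(i <= n < j) n%:R * wt rho n) * G x.
  by rewrite mulr_suml; apply: eq_bigr => n _; rewrite mulrA (mulrC (wt _ _)).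
rewrite !sumG.
have e1 : s * \sum_(0 <= n < k0) n%:R * wt rho n = rho - T := sum_nat_geo rho k0.
have e2 : s * \sum_(0 <= n < k) n%:R * wt rho n = rho - rho ^+ k * (rho + s * k%:R).
  exact: sum_nat_geo.
rewrite (@big_cat_nat _ _ _ k0)//= mulrDr e1 in e2.
set S0 := \sum_(0 <= n < k0) n%:R * wt rho n in e1 *.
set S1 := \sum_(k0 <= n < k) n%:R * wt rho n in e2 *.
have Tk : 0 <= rho ^+ k * (rho + s * k%:R).
  by rewrite mulr_ge0 ?exprn_ge0 ?addr_ge0 ?mulr_ge0// ltW.
have S1T : s * S1 <= T by lra.
have CS1 : C * S1 <= e * S0.
  rewrite -(ler_pM2l s0).
  have h1 : C * (s * S1) <= C * T by rewrite ler_pM2l.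
  have h2 : e * 4^-1 <= e * (s * S0) by rewrite ler_pM2l//; lra.
  lra.
rewrite mulrA (mulrDr e).
apply: le_trans (_ : e * S0 * G x <= _); first by rewrite ler_wpM2r.
rewrite mulrA lerDl mulr_ge0 ?powR_ge0// ltW//.
Unshelve. all: by end_near. Qed.

Ltac clear_local := clear -mu0 b0 bg g1 q1 gbq gq1 q'0 G_ni G_ge0 G_le1 G_low
  G_up G_scale G_cont p_ge0 p_le1 p_small p_mid p_below p_above S wt_ge0 B_ge0
  B_geG wsum_le wsum_const wsum_ge0 wsum_close trunc_le.

(** The cuts [k0], [k2], [k3], [k4] lie near [delta x], [(1 - eta) x / mu], [(x - x^g) / mu] and
    [(x + x^g) / mu]; [S] stops at [MM], inside the window. Below [k0] the two sums agree up to [e],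
    up to [k3] all blocks of both are errors, and from [k3] on the series yields [r] while [S]
    contributes only an error. *)
Lemma heavy_traffic delta (C1 e : R) : 0 < e <= 1 -> 0 < delta -> delta * mu <= 2^-1 ->
  0 < C1 ->
  (\forall x \near +oo, forall n, n%:R <= delta * x -> `|p n x - B n x| <= e * B n x) ->
  \forall x \near +oo, forall rho w, 0 < rho < 1 -> (1 - rho) * x <= C1 * ln x ->
    mixture_bounds rho x w ->
    `|w - (S rho x + rho `^ (x / mu))| <= 5 * e * (S rho x + rho `^ (x / mu)).
Proof.
move=> /andP[e0 e1] d0 dmu C10 near_small.
pose tau := g * q - 1; have tau0 : 0 < tau by rewrite subr_gt0.
have tau20 : 0 < tau / 2 by rewrite divr_gt0.
have g0 : 0 < g by exact: lt_trans bg.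
have b1 : b < 1 by exact: lt_trans g1.
have den0 : 0 < 4 * C1 + 4 * (tau * mu) by rewrite addr_gt0// !mulr_gt0.
(* Moving the exponent from [x / mu] down to [k2] costs [expR (2 s eta x / mu)], at most
   [x^(2 C1 eta / mu)]. This [eta] keeps it below [x^(tau / 2)], which loses against the bound
   [x^(- tau)] on the terms between [k2] and [k3]. [eta <= 1/4] gives [k0 <= k2]. *)
have [eta [eta0 eta4 etaC]] : exists eta,
    [/\ 0 < eta, eta <= 4^-1 & 2 * C1 * eta / mu <= tau / 2].
  exists (tau * mu / (4 * C1 + 4 * (tau * mu))); split.
  - by rewrite divr_gt0// mulr_gt0.
  - by rewrite ler_pdivrMr//; lra.
  rewrite ler_pdivrMr// mulrA ler_pdivrMr//.
  have : 0 <= (tau * mu) * (tau * mu) by rewrite -expr2 sqr_ge0.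
  nra.
have eta01 : 0 < eta < 1 by rewrite eta0/=; lra.
have eta1 : 0 <= 1 - eta by lra.
have e1' : 0 <= 1 - e by lra.
have [C2 C20 near_mid] := p_mid eta01.
have [C3 C30 near_scale] := G_scale eta01.
have [K2 K20 near_below] := p_below.
have [K K0 GK] := G_up.
pose C := C2 + C3; have C0 : 0 < C by rewrite addr_gt0.
have near_mn := middle_negligible d0 C0 C10 e0.
have near_ab := p_above e0.
have ln1e : 0 < ln (1 + e) by rewrite ln_gt0// ltrDl.
have e30 : 0 < e / 3 by rewrite divr_gt0.
near=> x => rho w rho01 sx [w_up w_lo].
have [r0 r1] := andP rho01.
have x1 : 1 <= x by near: x; exact: near_pinfty_ge.
have x0 : 0 < x by exact: lt_le_trans x1.
have small : forall n, n%:R <= delta * x -> `|p n x - B n x| <= e * B n x by near: x.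
have mid : forall n, n%:R * mu <= (1 - eta) * x -> p n x <= C2 * (n%:R * G x).
  by near: x.
have scale : G (eta * x) <= C3 * G x by near: x.
have below : forall n, n%:R * mu <= x - x `^ g -> p n x <= K2 * x `^ (1 - g * q).
  by near: x.
have above : forall n, x + x `^ g <= n%:R * mu -> 1 - e <= p n x by near: x.
have mn : forall rho k, 2^-1 <= rho < 1 -> (1 - rho) * x <= C1 * ln x ->
    ((Num.truncn (delta * x)).+1 <= k)%N -> k%:R <= x / mu + 1 ->
    C * \sum_((Num.truncn (delta * x)).+1 <= n < k) wt rho n * (n%:R * G x) <=
    e * (\sum_(0 <= n < (Num.truncn (delta * x)).+1) wt rho n * (n%:R * G x)
         + rho `^ (x / mu)) by near: x.
have xN1 : x `^ (-1) = x^-1 by rewrite powRN powRr1// ltW.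
set s := 1 - rho in sx *.
have s0 : 0 < s by rewrite subr_gt0.
have sx' : s <= C1 * ln x * x `^ (-1) by rewrite xN1 ler_pdivlMr.
have rh : 2^-1 <= rho < 1.
  rewrite r1 andbT; have : C1 * ln x * x `^ (-1) <= 2^-1.
    by near: x; exact: near_ln_powRN_le.
  by move: sx'; rewrite /s; move: (C1 * _ * _) => u; clear_local; lra.
have xg1 : 1 <= x `^ g by rewrite powR_ge1// ltW.
have xb1 : 1 <= x `^ b by rewrite powR_ge1// ltW.
have xbg : x `^ b <= x `^ g by rewrite ler_powR// ltW.
have xg4 : x `^ g <= x / 4.
  have : x `^ (- (1 - g)) <= 4^-1.
    by near: x; apply: near_powRN_le => //; rewrite subr_gt0.
  rewrite opprB powRB ?(gt_eqF x0) ?implybT// powRr1 ?(ltW x0)//.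
  by rewrite ler_pdivrMr// mulrC.
have xmu0 : 0 < x / mu by rewrite divr_gt0.
have D0 : 0 <= x `^ g / mu + 1 by rewrite addr_ge0// divr_ge0 ?powR_ge0// ltW.
have xgmu0 : 0 <= x `^ g / mu by rewrite divr_ge0 ?powR_ge0// ltW.
have sg : s * (x `^ g / mu + 1) <= C1 * (mu^-1 + 1) * ln x * x `^ (- (1 - g)).
  apply: le_trans (_ : C1 * ln x * x `^ (-1) * ((mu^-1 + 1) * x `^ g) <= _).
    apply: ler_pM => //; first exact: ltW.
    by rewrite mulrDl mulrC mul1r lerD2l.
  have -> : - (1 - g) = -1 + g by ring.
  rewrite powRD ?(gt_eqF x0) ?implybT//.
  by rewrite le_eqVlt; apply/orP; left; apply/eqP; ring.
have Ee : expR (2 * s * (x `^ g / mu + 1)) <= 1 + e.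
  rewrite -[leRHS]lnK ?posrE ?addr_gt0// ler_expR -mulrA.
  have : C1 * (mu^-1 + 1) * ln x * x `^ (- (1 - g)) <= ln (1 + e) / 2.
    by near: x; apply: near_ln_powRN_le; [rewrite subr_gt0|rewrite divr_gt0].
  move: sg; move: (s * _) (ln (1 + e)) (C1 * _ * _ * _) => u v t; clear_local; lra.
have [xg Exg] : exists y, y = x `^ g by exists (x `^ g).
have [xb Exb] : exists y, y = x `^ b by exists (x `^ b).
rewrite -Exg in xg1 xbg xg4 D0 xgmu0 Ee below above sg.
rewrite -Exb in xb1 xbg.
set r := rho `^ (x / mu).
have rr0 : 0 <= r by exact: powR_ge0.
have xxg : 0 <= x - xg by move: xg4 x0; clear_local; lra.
have xxb : 0 <= x - xb by move: xg4 xbg x0; clear_local; lra.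
have xpg : 0 <= x + xg by move: xg1 x0; clear_local; lra.
set k0 := (Num.truncn (delta * x)).+1 in mn *.
set k2 := (Num.truncn ((1 - eta) * x / mu)).+1.
set k3 := (Num.truncn ((x - xg) / mu)).+1.
set k4 := (Num.truncn ((x + xg) / mu)).+1.
set MM := (Num.truncn ((x - xb) / mu)).+1.
have a2 : 0 <= (1 - eta) * x / mu.
  by rewrite divr_ge0 ?mulr_ge0 ?(ltW mu0) ?(ltW x0).
have a3 : 0 <= (x - xg) / mu by rewrite divr_ge0 ?(ltW mu0).
have aM : 0 <= (x - xb) / mu by rewrite divr_ge0 ?(ltW mu0).
have k02 : (k0 <= k2)%N.
  rewrite ltnS le_truncn// ler_pdivlMr// mulrAC ler_pM2r//; move: dmu eta4; clear_local; lra.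
have k23 : (k2 <= k3)%N.
  rewrite ltnS le_truncn// ler_pM2r ?invr_gt0//.
  rewrite mulrBl mul1r lerD2l lerN2.
  have : x `^ (- (1 - g)) <= eta.
    by near: x; apply: near_powRN_le => //; rewrite subr_gt0.
  by rewrite opprB powRB ?(gt_eqF x0) ?implybT// powRr1 ?(ltW x0)// -Exg ler_pdivrMr.
have k3M : (k3 <= MM)%N by rewrite ltnS le_truncn// ler_pM2r ?invr_gt0// lerB.
have k34 : (k3 <= k4)%N.
  rewrite ltnS le_truncn// ler_pM2r ?invr_gt0//; move: xg1; clear_local; lra.
have k2x : k2%:R <= x / mu + 1.
  rewrite -natr1 lerD2r; apply: le_trans (_ : (1 - eta) * x / mu <= _).
    by rewrite truncn_le.
  rewrite ler_pM2r ?invr_gt0// mulrBl mul1r gerBl mulr_ge0// ltW//.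
have rk3 : rho ^+ k3 <= (1 + e) * r.
  rewrite -powR_mulrn ?(ltW r0)// mulrC.
  apply: le_trans (@rho_powR_shift R rho _ (x / mu) (xg / mu + 1) rh D0 _) _.
    have := truncnS_gt ((x - xg) / mu); rewrite -/k3 mulrBl; move: k3%:R (x / mu) (xg / mu) => u v t; clear_local; lra.
  by rewrite ler_wpM2l ?powR_ge0.
have rk4 : r <= (1 + e) * rho ^+ k4.
  rewrite -powR_mulrn ?(ltW r0)// mulrC.
  apply: le_trans (@rho_powR_shift R rho _ k4%:R (xg / mu + 1) rh D0 _) _.
    have : k4%:R <= (x + xg) / mu + 1.
      by rewrite -natr1 lerD2r truncn_le divr_ge0 ?(ltW mu0).
    rewrite mulrDl; move: k4%:R (x / mu) (xg / mu) => ? ? ?; clear_local; lra.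
  by rewrite ler_wpM2l ?powR_ge0.
have rk2 : rho ^+ k2 <= r * x `^ (tau / 2).
  have D20 : 0 <= eta * x / mu by rewrite divr_ge0 ?mulr_ge0// ltW.
  rewrite -powR_mulrn ?(ltW r0)//.
  apply: le_trans (@rho_powR_shift R rho _ (x / mu) (eta * x / mu) rh D20 _) _.
    have := truncnS_gt ((1 - eta) * x / mu); rewrite -/k2 mulrBl mul1r mulrBl.
    move: k2%:R (x / mu) (eta * x / mu) => u v t; clear_local; lra.
  rewrite ler_wpM2l ?powR_ge0// (powR_expR _ x0) ler_expR -/s.
  apply: le_trans (_ : 2 * C1 * eta / mu * ln x <= _); last first.
    by rewrite ler_wpM2r// ln_ge0.
  have : eta / mu * (s * x) <= eta / mu * (C1 * ln x).
    by rewrite ler_wpM2l// divr_ge0 ?(ltW eta0) ?(ltW mu0).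
  move: (ln x) mu^-1 => u v; clear_local; lra.
have xtau : x `^ (- tau) * x `^ (tau / 2) = x `^ (- (tau / 2)).
  by rewrite -powRD ?(gt_eqF x0) ?implybT//; congr powR; clear_local; lra.
have tail23 (f : nat -> R) (K' : R) : 0 <= K' -> K' * x `^ (- (tau / 2)) <= e / 3 ->
    (forall n, n%:R * mu <= x - xg -> f n <= K' * x `^ (- tau)) ->
    \sum_(k2 <= n < k3) wt rho n * f n <= e / 3 * r.
  move=> K'0 K'e fK; apply: le_trans (@wsum_le _ _ _ _ (fun=> K' * x `^ (- tau)) rho01 _) _.
    move=> n /andP[_ nk]; apply: fK.
    by rewrite -ler_pdivlMr//; apply: trunc_le nk a3.
  apply: le_trans (wsum_const rho01 _ k23) _; first by rewrite mulr_ge0 ?powR_ge0.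
  apply: le_trans (ler_wpM2l _ rk2) _; first by rewrite mulr_ge0 ?powR_ge0.
  rewrite [leLHS](_ : _ = K' * (x `^ (- tau) * x `^ (tau / 2)) * r); last by ring.
  by rewrite xtau ler_wpM2r.
set P0 := \sum_(0 <= n < k0) wt rho n * p n x.
set S0 := \sum_(0 <= n < k0) wt rho n * B n x.
set P1 := \sum_(k0 <= n < k2) wt rho n * p n x.
set S1 := \sum_(k0 <= n < k2) wt rho n * B n x.
set P2 := \sum_(k2 <= n < k3) wt rho n * p n x.
set S2 := \sum_(k2 <= n < k3) wt rho n * B n x.
set P3 := \sum_(k3 <= n < k4) wt rho n * p n x.
set S3 := \sum_(k3 <= n < MM) wt rho n * B n x.
have ES : S rho x = S0 + S1 + S2 + S3.
  rewrite /S -Exb -/MM (@big_cat_nat _ _ _ k3)//=; congr (_ + _).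
  rewrite (@big_cat_nat _ _ _ k2)//=; congr (_ + _).
  by rewrite (@big_cat_nat _ _ _ k0).
have EP : \sum_(0 <= n < k4) wt rho n * p n x = P0 + P1 + P2 + P3.
  rewrite (@big_cat_nat _ _ _ k3)//=; congr (_ + _).
  rewrite (@big_cat_nat _ _ _ k2)//=; congr (_ + _).
  by rewrite (@big_cat_nat _ _ _ k0).
have wu := w_up k4; have wl := w_lo k4 (1 - e).
have {}wl : \sum_(0 <= n < k4) wt rho n * p n x + (1 - e) * rho ^+ k4 <= w.
  apply: wl => n k4n; apply: above; rewrite -ler_pdivrMr// ltW//.
  by apply: lt_le_trans (truncnS_gt _) _; rewrite ler_nat.
rewrite -/(wt _ _) EP in wu; rewrite EP in wl.
have S00 : 0 <= S0 by exact: wsum_ge0.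
have S10 : 0 <= S1 by exact: wsum_ge0.
have S20 : 0 <= S2 by exact: wsum_ge0.
have S30 : 0 <= S3 by exact: wsum_ge0.
have P10 : 0 <= P1 by exact: wsum_ge0.
have P20 : 0 <= P2 by exact: wsum_ge0.
have P30 : 0 <= P3 by exact: wsum_ge0.
have PS0 : `|P0 - S0| <= e * S0.
  apply: wsum_close => // n /andP[_ nk]; apply: small.
  by apply: trunc_le nk _; rewrite mulr_ge0// ltW.
have P1S1 : P1 + S1 <= e * (S0 + r).
  apply: le_trans (_ : e * (\sum_(0 <= n < k0) wt rho n * (n%:R * G x) + r) <= _).
    apply: le_trans (mn rho k2 rh sx k02 k2x).
    rewrite /C mulrDl; apply: lerD.
      rewrite /P1 mulr_sumr big_nat [leRHS]big_nat; apply: ler_sum => n /andP[_ nk].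
      rewrite mulrCA ler_wpM2l ?wt_ge0//; apply: mid.
      by rewrite -ler_pdivlMr//; apply: trunc_le nk a2.
    rewrite /S1 mulr_sumr big_nat [leRHS]big_nat; apply: ler_sum => n /andP[_ nk].
    rewrite [leRHS]mulrCA ler_wpM2l ?wt_ge0// /B [leRHS]mulrCA ler_wpM2l//.
    apply: le_trans scale; apply: G_ni.
    have : n%:R * mu <= (1 - eta) * x.
      by rewrite -ler_pdivlMr//; apply: trunc_le nk a2.
    have : n.-1%:R * mu <= n%:R * mu by rewrite ler_pM2r// ler_nat leq_pred.
    move: (n.-1%:R * mu) (n%:R * mu) => u v; clear_local; lra.
  rewrite ler_pM2l// lerD2r; apply: (@wsum_le rho 0 k0 _ (B ^~ x) rho01) => n _.
  exact: B_geG.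
have P2e : P2 <= e / 3 * r.
  apply: (tail23 _ K2); first exact: ltW.
    by rewrite mulrC -ler_pdivlMr//; near: x; apply: near_powRN_le; rewrite ?divr_gt0.
  by move=> n /below; rewrite /tau opprB.
have B_le n : n%:R * mu <= x -> forall a, 0 <= a -> x `^ a <= x - n%:R * mu ->
    B n x <= K / mu * x `^ (1 - a * q).
  move=> nx a a0 ax; rewrite powRB ?(gt_eqF x0) ?implybT// powRr1 ?(ltW x0)//.
  rewrite [leRHS](_ : _ = x / mu * (K * (x `^ (a * q))^-1)); last by ring.
  apply: ler_pM => //; first by rewrite ler_pdivlMr.
  rewrite powRrM -powRN.
  apply: le_trans (GK _ _); last by rewrite powR_gt0.
  apply: G_ni; apply: le_trans ax _; rewrite lerB// ler_pM2r// ler_nat leq_pred//.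
have S2e : S2 <= e / 3 * r.
  apply: (tail23 _ (K / mu)); first by rewrite divr_ge0// ltW.
    rewrite mulrC -ler_pdivlMr ?divr_gt0//.
    by near: x; apply: near_powRN_le; rewrite ?divr_gt0.
  move=> n nx; rewrite /tau opprB; apply: B_le; rewrite -?Exg ?(ltW g0)//; move: nx xg1; clear_local; lra.
(* The termwise bound [x^(1 - b q)] may grow with [x]. The weights compensate: at most
   [x^g / mu + 1] of them, each at most [s (1 + e) r] with [s = O(ln x / x)], so the block is
   [O(x^(g - b q) ln x) r]. *)
have S3e : S3 <= e / 3 * r.
  apply: le_trans (@wsum_le _ _ _ _ (fun=> K / mu * x `^ (1 - b * q)) rho01 _) _.
    move=> n /andP[_ nk]; have : n%:R * mu <= x - xb.
      by rewrite -ler_pdivlMr//; apply: trunc_le nk aM.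
    by move=> nx; apply: B_le; rewrite -?Exb ?(ltW b0)//; move: nx xb1; clear_local; lra.
  have Kb0 : 0 <= K / mu * x `^ (1 - b * q).
    by rewrite mulr_ge0 ?powR_ge0// divr_ge0// ltW.
  rewrite -mulr_suml mulrC.
  have h1 : \sum_(k3 <= n < MM) wt rho n <= s * ((1 + e) * r) * (xg / mu + 1).
    rewrite big_nat; apply: le_trans (_ : \sum_(k3 <= n < MM) s * ((1 + e) * r) <= _).
      rewrite [leRHS]big_nat; apply: ler_sum => n /andP[kn _].
      rewrite ler_pM2l//; apply: le_trans rk3.
      by apply: ler_wiXn2l => //; exact: ltW.
    rewrite sumr_const_nat -[leLHS]mulr_natr ler_wpM2l//.
      by rewrite mulr_ge0 ?(ltW s0)// mulr_ge0// addr_ge0// ltW.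
    have hM : MM%:R <= (x - xb) / mu + 1 by rewrite -natr1 lerD2r truncn_le.
    have h3 : (x - xg) / mu < k3%:R by exact: truncnS_gt.
    have hb : 0 <= xb / mu by rewrite divr_ge0 ?(ltW mu0)//; apply: le_trans xb1.
    move: hM h3 hb; rewrite natrB// !mulrBl.
    move: MM%:R k3%:R (x / mu) (xg / mu) (xb / mu) => ? ? ? ? ?; clear_local; lra.
  apply: le_trans (ler_wpM2l Kb0 h1) _.
  rewrite [leLHS](_ : _ = K / mu * x `^ (1 - b * q) * (s * (xg / mu + 1)) * (1 + e) * r);
    last by ring.
  rewrite ler_wpM2r//.
  apply: le_trans (_ : K / mu * x `^ (1 - b * q) * (s * (xg / mu + 1)) * 2 <= _).
    rewrite ler_wpM2l//; last by move: e1; clear_local; lra.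
    by rewrite mulr_ge0// mulr_ge0// ltW.
  apply: le_trans (_ : K / mu * x `^ (1 - b * q) *
     (C1 * (mu^-1 + 1) * ln x * x `^ (- (1 - g))) * 2 <= _).
    by rewrite ler_wpM2r// ler_wpM2l.
  have -> : K / mu * x `^ (1 - b * q) * (C1 * (mu^-1 + 1) * ln x * x `^ (- (1 - g))) * 2
    = (K / mu * C1 * (mu^-1 + 1) * 2) * ln x * (x `^ (1 - b * q) * x `^ (- (1 - g))).
    by ring.
  rewrite -powRD ?(gt_eqF x0) ?implybT//.
  have -> : 1 - b * q - (1 - g) = - (b * q - g) by ring.
  by near: x; apply: near_ln_powRN_le => //; rewrite subr_gt0.
(* Inside the window [0 <= p n x <= 1] is enough: [P3] together with everything above it is at most
   [rho ^+ k3] and at least [(1 - e) * rho ^+ k4], and both are close to [r]. *)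
have P3le : P3 + rho ^+ k4 <= (1 + e) * r.
  apply: le_trans rk3; rewrite -lerBrDr -sum_geo//.
  rewrite /P3; apply: ler_sum => n _; rewrite -[leRHS]mulr1 ler_wpM2l ?wt_ge0//.
have rk4' : (1 - e) * r <= rho ^+ k4.
  have R4 : 0 <= rho ^+ k4 by rewrite exprn_ge0// ltW.
  apply: le_trans (_ : (1 - e) * ((1 + e) * rho ^+ k4) <= _).
    by rewrite ler_wpM2l.
  move: (rho ^+ k4) R4 => u; clear_local; nra.
have rk4'' : (1 - e - e) * r <= (1 - e) * rho ^+ k4.
  apply: le_trans (_ : (1 - e) * ((1 - e) * r) <= _); last by rewrite ler_wpM2l.
  have : 0 <= e * e * r by rewrite mulr_ge0// mulr_ge0// ltW.
  move: (r); clear_local => ? ?; lra.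
rewrite ES -/r.
have eS : 0 <= e * (S1 + S2 + S3) by rewrite mulr_ge0 ?addr_ge0// ltW.
have eS0 : 0 <= e * S0 by rewrite mulr_ge0// ltW.
have er : 0 <= e * r by rewrite mulr_ge0// ltW.
move: PS0 P1S1 P2e S2e S3e P3le wu wl rk4'' eS eS0 er S00 S10 S20 S30 P10 P20 P30 rr0.
move: (S0) (S1) (S2) (S3) (P0) (P1) (P2) (P3) (r) (rho ^+ k4).
clear_local => ? ? ? ? ? ? ? ? ? ?; rewrite !ler_norml => /andP[] *.
by apply/andP; split; lra.
Unshelve. all: by end_near. Qed.

(** [light_traffic] produces its constant [C1], and [heavy_traffic] accepts any, so the two cases
    exhaust all [rho] beyond a common threshold on [x]. *)
Lemma mixture_asymptotics (e : R) : 0 < e ->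
  \forall x \near +oo, forall rho w, 0 < rho < 1 -> mixture_bounds rho x w ->
    `|w - (S rho x + rho `^ (x / mu))| <= e * (S rho x + rho `^ (x / mu)).
Proof.
move=> e0; pose e' := Num.min 1 (e / 5).
have e'0 : 0 < e' by rewrite lt_min ltr01 divr_gt0.
have e'1 : 0 < e' <= 1 by rewrite e'0 ge_min lexx.
have e'e : 5 * e' <= e by rewrite -ler_pdivlMl// mulrC ge_min lexx orbT.
have e'2 : 2 * e' <= e by lra.
have [delta [d0 dmu] near_small] := B_small e'0.
have [C1 C10 near_light] := light_traffic e'0 d0 dmu near_small.
have near_heavy := heavy_traffic e'1 d0 dmu C10 near_small.
move: near_light near_heavy; apply: filterS2 => x light heavy rho w rho01 mix.
have U0 : 0 <= S rho x + rho `^ (x / mu).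
  by rewrite addr_ge0 ?powR_ge0//; apply: wsum_ge0.
have [h|/ltW h] := leP (C1 * ln x) ((1 - rho) * x).
  by apply: le_trans (light _ _ rho01 h mix) _; rewrite ler_wpM2r.
by apply: le_trans (heavy _ _ rho01 h mix) _; rewrite ler_wpM2r.
Qed.

End core.

(** * Regularly varying tails *)

Section tail_regularity.
Context {R : realType}.
Implicit Types (x y u v e eta : R).

Lemma near_pinfty_ex (P : R -> Prop) : (\forall x \near +oo, P x) ->
  exists2 x0 : R, 1 <= x0 & forall x, x0 <= x -> P x.
Proof.
move=> [x0 [_ h]]; exists (Num.max 1 (x0 + 1)); first by rewrite le_max lexx.
by move=> x; rewrite ge_max => /andP[_ x0x]; apply: h; apply: lt_le_trans x0x; rewrite ltrDl.
Qed.

Lemma near_pinfty_of_ge (P : R -> Prop) (x0 : R) : (forall x, x0 <= x -> P x) ->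
  \forall x \near +oo, P x.
Proof. by move=> h; near=> x; apply: h. Unshelve. all: by end_near. Qed.

Lemma dyadic_le (f : R -> R) (x0 : R) : 0 < x0 ->
  (forall x, x0 <= x -> f (2 * x) <= f x) ->
  forall n x, x0 <= x -> f (2 ^+ n * x) <= f x.
Proof.
move=> x00 f2; elim=> [|n IH] x x0x; first by rewrite expr0 mul1r.
rewrite exprSr -mulrA; apply: le_trans (f2 _ x0x); apply: IH.
by rewrite (le_trans x0x)// ler_peMl ?ler1n// (le_trans (ltW x00)).
Qed.

(** Repeated halving brings every [x >= x0] into [[x0, 2 x0]] without decreasing [f]. *)
Lemma dyadic_bound (f : R -> R) (x0 K : R) : 0 < x0 ->
  (forall x, x0 <= x -> f (2 * x) <= f x) ->
  (forall x, x0 <= x <= 2 * x0 -> f x <= K) ->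
  forall x, x0 <= x -> f x <= K.
Proof.
move=> x00 f2 fK.
have key n : forall x, x0 <= x <= 2 ^+ n.+1 * x0 -> f x <= K.
  elim: n => [|n IH] x /andP[x0x xn]; first by apply: fK; rewrite x0x.
  have [xx0|/ltW xx0] := leP x (2 * x0); first by apply: fK; rewrite x0x.
  have h : x0 <= x / 2 by rewrite ler_pdivlMr// mulrC.
  have -> : x = 2 * (x / 2) by field.
  apply: le_trans (f2 _ h) _; apply: IH; rewrite h/=.
  by rewrite ler_pdivrMr// mulrAC -exprSr.
move=> x x0x; have := @Num.Theory.truncnS_gt R (x / x0).
set n := (Num.truncn _).+1 => hn; apply: (key n); rewrite x0x/=.
rewrite -ler_pdivrMr//; apply: le_trans (ltW hn) _.
by rewrite -natrX ler_nat (leq_trans (leqnSn n))// ltnW// ltn_expl.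
Qed.

(** [F] is the density of [X_1] and [G] its tail. [G_incr] bounds the integral of the nonincreasing
    [F] over []u, v]] by rectangles. All powers of [x] below come from iterating the comparison of
    [F x] with [F (2 * x)]. *)
Variables (F G : R -> R) (q c1 : R).
Hypothesis F_ni : forall x y, x <= y -> F y <= F x.
Hypothesis F_ge0 : forall x, 0 <= F x.
Hypothesis G_incr : forall u v, 0 <= u -> u <= v ->
  (v - u) * F v <= G u - G v <= (v - u) * F u.
Hypothesis G_ni : forall x y, x <= y -> G y <= G x.
Hypothesis G_ge0 : forall x, 0 <= G x.
Hypothesis G_le1 : forall x, G x <= 1.
Hypothesis G_cvg0 : forall e : R, 0 < e -> \forall x \near +oo, G x <= e.
Hypothesis q1 : 1 < q.
Hypothesis F_upper : \forall x \near +oo, F (2 * x) <= 2 `^ (- (q + 1)) * F x.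
Hypothesis c10 : 0 < c1.
Hypothesis F_lower : \forall x \near +oo, c1 * F x <= F (2 * x).
Hypothesis F_gt0 : \forall x \near +oo, 0 < F x.

Lemma density_powR_le : exists2 K : R, 0 <= K & exists2 x0 : R, 1 <= x0 &
  forall x, x0 <= x -> x * F x <= K * x `^ (- q).
Proof.
have [x0 x01 F2] := near_pinfty_ex F_upper; have x00 : 0 < x0 by exact: lt_le_trans x01.
exists (F x0 * (2 * x0) `^ (q + 1)); first by rewrite mulr_ge0 ?powR_ge0.
exists x0 => // x x0x; have xp : 0 < x by exact: lt_le_trans x0x.
rewrite powRN ler_pdivlMr ?powR_gt0// mulrC mulrA.
have -> : x `^ q * x = x `^ (q + 1).
  by rewrite powRD ?(gt_eqF xp) ?implybT// powRr1// ltW.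
rewrite mulrC.
apply: (@dyadic_bound (fun x => F x * x `^ (q + 1)) x0) => // [y x0y|y /andP[x0y yx0]].
  have y0 : 0 < y by exact: lt_le_trans x0y.
  apply: le_trans (ler_wpM2r (powR_ge0 _ _) (F2 _ x0y)) _.
  rewrite powRM ?(ltW y0)// mulrACA -powRD ?pnatr_eq0 ?implybT//.
  by rewrite addNr powRr0 mul1r mulrC.
apply: ler_pM => //; rewrite ?powR_ge0 ?F_ni//.
have q10 : 0 <= q + 1 by have := q1; lra.
by apply: ge0_ler_powR; rewrite ?nnegrE//; lra.
Qed.

(** The constant [K'] solves [K' (1 - 2^(-q)) = K], the sum of the geometric series of increments of
    [G] over dyadic intervals. Thus [K' x^(-q) - G x] does not increase under doubling, and it is
    nonnegative because [G] tends to [0]. *)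
Lemma tail_powR_le : exists2 K : R, 0 < K & forall y, 0 < y -> G y <= K * y `^ (- q).
Proof.
have [K K0 [x0 x01 FK]] := density_powR_le; have x00 : 0 < x0 by exact: lt_le_trans x01.
have q2 : 0 < 1 - 2 `^ (- q).
  rewrite subr_gt0 powRN invf_lt1 ?powR_gt0//.
  by apply: lt_le_trans (_ : 2 <= _); rewrite ?ltr1n// le1r_powR ?ler1n// ltW.
pose K' := K / (1 - 2 `^ (- q)).
have K'0 : 0 <= K' by rewrite divr_ge0// ltW.
have dec y : x0 <= y ->
    K' * (2 * y) `^ (- q) - G (2 * y) <= K' * y `^ (- q) - G y.
  move=> x0y; have y0 : 0 < y by exact: lt_le_trans x0y.
  have y2 : y <= 2 * y by lra.
  have /andP[_ h] := G_incr (ltW y0) y2.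
  have := FK _ x0y; rewrite powRM ?(ltW y0)//.
  have -> : K = K' * (1 - 2 `^ (- q)) by rewrite /K' divfK// gt_eqF.
  by rewrite (_ : 2 * y - y = y) in h; [lra|ring].
have big x : x0 <= x -> G x <= K' * x `^ (- q).
  move=> x0x; have xp : 0 < x by exact: lt_le_trans x0x.
  rewrite -subr_le0; apply/ler_addgt0Pr => e e0; rewrite add0r.
  have [x1 x11 Ge] := near_pinfty_ex (G_cvg0 e0).
  pose n := (Num.truncn x1).+1.
  have := dyadic_le x00 dec n x0x.
  have Gn : G (2 ^+ n * x) <= e.
    apply: Ge; apply: le_trans (ltW (truncnS_gt x1)) _; rewrite -/n.
    apply: le_trans (_ : 2 ^+ n <= _).
      by rewrite -natrX ler_nat ltnW// ltn_expl.
    by rewrite ler_peMr ?exprn_ge0// (le_trans x01).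
  have : 0 <= K' * (2 ^+ n * x) `^ (- q) by rewrite mulr_ge0 ?powR_ge0.
  lra.
exists (Num.max (K' + 1) (x0 `^ q)); first by rewrite lt_max ltr_wpDl.
move=> y y0; have [x0y|/ltW yx0] := leP x0 y.
  apply: le_trans (big _ x0y) _; rewrite ler_wpM2r ?powR_ge0//.
  by rewrite le_max lerDl ler01.
apply: le_trans (G_le1 _) _; rewrite powRN ler_pdivlMr ?powR_gt0// mul1r.
rewrite le_max; apply/orP; right.
by apply: ge0_ler_powR; rewrite ?nnegrE//; have := q1; lra.
Qed.

(** The increment of [G] over [[(1 - eta) x, x]] is at most [eta x F(x / 2)]. Two applications of
    [F_lower] replace [F(x / 2)] by [F(2 x)], and [x F(2 x) <= G x]. *)
Lemma tail_left_le : exists2 C : R, 0 < C & exists2 x0 : R, 1 <= x0 &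
  forall x eta, x0 <= x -> 0 <= eta <= 2^-1 -> G ((1 - eta) * x) <= (1 + C * eta) * G x.
Proof.
have [x0 x01 Fl] := near_pinfty_ex F_lower; have x00 : 0 < x0 by exact: lt_le_trans x01.
exists (c1 ^- 2); first by rewrite invr_gt0 exprn_gt0.
exists (2 * x0) => [|x eta xx0 /andP[e0 e2]]; first by lra.
have x0' : 0 <= x by lra.
have Fx : F (x / 2) <= c1 ^- 2 * F (2 * x).
  rewrite ler_pdivlMl ?exprn_gt0// expr2 -mulrA.
  have h1 : x0 <= x / 2 by lra.
  have h2 : x0 <= x by lra.
  apply: le_trans (Fl _ h2); rewrite ler_pM2l//.
  by apply: le_trans (Fl _ h1) _; rewrite mulrC divfK.
have ex0 : 0 <= eta * x by rewrite mulr_ge0.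
have ex2 : eta * x <= x / 2 by rewrite mulrC ler_wpM2l.
have u0 : 0 <= (1 - eta) * x by lra.
have ux : (1 - eta) * x <= x by lra.
have x2x : x <= 2 * x by lra.
have /andP[_ h1] := G_incr u0 ux.
have /andP[h2 _] := G_incr x0' x2x.
have h3 : F ((1 - eta) * x) <= F (x / 2) by apply: F_ni; lra.
have h4 : (x - (1 - eta) * x) * F ((1 - eta) * x) <= eta * x * (c1 ^- 2 * F (2 * x)).
  rewrite (_ : x - (1 - eta) * x = eta * x); last by ring.
  by rewrite ler_wpM2l// (le_trans h3).
have h5 : eta * x * (c1 ^- 2 * F (2 * x)) <= eta * c1 ^- 2 * G x.
  rewrite (_ : _ * (_ * _) = eta * c1 ^- 2 * ((2 * x - x) * F (2 * x))); last by ring.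
  have C0 : 0 <= c1 ^- 2 by rewrite invr_ge0 exprn_ge0// ltW.
  by rewrite ler_wpM2l ?mulr_ge0//; have := G_ge0 (2 * x); lra.
lra.
Qed.

Lemma tail_half_le : exists2 D : R, 1 < D & exists2 x0 : R, 1 <= x0 &
  forall x, x0 <= x -> G x <= D * G (2 * x).
Proof.
have [C C0 [x0 x01 h]] := tail_left_le; exists (1 + C * 2^-1); first by rewrite ltrDl divr_gt0.
exists x0 => // x x0x; have := h (2 * x) 2^-1.
rewrite (_ : (1 - 2^-1) * (2 * x) = x); last by field.
by apply; lra.
Qed.

Lemma tail_scale_le eta : 0 < eta < 1 ->
  exists2 C : R, 0 < C & \forall x \near +oo, G (eta * x) <= C * G x.
Proof.
move=> /andP[eta0 eta1]; have [D D1 [x0 x01 h]] := tail_half_le.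
have D0 : 0 < D by exact: lt_trans D1.
pose k := (Num.truncn eta^-1).+1.
have k_eta : 2 ^- k <= eta.
  rewrite invf_ple ?posrE ?exprn_gt0//; apply: le_trans (ltW (truncnS_gt _)) _.
  by rewrite -natrX ler_nat ltnW// ltn_expl.
have iter n : forall x, x0 <= x -> G x <= D ^+ n * G (2 ^+ n * x).
  elim: n => [|n IH] x x0x; first by rewrite !expr0 !mul1r.
  apply: le_trans (h _ x0x) _; rewrite exprS -mulrA ler_pM2l// exprSr -mulrA.
  by apply: IH; lra.
exists (D ^+ k); first by rewrite exprn_gt0.
apply: (@near_pinfty_of_ge _ (2 ^+ k * x0)) => x xk.
have x'0 : x0 <= 2 ^- k * x by rewrite ler_pdivlMl ?exprn_gt0.
have := iter k _ x'0; rewrite mulrA divff ?mul1r ?expf_neq0//; apply: le_trans.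
apply: G_ni; rewrite ler_wpM2r//; apply: le_trans xk.
by rewrite mulr_ge0 ?exprn_ge0//; lra.
Qed.

Lemma tail_near1_le e : 0 < e -> exists2 delta : R, 0 < delta < 1 &
  \forall x \near +oo, G ((1 - delta) * x) <= (1 + e) * G x.
Proof.
move=> e0; have [C C0 [x0 x01 h]] := tail_left_le.
have d0 : 0 < Num.min 2^-1 (e / C) by rewrite lt_min invr_gt0 ltr0n divr_gt0.
have d2 : Num.min 2^-1 (e / C) <= 2^-1 by rewrite ge_min lexx.
exists (Num.min 2^-1 (e / C)); first by rewrite d0/=; lra.
apply: (@near_pinfty_of_ge _ x0) => x x0x; apply: le_trans (h _ _ x0x _) _; first by rewrite (ltW d0).
by rewrite ler_wpM2r// lerD2l -ler_pdivlMl// mulrC ge_min lexx orbT.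
Qed.

(** With [q' = ln D / ln 2], that is [2^q' = D], the product [G x * x^q'] does not decrease under
    doubling. [F_gt0] makes it positive at the start. *)
Lemma tail_powR_ge : exists2 q' : R, 0 < q' &
  exists2 c : R, 0 < c & \forall x \near +oo, c * x `^ (- q') <= G x.
Proof.
have [D D1 [x0 x01 h]] := tail_half_le; have D0 : 0 < D by exact: lt_trans D1.
have [x1 x11 Fp] := near_pinfty_ex F_gt0.
pose x2 := Num.max x0 x1.
have x2x0 : x0 <= x2 by rewrite le_max lexx.
have x20 : 0 < x2 by lra.
have ln2 : 0 < ln 2 :> R by rewrite ln_gt0// ltr1n.
pose q' := ln D / ln 2; have q'0 : 0 < q' by rewrite divr_gt0// ln_gt0.
have D2 : 2 `^ q' = D by rewrite powR_expR// /q' divfK ?gt_eqF// lnK.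
have Gp : 0 < G (2 * x2).
  have x24 : 2 * x2 <= 4 * x2 by lra.
  have x2p : 0 <= 2 * x2 by lra.
  have /andP[hG _] := G_incr x2p x24.
  have F4 : 0 < F (4 * x2).
    by apply: Fp; apply: le_trans (_ : x2 <= _); [rewrite le_max lexx orbT|lra].
  have : 0 < (4 * x2 - 2 * x2) * F (4 * x2) by rewrite mulr_gt0//; lra.
  by have := G_ge0 (4 * x2); lra.
exists q' => //; exists (G (2 * x2) * x2 `^ q'); first by rewrite mulr_gt0 ?powR_gt0.
apply: (@near_pinfty_of_ge _ x2) => x x2x; have xp : 0 < x by exact: lt_le_trans x2x.
rewrite powRN ler_pdivrMr ?powR_gt0// -lerN2.
apply: (@dyadic_bound (fun x => - (G x * x `^ q')) x2) => // [y x2y|y /andP[x2y yx2]].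
  have y0 : 0 < y by exact: lt_le_trans x2y.
  rewrite lerN2 powRM ?(ltW y0)// D2 mulrA ler_wpM2r ?powR_ge0// mulrC h//.
  exact: le_trans x2y.
rewrite lerN2; apply: ler_pM; rewrite ?powR_ge0 ?G_ni//.
by apply: ge0_ler_powR; rewrite ?nnegrE ?(ltW q'0)//; lra.
Qed.
End tail_regularity.

(** * Expectations of products of independent variables *)

Section independence.
Context {R : realType} {d : measure_display} {T : measurableType d}.
Variable P : probability T R.
Import HBNNSimple.

Lemma integral_simple_mul (Y H : T -> R) (g : {nnsfun R >-> R}) :
  measurable_fun setT Y -> measurable_fun setT H -> (forall w, 0 <= H w) ->
  (\int[P]_w (g (Y w) * H w)%:E =
   \sum_(y \in range g) (y%:E * \int[P]_w (\1_(g @^-1` [set y]) (Y w) * H w)%:E))%E.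
Proof.
move=> mY mH H0.
have mind y : measurable_fun setT (fun w => \1_(g @^-1` [set y]) (Y w) : R).
  by apply: (measurableT_comp (f := \1_(g @^-1` [set y]) : R -> R)).
have mindH y : measurable_fun setT (fun w => (\1_(g @^-1` [set y]) (Y w) * H w)%:E).
  by apply/measurable_EFinP; apply: measurable_funM.
transitivity (\int[P]_w (\sum_(y \in range g)
    (y%:E * (\1_(g @^-1` [set y]) (Y w) * H w)%:E)))%E.
  apply: eq_integral => w _; rewrite fimfunE !fsbig_finite//= big_distrl/= -sumEFin.
  by apply: eq_bigr => y _; rewrite -EFinM mulrA.
rewrite ge0_integral_fsum//=; last 2 first.
- by move=> y; apply: measurable_funeM.
- by move=> y w _; rewrite EFinM muleA mule_ge0// ?nnfun_muleindic_ge0// lee_fin.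
apply: eq_fsbigr => y /set_mem[r _ <-].
by rewrite ge0_integralZl// => [w _|]; rewrite lee_fin// mulr_ge0.
Qed.

(* Monotone convergence along simple approximations of [f]. *)
Lemma integral_comp_mul (Y H H' : T -> R) (f : R -> R) :
  measurable_fun setT Y -> measurable_fun setT H -> measurable_fun setT H' ->
  (forall w, 0 <= H w) -> (forall w, 0 <= H' w) ->
  measurable_fun setT f -> (forall y, 0 <= f y) ->
  (forall B, measurable B ->
    \int[P]_w (\1_B (Y w) * H w)%:E = \int[P]_w (\1_B (Y w) * H' w)%:E)%E ->
  (\int[P]_w (f (Y w) * H w)%:E = \int[P]_w (f (Y w) * H' w)%:E)%E.
Proof.
move=> mY mH mH' H0 H'0 mf f0 HH'.
have mfE : measurable_fun setT (EFin \o f) by exact/measurable_EFinP.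
pose g := nnsfun_approx measurableT mfE.
have cvg_g (K : T -> R) : measurable_fun setT K -> (forall w, 0 <= K w) ->
    (\int[P]_w (g n (Y w) * K w)%:E @[n --> \oo] --> \int[P]_w (f (Y w) * K w)%:E)%E.
  move=> mK K0; rewrite [X in _ --> X](_ : _ =
      \int[P]_w (limn (fun n => (g n (Y w) * K w)%:E)))%E; last first.
    apply: eq_integral => w _; apply/esym/cvg_lim => //.
    apply: cvg_EFin; first by near=> n.
    apply: cvgMl.
    have fE0 y : setT y -> (0 <= (EFin \o f) y)%E by rewrite lee_fin.
    by have /fine_cvgP[] := cvg_nnsfun_approx measurableT mfE fE0 (I : setT (Y w)).
  apply: cvg_monotone_convergence => //.
  - move=> n; apply/measurable_EFinP; apply: measurable_funM => //.
    by apply: measurableT_comp.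
  - by move=> n w _; rewrite lee_fin mulr_ge0.
  - move=> w _ m n mn; rewrite lee_fin ler_wpM2r//.
    by have /lefP := @nd_nnsfun_approx _ _ _ _ measurableT _ mfE m n mn; exact.
have eq_g n : (\int[P]_w (g n (Y w) * H w)%:E = \int[P]_w (g n (Y w) * H' w)%:E)%E.
  rewrite !integral_simple_mul//; apply: eq_fsbigr => y _; rewrite HH'//.
have := cvg_g H mH H0; under eq_fun do rewrite eq_g.
by move=> cvgH; apply: (cvg_unique _ cvgH (cvg_g H' mH' H'0)).
Unshelve. all: by end_near. Qed.

(* The indicator case is independence itself; the indicators are replaced by
   general functions one at a time, along [J1]. *)
Lemma expectation_prod (I : eqType) (Y : I -> {RV P >-> R}) (f : I -> R -> R)
    (m : I -> R) (J : seq I) :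
  mutually_independent Y -> uniq J ->
  (forall i, measurable_fun setT (f i)) -> (forall i y, 0 <= f i y) ->
  (forall i, \int[P]_w (f i (Y i w))%:E = (m i)%:E)%E ->
  (\int[P]_w (\prod_(i <- J) f i (Y i w))%:E = (\prod_(i <- J) m i)%:E)%E.
Proof.
move=> indep uJ mf f0 fm.
have mfY i : measurable_fun setT (fun w => f i (Y i w)).
  by apply: (measurableT_comp (f := f i)).
have mYB B i : measurable B -> measurable (Y i @^-1` B).
  by move=> mB; rewrite -[X in measurable X]setTI; exact: measurable_funPT.
have mBY B i : measurable B -> measurable_fun setT (fun w => \1_B (Y i w) : R).
  by move=> mB; apply: (measurableT_comp (f := \1_B : R -> R)).
have m0 i : 0 <= m i.
  by rewrite -lee_fin -fm; apply: integral_ge0 => w _; rewrite lee_fin.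
pose b (B : I -> set R) i := fine (P (Y i @^-1` B i)).
have b0 B i : 0 <= b B i by exact: fine_ge0.
have bE B i : (forall i, measurable (B i)) -> (b B i)%:E = P (Y i @^-1` B i).
  by move=> mB; rewrite fineK// fin_num_measure//; exact: mYB.
suff gen J1 : forall J2 (B : I -> set R), uniq (J1 ++ J2) -> (forall i, measurable (B i)) ->
    (\int[P]_w (\prod_(i <- J1) f i (Y i w) * \prod_(i <- J2) \1_(B i) (Y i w))%:E =
    (\prod_(i <- J1) m i * \prod_(i <- J2) b B i)%:E)%E.
  have := gen J [::] (fun=> setT); rewrite cats0 !big_nil mulr1 => <- //.
  by apply: eq_integral => w _; rewrite big_nil mulr1.
elim: J1 => [|j J1 IH] J2 B /=.
  move=> uJ2 mB; rewrite big_nil mul1r.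
  have mcap : measurable (\bigcap_(i in [set i | i \in J2]) (Y i @^-1` B i)).
    by apply: fin_bigcap_measurable => [|i _]; [exact: finite_seq|exact: mYB].
  transitivity (\int[P]_w (\1_(\bigcap_(i in [set i | i \in J2]) (Y i @^-1` B i)) w)%:E)%E.
    apply: eq_integral => w _; rewrite big_nil mul1r; congr EFin.
    transitivity ((all (fun i => Y i w \in B i) J2)%:R : R).
      elim: (J2) => [|i s IH]; first by rewrite big_nil.
      by rewrite big_cons IH indicE -natrM mulnb.
    rewrite indicE; congr (nat_of_bool _)%:R; apply/allP/idP => [h|/set_mem h i iJ].
      by apply/mem_set => i /h /set_mem.
    by apply/mem_set/h.
  rewrite integral_indic// setIT; apply: (etrans (indep _ _ uJ2 mB)).
  by rewrite -prodEFin; apply: eq_bigr => i _; exact/esym/bE.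
move=> /andP[jJ uJ12] mB.
pose H w := \prod_(i <- J1) f i (Y i w) * \prod_(i <- J2) \1_(B i) (Y i w).
pose c := \prod_(i <- J1) m i * \prod_(i <- J2) b B i.
have c0 : 0 <= c by rewrite mulr_ge0// prodr_ge0.
transitivity (\int[P]_w (f j (Y j w) * H w)%:E)%E.
  by apply: eq_integral => w _; rewrite big_cons mulrA.
have mH : measurable_fun setT H.
  by apply: measurable_funM; apply: measurable_prod => i _ //; exact: mBY.
have H0 w : 0 <= H w.
  by apply: mulr_ge0; apply: prodr_ge0 => i _ //; rewrite indicE ler0n.
rewrite (@integral_comp_mul _ _ (cst c))//.
  rewrite /cst; under eq_integral do rewrite mulrC EFinM.
  rewrite ge0_integralZl//=.
  - by rewrite fm -EFinM big_cons /c; congr EFin; ring.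
  - exact/measurable_EFinP.
  - by move=> w _; rewrite lee_fin.
move=> B' mB'; pose B'' i := if i == j then B' else B i.
have mB'' i : measurable (B'' i) by rewrite /B''; case: ifP.
have jJ2 : j \notin J2 by move: jJ; rewrite mem_cat => /norP[].
have := IH (j :: J2) B''; rewrite cat_uniq /=.
have -> : [&& uniq J1, ~~ ((j \in J1) || has (in_mem^~ (mem J1)) J2), j \notin J2 & uniq J2].
  move: jJ uJ12; rewrite mem_cat cat_uniq !negb_or => /andP[-> ->] /and3P[-> -> ->].
  by [].
have B''J2 (F : I -> set R -> R) :
    \prod_(i <- J2) F i (B'' i) = \prod_(i <- J2) F i (B i).
  by apply: eq_big_seq => i iJ2; rewrite /B''; case: eqP iJ2 jJ2 => // -> ->.
move=> /(_ isT mB'') IHB; transitivity (\int[P]_w (\prod_(i <- J1) f i (Y i w) *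
     \prod_(i <- j :: J2) \1_(B'' i) (Y i w))%:E)%E.
  apply: eq_integral => w _; congr EFin.
  rewrite big_cons (B''J2 (fun i B => \1_B (Y i w))) /H {1}/B'' eqxx.
  ring.
rewrite IHB big_cons (B''J2 (fun i B => fine (P (Y i @^-1` B)))).
rewrite {1}/b {1}/B'' eqxx /cst.
under [RHS]eq_integral do rewrite mulrC EFinM.
rewrite ge0_integralZl//=.
- rewrite (_ : (fun w => (\1_B' (Y j w))%:E) = (fun w => (\1_(Y j @^-1` B') w)%:E))//.
  rewrite integral_indic ?setIT//; last exact: mYB.
  rewrite -[X in (_ * X)%E]fineK ?fin_num_measure//; last exact: mYB.
  by rewrite -EFinM /c /b; congr EFin; ring.
- by apply/measurable_EFinP; exact: mBY.
Qed.
End independence.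

(** * Deviation inequalities for sums *)

Section tails.
Context {R : realType} {d : measure_display} {T : measurableType d}.
Variable P : probability T R.
Implicit Types (x c : R) (X : {RV P >-> R}).

Lemma measurable_tail_set (Z : T -> R) x : measurable_fun setT Z ->
  measurable [set w | x < Z w].
Proof.
move=> mZ; rewrite (_ : [set w | _] = Z @^-1` `]x, +oo[%classic).
  by rewrite -[X in measurable X]setTI; exact: mZ.
by apply/seteqP; split => w /=; rewrite in_itv/= andbT.
Qed.

Lemma tailE (Z : T -> R) x : measurable_fun setT Z ->
  (tail P Z x)%:E = P [set w | x < Z w].
Proof. by move=> mZ; rewrite fineK// fin_num_measure//; exact: measurable_tail_set. Qed.

Lemma tail_ge0 (Z : T -> R) x : 0 <= tail P Z x.
Proof. exact: fine_ge0. Qed.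

Lemma tail_setC (Z : T -> R) x : measurable_fun setT Z ->
  fine (P (~` [set w | x < Z w])) = 1 - tail P Z x.
Proof.
move=> mZ; have mA := measurable_tail_set x mZ.
apply: EFin_inj; rewrite EFinB tailE// -probability_setC// fineK//.
by apply: fin_num_measure; exact: measurableC.
Qed.

Lemma tail_le1 (Z : T -> R) x : measurable_fun setT Z -> tail P Z x <= 1.
Proof. by move=> mZ; rewrite -lee_fin tailE// probability_le1//; exact: measurable_tail_set. Qed.

Lemma tail_nonincreasing (Z : T -> R) x y : measurable_fun setT Z -> x <= y ->
  tail P Z y <= tail P Z x.
Proof.
move=> mZ xy; rewrite -lee_fin !tailE//.
apply: le_measure; rewrite ?inE; [exact: measurable_tail_set..|].
by move=> w /=; apply: le_lt_trans.
Qed.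

(** Markov's inequality for a test function [h]; the deviation bounds below differ only in the
    choice of [h]. *)
Lemma prob_le (A : set T) (h : T -> R) c : measurable A -> measurable_fun setT h ->
  (forall w, 0 <= h w) -> (forall w, A w -> 1 <= h w) ->
  (\int[P]_w (h w)%:E <= c%:E)%E -> fine (P A) <= c.
Proof.
move=> mA mh h0 h1 hc; rewrite -lee_fin fineK ?fin_num_measure//.
apply: le_trans hc; rewrite -[X in (P X <= _)%E]setIT -integral_indic//.
apply: ge0_le_integral => //.
- exact/measurable_EFinP.
- exact/measurable_EFinP.
- move=> w _; rewrite lee_fin indicE; case: (boolP (w \in A)) => [/set_mem/h1//|_].
  exact: h0.
Qed.

Lemma measurable_preimage_RV X B : measurable B -> measurable (X @^-1` B).
Proof. by move=> mB; rewrite -[Z in measurable Z]setTI; exact: measurable_funPT. Qed.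

Lemma integral_indic_comp X B : measurable B ->
  (\int[P]_w (\1_B (X w))%:E = P (X @^-1` B))%E.
Proof.
move=> mB; rewrite -[Z in P Z]setIT -integral_indic//.
exact: measurable_preimage_RV.
Qed.

Lemma tail_preimage X c : P (X @^-1` `]c, +oo[%classic) = (tail P X c)%:E.
Proof.
rewrite tailE//; congr (P _).
by apply/seteqP; split => w /=; rewrite in_itv/= andbT.
Qed.
End tails.

(** * Tilting bounds for sums of nonnegative i.i.d. variables *)

Section iid_sums.
Context {R : realType} {d : measure_display} {T : measurableType d}.
Variables (P : probability T R) (Y : nat -> {RV P >-> R}) (mu m p : R).
Hypothesis Y_iid : iid Y.
Hypothesis Y_ge0 : forall n w, 0 <= Y n w.
Hypothesis p12 : 1 <= p <= 2.
Hypothesis Y_mean : (\int[P]_w (Y 0%N w)%:E = mu%:E)%E.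
Hypothesis Y_moment : (\int[P]_w (Y 0%N w `^ p)%:E = m%:E)%E.
Implicit Types (x b c theta : R) (n : nat).

Let G := tail P (Y 0%N).
Let S n := partial_sum Y n.

Lemma measurable_partial_sum n : measurable_fun setT (S n).
Proof. exact: measurable_sum. Qed.

Lemma expectation_iid (f : R -> R) n : measurable_fun setT f -> (forall y, 0 <= f y) ->
  (\int[P]_w (f (Y n w))%:E = \int[P]_w (f (Y 0%N w))%:E)%E.
Proof.
move=> mf f0.
have mfE : measurable_fun setT (EFin \o f) by exact/measurable_EFinP.
have fE0 y : (0 <= (EFin \o f) y)%E by rewrite lee_fin.
rewrite -[LHS](ge0_integral_distribution (Y n) mfE fE0).
rewrite -[RHS](ge0_integral_distribution (Y 0%N) mfE fE0).
by apply: eq_measure_integral => B mB _; exact: Y_iid.2.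
Qed.

Lemma expectation_prod_iid (f : R -> R) c n : measurable_fun setT f ->
  (forall y, 0 <= f y) -> (\int[P]_w (f (Y 0%N w))%:E <= c%:E)%E ->
  (\int[P]_w (\prod_(i < n) f (Y i w))%:E <= (c ^+ n)%:E)%E.
Proof.
move=> mf f0 fc.
have e0 : (0 <= \int[P]_w (f (Y 0%N w))%:E)%E.
  by apply: integral_ge0 => w _; rewrite lee_fin.
have [e eE] : exists e, (\int[P]_w (f (Y 0%N w))%:E = e%:E)%E.
  exists (fine (\int[P]_w (f (Y 0%N w))%:E)).
  by rewrite fineK// ge0_fin_numE// (le_lt_trans fc) ?ltry.
have ec : e <= c by rewrite -lee_fin -eE.
have {}e0 : 0 <= e by rewrite -lee_fin -eE.
under eq_integral => w _ do rewrite -(big_mkord xpredT (fun i => f (Y i w))).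
rewrite (@expectation_prod _ _ _ P _ Y (fun=> f) (fun=> e))//.
- by rewrite lee_fin big_mkord prodr_const card_ord lerXn2r// nnegrE// (le_trans e0).
- exact: Y_iid.1.
- exact: iota_uniq.
- by move=> i; rewrite expectation_iid// eE.
Qed.

Lemma prob_le_prod (A : set T) (f : R -> R) (K c : R) n : measurable A -> measurable_fun setT f ->
  (forall y, 0 <= f y) -> 0 <= K -> (\int[P]_w (f (Y 0%N w))%:E <= c%:E)%E ->
  (forall w, A w -> 1 <= K * \prod_(i < n) f (Y i w)) ->
  fine (P A) <= K * c ^+ n.
Proof.
move=> mA mf f0 K0 fc hA.
have mprod : measurable_fun setT (fun w => \prod_(i < n) f (Y i w)).
  by apply: measurable_prod => i _; apply: (measurableT_comp (f := f)).
apply: (prob_le (h := fun w => K * \prod_(i < n) f (Y i w))) => //.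
- exact: measurable_funM.
- by move=> w; rewrite mulr_ge0// prodr_ge0.
under eq_integral do rewrite EFinM.
rewrite ge0_integralZl//=.
- by rewrite EFinM lee_wpmul2l//; exact: expectation_prod_iid.
- exact/measurable_EFinP.
- by move=> w _; rewrite lee_fin prodr_ge0.
Qed.

Lemma le_partial_sum n (i : 'I_n) w : Y i w <= S n w.
Proof. by rewrite /S /partial_sum (bigD1 i)//= lerDl sumr_ge0. Qed.

Lemma partial_sum_tail_ge n x : 1 - (1 - G x) ^+ n <= tail P (S n) x.
Proof.
have mS := measurable_tail_set x (measurable_partial_sum n).
rewrite lerBlDr -lerBlDl.
rewrite -tail_setC; last exact: measurable_partial_sum.
rewrite -[leRHS]mul1r; apply: (prob_le_prod (f := \1_(~` `]x, +oo[%classic))) => //.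
- exact: measurableC.
- by apply/measurable_indicP; exact: measurableC.
- rewrite integral_indic_comp; last exact: measurableC.
  rewrite preimage_setC probability_setC ?tail_preimage//.
  exact: (measurable_preimage_RV (Y 0%N) (measurable_itv `]x, +oo[)).
- move=> w /= /negP; rewrite -leNgt => Sx; rewrite mul1r big1// => i _.
  rewrite indicE mem_set//= in_itv/= andbT; apply/negP; rewrite -leNgt.
  by apply: le_trans Sx; exact: le_partial_sum.
Qed.

Lemma affine_moment a1 a2 a3 : 0 <= a1 -> 0 <= a2 -> 0 <= a3 ->
  (\int[P]_w (a1 + a2 * Y 0%N w + a3 * Y 0%N w `^ p)%:E = (a1 + a2 * mu + a3 * m)%:E)%E.
Proof.
move=> a10 a20 a30.
have mYp : measurable_fun setT (fun w => Y 0%N w `^ p).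
  by apply: (measurableT_comp (measurable_powR p)).
under eq_integral do rewrite 2!EFinD.
rewrite ge0_integralD//=; last 4 first.
- by move=> w _; rewrite -EFinD lee_fin addr_ge0// mulr_ge0.
- by apply/measurable_EFinP; apply: measurable_funD => //; exact: measurable_funM.
- by move=> w _; rewrite lee_fin mulr_ge0 ?powR_ge0.
- by apply/measurable_EFinP; exact: measurable_funM.
rewrite ge0_integralD//=; last 2 first.
- by move=> w _; rewrite lee_fin mulr_ge0.
- by apply/measurable_EFinP; exact: measurable_funM.
under [X in (_ + X + _)%E]eq_integral do rewrite EFinM.
under [X in (_ + X)%E]eq_integral do rewrite EFinM.
rewrite !ge0_integralZl//=.
- by rewrite Y_mean Y_moment integral_cst//= probability_setT mule1.
- exact/measurable_EFinP.
- by move=> w _; rewrite lee_fin powR_ge0.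
- exact/measurable_EFinP.
- by move=> w _; rewrite lee_fin.
Qed.

Lemma mgfN_le theta : 0 <= theta ->
  (\int[P]_w (expR (- (theta * Y 0%N w)))%:E <=
   (expR (- (theta * mu - theta `^ p * m)))%:E)%E.
Proof.
move=> t0.
have mtY : measurable_fun setT (fun w => theta * Y 0%N w) by exact: measurable_funM.
have mE : measurable_fun setT (fun w => expR (- (theta * Y 0%N w))).
  by apply: measurableT_comp => //; apply: measurable_funN.
have thmu : (\int[P]_w (theta * Y 0%N w)%:E = (theta * mu)%:E)%E.
  under eq_integral do rewrite EFinM.
  by rewrite ge0_integralZl//= ?Y_mean//; [exact/measurable_EFinP|move=> w _; rewrite lee_fin].
(* The linear term is moved to the left, so that only integrals of nonnegative functions are added
   and compared. *)
have : (\int[P]_w (expR (- (theta * Y 0%N w)))%:E + (theta * mu)%:E <=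
    (1 + theta `^ p * m)%:E)%E.
  have := @affine_moment 1 0 (theta `^ p).
  rewrite mul0r addr0 => <- //; last exact: powR_ge0.
  rewrite -thmu -ge0_integralD//=.
  - apply: ge0_le_integral => //.
    + by move=> w _; rewrite -EFinD lee_fin addr_ge0 ?expR_ge0 ?mulr_ge0.
    + by apply/measurable_EFinP; exact: measurable_funD.
    + apply/measurable_EFinP; apply: measurable_funD => //.
        by apply: measurable_funD => //; exact: measurable_funM.
      by apply: measurable_funM => //; apply: (measurableT_comp (measurable_powR p)).
    + move=> w _; rewrite -EFinD lee_fin -powRM// mul0r addr0.
      by have := expRN_le1BxDpow (mulr_ge0 t0 (Y_ge0 0 w)) p12; lra.
  - exact/measurable_EFinP.
  - by move=> w _; rewrite lee_fin mulr_ge0.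
  - exact/measurable_EFinP.
rewrite -leeBrDr// -EFinB => /le_trans; apply.
rewrite lee_fin; apply: le_trans (expR_ge1Dx _); lra.
Qed.

Lemma lower_deviation n x theta : 0 <= theta ->
  1 - tail P (S n) x <= expR (theta * x - n%:R * (theta * mu - theta `^ p * m)).
Proof.
move=> t0; have mS := measurable_tail_set x (measurable_partial_sum n).
rewrite -tail_setC; last exact: measurable_partial_sum.
have mE : measurable_fun setT (fun y : R => expR (- (theta * y))).
  by apply: measurableT_comp => //; apply: measurable_funN; apply: measurable_funM.
rewrite expRD -mulrN expRM_natl.
apply: (prob_le_prod (f := fun y => expR (- (theta * y)))) => //.
- exact: measurableC.
- exact: mgfN_le.
move=> w /= /negP; rewrite -leNgt => Sx.
rewrite -expR_sum -expRD -expR0 ler_expR sumrN -mulr_sumr.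
by rewrite subr_ge0 ler_wpM2l.
Qed.

(** Truncation at [b] makes the exponential moment finite: in the remainder term of [expR_le1DxDpow]
    the exponential is at most [expR (theta * b)], which leaves the moment of order [p]. *)
Lemma truncated_mgf_le theta b : 0 <= theta ->
  (\int[P]_w (expR (theta * Y 0%N w) * \1_(`]-oo, b]%classic) (Y 0%N w))%:E <=
   (expR (theta * mu + theta `^ p * m * expR (theta * b)))%:E)%E.
Proof.
move=> t0; pose a3 := theta `^ p * expR (theta * b).
have a30 : 0 <= a3 by rewrite mulr_ge0 ?powR_ge0 ?expR_ge0.
have hle : (\int[P]_w (expR (theta * Y 0%N w) * \1_(`]-oo, b]%classic) (Y 0%N w))%:E <=
    (\int[P]_w (1 + theta * Y 0%N w + a3 * Y 0%N w `^ p)%:E))%E.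
  apply: ge0_le_integral => //.
  - apply/measurable_EFinP; apply: measurable_funM.
      by apply: measurableT_comp => //; exact: measurable_funM.
    by apply: (measurableT_comp (f := \1_(`]-oo, b]%classic) : R -> R)).
  - apply/measurable_EFinP; apply: measurable_funD.
      by apply: measurable_funD => //; exact: measurable_funM.
    by apply: measurable_funM => //; apply: (measurableT_comp (measurable_powR p)).
  - move=> w _; rewrite lee_fin.
    have Y0 := Y_ge0 0 w; set u := theta * Y 0%N w.
    have u0 : 0 <= u by rewrite mulr_ge0.
    rewrite indicE; case: (boolP (_ \in _)) => [/set_mem|]; last first.
      by rewrite mulr0 !addr_ge0 ?mulr_ge0 ?powR_ge0 ?expR_ge0.
    rewrite /= in_itv/= mulr1 => Yb; apply: le_trans (expR_le1DxDpow u0 p12) _.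
    rewrite lerD2l /u powRM// /a3 mulrAC ler_wpM2r ?powR_ge0// ler_wpM2l ?powR_ge0//.
    by rewrite ler_expR ler_wpM2l.
apply: le_trans hle _; rewrite affine_moment// lee_fin.
by apply: le_trans (expR_ge1Dx _); rewrite /a3; lra.
Qed.

Let below b := \1_(`]-oo, b]%classic) : R -> R.
Let above b := \1_(`]b, +oo[%classic) : R -> R.

Let tmgf theta b (u : R) := expR (theta * u) * below b u.

Let above_ge0 b u : 0 <= above b u.
Proof. by rewrite /above indicE. Qed.

Let tmgf_ge0 theta b u : 0 <= tmgf theta b u.
Proof. by rewrite mulr_ge0 ?expR_ge0// /below indicE. Qed.

Let measurable_above b : measurable_fun setT (above b).
Proof. exact/measurable_indicP. Qed.

Let measurable_tmgf theta b : measurable_fun setT (tmgf theta b).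
Proof.
apply: measurable_funM; last exact/measurable_indicP.
by apply: measurableT_comp => //; exact: measurable_funM.
Qed.

Lemma sum_above_le n b :
  (\int[P]_w (\sum_(i < n) above b (Y i w))%:E = (n%:R * G b)%:E)%E.
Proof.
under eq_integral do rewrite -sumEFin.
rewrite ge0_integral_sum//; last 2 first.
- by move=> i; apply/measurable_EFinP; exact: (measurableT_comp (f := above b)).
- by move=> i w _; rewrite lee_fin.
under eq_bigr => i _.
  rewrite (expectation_iid i (measurable_above b) (above_ge0 b)).
  rewrite integral_indic_comp// tail_preimage.
  over.
by rewrite /= sumEFin sumr_const card_ord mulr_natl.
Qed.

Lemma tilted_prod_le n x b theta : 0 <= theta ->
  (\int[P]_w (expR (- (theta * x)) * \prod_(i < n) tmgf theta b (Y i w))%:E <=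
  (expR (- (theta * (x - n%:R * mu)) + n%:R * (theta `^ p * m * expR (theta * b))))%:E)%E.
Proof.
move=> t0.
under eq_integral do rewrite EFinM.
rewrite ge0_integralZl//=.
- have -> : - (theta * (x - n%:R * mu)) + n%:R * (theta `^ p * m * expR (theta * b)) =
      - (theta * x) + n%:R * (theta * mu + theta `^ p * m * expR (theta * b)) by ring.
  rewrite expRD expRM_natl EFinM lee_wpmul2l ?lee_fin ?expR_ge0//.
  by apply: expectation_prod_iid => //; exact: truncated_mgf_le.
- apply/measurable_EFinP/measurable_prod => i _.
  exact: (measurableT_comp (f := tmgf theta b)).
- by move=> w _; rewrite lee_fin prodr_ge0.
Qed.

Lemma tilted_prod_ge1 n x b theta w : 0 <= theta -> x < S n w ->
  (forall i : 'I_n, Y i w <= b) ->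
  1 <= expR (- (theta * x)) * \prod_(i < n) tmgf theta b (Y i w).
Proof.
move=> t0 Sx Yb; rewrite (eq_bigr (fun i : 'I_n => expR (theta * Y i w))); last first.
  by move=> i _; rewrite /tmgf /below indicE mem_set ?mulr1//= in_itv/=.
rewrite -expR_sum -expRD -expR0 ler_expR -mulr_sumr.
by rewrite addrC subr_ge0 ler_wpM2l// ltW.
Qed.

(** A union bound covers the event that some [Y_i > b]; otherwise truncation changes nothing and the
    tilted product is at least [1]. *)
Lemma upper_deviation n x b theta : 0 <= theta ->
  tail P (S n) x <= n%:R * G b +
    expR (- (theta * (x - n%:R * mu)) + n%:R * (theta `^ p * m * expR (theta * b))).
Proof.
move=> t0.
pose h w := \sum_(i < n) above b (Y i w) +
  expR (- (theta * x)) * \prod_(i < n) tmgf theta b (Y i w).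
have m1 : measurable_fun setT (fun w => \sum_(i < n) above b (Y i w)).
  by apply: measurable_sum => i; exact: (measurableT_comp (f := above b)).
have m2 : measurable_fun setT (fun w => expR (- (theta * x)) * \prod_(i < n) tmgf theta b (Y i w)).
  apply: measurable_funM => //; apply: measurable_prod => i _.
  exact: (measurableT_comp (f := tmgf theta b)).
have h1 w : 0 <= \sum_(i < n) above b (Y i w) by apply: sumr_ge0.
have h2 w : 0 <= expR (- (theta * x)) * \prod_(i < n) tmgf theta b (Y i w).
  by rewrite mulr_ge0 ?expR_ge0// prodr_ge0.
apply: (prob_le (h := h)).
- exact/measurable_tail_set/measurable_partial_sum.
- exact: measurable_funD.
- by move=> w; rewrite addr_ge0.
- move=> w /= Sx; case: (pselect (forall i : 'I_n, Y i w <= b)) => [Yb|].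
    by rewrite /h ler_wpDl// tilted_prod_ge1.
  move=> /existsNP[i /negP]; rewrite -ltNge => Yi; rewrite /h ler_wpDr//.
  by rewrite (bigD1 i)//= /above indicE mem_set/= ?in_itv/= ?Yi// lerDl sumr_ge0.
under eq_integral do rewrite EFinD.
rewrite ge0_integralD//=.
- by rewrite sum_above_le EFinD leeD2l// tilted_prod_le.
- by move=> w _; rewrite lee_fin.
- exact/measurable_EFinP.
- by move=> w _; rewrite lee_fin.
- exact/measurable_EFinP.
Qed.

Lemma expectation_above_mul b i j : i != j ->
  (\int[P]_w (above b (Y i w) * Y j w)%:E = (G b * mu)%:E)%E.
Proof.
(* [expectation_prod] asks for functions nonnegative on the whole line, hence [Num.max y 0] in place
   of the identity; both agree on the values of [Y]. *)
move=> ij; pose f k := if k == i then above b else fun y => Num.max y 0.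
pose e k := if k == i then G b else mu.
have := @expectation_prod _ _ _ P _ Y f e [:: i; j].
rewrite !big_cons big_nil /e eqxx eq_sym (negbTE ij) mulr1 => <- //.
- apply: eq_integral => w _; rewrite !big_cons big_nil /f eqxx eq_sym (negbTE ij) mulr1.
  by rewrite max_l.
- exact: Y_iid.1.
- by rewrite /= inE ij.
- by move=> k; rewrite /f; case: ifP => // _; exact: measurable_maxr.
- by move=> k y; rewrite /f; case: ifP => // _; rewrite le_max lexx orbT.
move=> k; rewrite /f; case: ifP => _.
  by rewrite (expectation_iid k (measurable_above b) (above_ge0 b)) integral_indic_comp// tail_preimage.
rewrite (@expectation_iid (fun y => Num.max y 0)).
- by rewrite -Y_mean; apply: eq_integral => w _; rewrite max_l.
- exact: measurable_maxr.
- by move=> y; rewrite le_max lexx orbT.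
Qed.

(* Either some [Y_i > c], or some [Y_i > b] while the other terms sum to more
   than [z], or all [Y_i <= b]. *)
Lemma upper_deviation_one_jump n x c b z theta : 0 <= theta -> 0 < z -> c + z <= x ->
  tail P (S n) x <= n%:R * G c + n%:R * (n%:R * mu / z) * G b +
    expR (- (theta * (x - n%:R * mu)) + n%:R * (theta `^ p * m * expR (theta * b))).
Proof.
move=> t0 z0 czx.
(* Off the diagonal, independence gives [g ij] the mean [G b * mu], and there are at most [n^2]
   pairs. Dividing the sum by [z] is Markov's inequality for the terms other than the jump. *)
pose g (ij : 'I_n * 'I_n) w :=
  if ij.1 == ij.2 then 0 else above b (Y ij.1 w) * Y ij.2 w.
have mg ij : measurable_fun setT (g ij).
  rewrite /g; case: (ij.1 == ij.2) => //; apply: measurable_funM => //.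
  exact: (measurableT_comp (f := above b)).
have g0 ij w : 0 <= g ij w by rewrite /g; case: ifP => // _; rewrite mulr_ge0.
have gE ij : (\int[P]_w (g ij w)%:E <= (G b * mu)%:E)%E.
  rewrite /g; case: (boolP (ij.1 == ij.2)) => [_|ij12]; last first.
    by rewrite expectation_above_mul.
  rewrite integral0 lee_fin mulr_ge0 ?tail_ge0// -lee_fin -Y_mean.
  by apply: integral_ge0 => w _; rewrite lee_fin.
pose h1 w := \sum_(i < n) above c (Y i w).
pose h2 w := z^-1 * \sum_ij g ij w.
pose h3 w := expR (- (theta * x)) * \prod_(i < n) tmgf theta b (Y i w).
have m1 : measurable_fun setT h1.
  by apply: measurable_sum => i; exact: (measurableT_comp (f := above c)).
have m2' : measurable_fun setT (fun w => \sum_ij g ij w) by exact: measurable_sum.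
have m2 : measurable_fun setT h2 by exact: measurable_funM.
have m3 : measurable_fun setT h3.
  apply: measurable_funM => //; apply: measurable_prod => i _.
  exact: (measurableT_comp (f := tmgf theta b)).
have h10 w : 0 <= h1 w by apply: sumr_ge0.
have h20 w : 0 <= h2 w by rewrite mulr_ge0 ?sumr_ge0// invr_ge0 ltW.
have h30 w : 0 <= h3 w by rewrite mulr_ge0 ?expR_ge0// prodr_ge0.
apply: (prob_le (h := fun w => h1 w + h2 w + h3 w)).
- exact/measurable_tail_set/measurable_partial_sum.
- by apply: measurable_funD => //; exact: measurable_funD.
- by move=> w; rewrite !addr_ge0.
- move=> w /= Sx; case: (pselect (forall i : 'I_n, Y i w <= b)) => [Yb|].
    by rewrite ler_wpDl ?addr_ge0// tilted_prod_ge1.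
  move=> /existsNP[i /negP]; rewrite -ltNge => Yi; rewrite ler_wpDr//.
  have [cYi|Yic] := ltP c (Y i w).
    rewrite ler_wpDr// /h1 (bigD1 i)//= /above indicE mem_set/= ?in_itv/= ?cYi//.
    by rewrite lerDl sumr_ge0.
  rewrite ler_wpDl// /h2 mulrC ler_pdivlMr// mul1r.
  rewrite -(pair_bigA _ (fun i j => g (i, j) w))/= (bigD1 i)//= ler_wpDr//.
    by apply: sumr_ge0 => j _; exact: sumr_ge0.
  rewrite (bigD1 i)//= ler_wpDl// (eq_bigr (fun j : 'I_n => Y j w)); last first.
    move=> j ji; rewrite /g/= eq_sym (negbTE ji) /above indicE mem_set ?mul1r//=.
    by rewrite in_itv/= Yi.
  move: Sx; rewrite /S /partial_sum (bigD1 i)//= => Sx; lra.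
under eq_integral do rewrite 2!EFinD.
rewrite ge0_integralD//=; last 4 first.
- by move=> w _; rewrite -EFinD lee_fin addr_ge0.
- by apply/measurable_EFinP; exact: measurable_funD.
- by move=> w _; rewrite lee_fin.
- exact/measurable_EFinP.
rewrite ge0_integralD//=; last 4 first.
- by move=> w _; rewrite lee_fin.
- exact/measurable_EFinP.
- by move=> w _; rewrite lee_fin.
- exact/measurable_EFinP.
rewrite sum_above_le 2!EFinD leeD ?tilted_prod_le// leeD2l//.
under eq_integral do rewrite EFinM.
rewrite ge0_integralZl//=.
- under eq_integral do rewrite -sumEFin.
  rewrite ge0_integral_sum//; last 2 first.
  + by move=> i; exact/measurable_EFinP.
  + by move=> i w _; rewrite lee_fin.
  have -> : n%:R * (n%:R * mu / z) * G b = z^-1 * (n%:R * n%:R * (G b * mu)) by ring.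
  rewrite EFinM lee_wpmul2l ?lee_fin ?invr_ge0 ?(ltW z0)//.
  apply: (@le_trans _ _ (\sum_(ij : 'I_n * 'I_n) (G b * mu)%:E)%E); first exact: lee_sum.
  by rewrite sumEFin sumr_const card_prod card_ord -natrM mulr_natl.
- exact/measurable_EFinP.
- by move=> w _; rewrite lee_fin sumr_ge0.
- by rewrite lee_fin invr_ge0 ltW.
Qed.

End iid_sums.

(** * Large deviations of heavy-tailed sums *)

Section large_deviations.
Context {R : realType}.
Variables (G : R -> R) (p : nat -> R -> R) (mu m g q q' t : R).
Hypotheses (mu0 : 0 < mu) (m0 : 0 <= m) (g0 : 0 < g) (g1 : g < 1).
Hypotheses (q0 : 0 < q) (gq1 : 1 < g * q) (q'0 : 0 < q') (t1 : 1 < t) (gt1 : 1 < g * t).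
Hypothesis G_ni : forall x y : R, x <= y -> G y <= G x.
Hypothesis G_ge0 : forall x : R, 0 <= G x.
Hypothesis G_le1 : forall x : R, G x <= 1.
Hypothesis G_low : exists2 c : R, 0 < c & \forall x \near +oo, c * x `^ (- q') <= G x.
Hypothesis G_up : exists2 K : R, 0 < K & forall y : R, 0 < y -> G y <= K * y `^ (- q).
Hypothesis G_scale : forall eta : R, 0 < eta < 1 ->
  exists2 C : R, 0 < C & \forall x \near +oo, G (eta * x) <= C * G x.
Hypothesis G_cont : forall e : R, 0 < e ->
  exists2 delta : R, 0 < delta < 1 & \forall x \near +oo, G ((1 - delta) * x) <= (1 + e) * G x.
Hypothesis p0 : forall x : R, 0 <= x -> p 0 x = 0.
Hypothesis p_max : forall n x, 1 - (1 - G x) ^+ n <= p n x.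
Hypothesis p_left : forall n x (theta : R), 0 <= theta ->
  1 - p n x <= expR (theta * x - n%:R * (theta * mu - theta `^ t * m)).
Hypothesis p_right : forall n x b (theta : R), 0 <= theta ->
  p n x <= n%:R * G b +
    expR (- (theta * (x - n%:R * mu)) + n%:R * (theta `^ t * m * expR (theta * b))).
Hypothesis p_jump : forall n (x c b z theta : R), 0 <= theta -> 0 < z -> c + z <= x ->
  p n x <= n%:R * G c + n%:R * (n%:R * mu / z) * G b +
    expR (- (theta * (x - n%:R * mu)) + n%:R * (theta `^ t * m * expR (theta * b))).
Implicit Types (n : nat) (x a b e eta : R).

(* The tilt is [theta = a ln x / (x - n mu)]. *)
Lemma chernoff_powR a : 0 < a -> exists2 eps : R, 0 < eps < 1 &
  \forall x \near +oo, forall n b, n%:R * mu <= x - x `^ g ->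
    b <= eps * (x - n%:R * mu) -> exists2 theta : R, 0 <= theta &
    expR (- (theta * (x - n%:R * mu)) + n%:R * (theta `^ t * m * expR (theta * b)))
      <= 2 * x `^ (- a).
Proof.
(* Count of powers of [x] in the second exponent: [n] contributes [1], [theta^t] contributes [- g t]
   and a logarithm absorbed by [s / 2], and [expR (theta * b)] contributes at most [a eps <= s]. As
   [1 - g t = - 2 s], the total is [- s / 2]. *)
move=> a0; pose s := (g * t - 1) / 2.
have s0 : 0 < s by rewrite divr_gt0// subr_gt0.
have t0 : 0 < t by exact: lt_trans t1.
have [eps [eps0 eps1 aeps]] : exists eps : R, [/\ 0 < eps, eps < 1 & a * eps <= s].
  exists (Num.min 2^-1 (s / a)); rewrite lt_min gt_min invr_gt0 ltr0n divr_gt0//=; split=> //.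
    by apply/orP; left; rewrite invf_lt1// ltr1n.
  by rewrite -ler_pdivlMl// mulrC ge_min lexx orbT.
exists eps; first by rewrite eps0.
pose D := m / mu * (a * (s / (2 * t))^-1) `^ t.
have D0 : 0 <= D by rewrite mulr_ge0 ?powR_ge0// divr_ge0// ltW.
have D10 : 0 < D + 1 by lra.
have s20 : 0 < s / 2 by rewrite divr_gt0.
have st0 : 0 < s / (2 * t) by rewrite divr_gt0// mulr_gt0.
have ln2 : 0 < ln 2 :> R by rewrite ln_gt0// ltr1n.
near=> x => n b nx bx.
have x1 : 1 <= x by near: x; exact: near_pinfty_ge.
have x0 : 0 < x by exact: lt_le_trans x1.
have lnx0 : 0 <= ln x by exact: ln_ge0.
set y := x - n%:R * mu in bx *.
have yx : x `^ g <= y by rewrite /y lerBrDr -lerBrDl.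
have y0 : 0 < y by apply: lt_le_trans yx; exact: powR_gt0.
have th0 : 0 <= a * ln x / y by rewrite divr_ge0 ?mulr_ge0// ltW.
exists (a * ln x / y) => //.
have thy : a * ln x / y * y = a * ln x by rewrite divfK// gt_eqF.
have thb : expR (a * ln x / y * b) <= x `^ s.
  rewrite powR_expR// ler_expR; apply: le_trans (_ : a * ln x / y * (eps * y) <= _).
    by rewrite ler_wpM2l.
  by rewrite mulrCA thy mulrA ler_wpM2r// mulrC.
have thp : (a * ln x / y) `^ t <= (a * (s / (2 * t))^-1) `^ t * x `^ (s / 2) * x `^ (- (g * t)).
  rewrite powRM ?mulr_ge0 ?invr_ge0 ?(ltW a0) ?(ltW y0)//; apply: ler_pM; rewrite ?powR_ge0//.
    have -> : s / 2 = s / (2 * t) * t by field; rewrite gt_eqF.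
    rewrite powRrM -powRM ?powR_ge0//; last by rewrite mulr_ge0 ?invr_ge0// ltW.
    apply: ge0_ler_powR; rewrite ?nnegrE ?mulr_ge0 ?invr_ge0 ?powR_ge0 ?(ltW a0) ?(ltW st0) ?(ltW t0)//.
    by rewrite -mulrA ler_pM2l//; exact: ln_le_powR.
  have -> : y^-1 `^ t = (y `^ t)^-1.
    by rewrite -(powR_inv1 (ltW y0)) -powRrM mulN1r powRN.
  rewrite powRN powRrM lef_pV2 ?posrE ?powR_gt0//.
  by apply: ge0_ler_powR; rewrite ?nnegrE ?powR_ge0 ?(ltW y0) ?(ltW t0).
have nxm : n%:R <= x / mu.
  by rewrite ler_pdivlMr// (le_trans nx)// gerBl powR_ge0.
have small : n%:R * ((a * ln x / y) `^ t * m * expR (a * ln x / y * b)) <= ln 2.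
  apply: le_trans (_ : x / mu * ((a * (s / (2 * t))^-1) `^ t * x `^ (s / 2) * x `^ (- (g * t))
      * m * x `^ s) <= _).
    apply: ler_pM => //; rewrite ?mulr_ge0 ?powR_ge0 ?expR_ge0//.
    apply: ler_pM; rewrite ?mulr_ge0 ?powR_ge0 ?expR_ge0//.
    by rewrite ler_wpM2r.
  have -> : x / mu * ((a * (s / (2 * t))^-1) `^ t * x `^ (s / 2) * x `^ (- (g * t))
      * m * x `^ s) = D * (x * x `^ (s / 2) * x `^ (- (g * t)) * x `^ s).
    by rewrite /D; ring.
  have -> : x * x `^ (s / 2) * x `^ (- (g * t)) * x `^ s = x `^ (- (s / 2)).
    rewrite -[X in X * _ * _ * _]powRr1 ?(ltW x0)//.
    by rewrite -!powRD ?(gt_eqF x0) ?implybT//; congr powR; rewrite /s; field.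
  have : x `^ (- (s / 2)) <= ln 2 / (D + 1).
    by near: x; apply: near_powRN_le => //; rewrite divr_gt0.
  rewrite ler_pdivlMr// => h; apply: le_trans h.
  by rewrite mulrC ler_wpM2l ?powR_ge0//; lra.
rewrite thy expRD mulrC; apply: ler_pM; rewrite ?expR_ge0//.
  by rewrite -[leRHS]lnK ?posrE// ler_expR.
by rewrite powR_expR// mulNr.
Unshelve. all: by end_near. Qed.

Lemma near_powRg_le eta : 0 < eta -> \forall x \near +oo, x `^ g <= eta * x.
Proof.
move=> eta0; near=> x; have x0 : 0 < x by near: x; exact: nbhs_pinfty_gt.
have : x `^ (- (1 - g)) <= eta.
  by near: x; apply: near_powRN_le => //; rewrite subr_gt0.
by rewrite opprB powRB ?(gt_eqF x0) ?implybT// powRr1 ?(ltW x0)// ler_pdivrMr.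
Unshelve. all: by end_near. Qed.

Lemma powR_le_G e : 0 < e -> \forall x \near +oo, 2 * x `^ (- (q' + 1)) <= e * G x.
Proof.
move=> e0; have [c c0 low] := G_low; near=> x.
have x0 : 0 < x by near: x; exact: nbhs_pinfty_gt.
have h : c * x `^ (- q') <= G x by near: x.
have x1 : x `^ (- 1) <= e * c / 2.
  by near: x; apply: near_powRN_le => //; rewrite divr_gt0// mulr_gt0.
apply: le_trans (_ : e * (c * x `^ (- q')) <= _); last by rewrite ler_pM2l.
rewrite opprD powRD ?(gt_eqF x0) ?implybT//.
rewrite [leLHS](_ : _ = 2 * x `^ (- 1) * x `^ (- q')); last by ring.
by rewrite (mulrA e) ler_wpM2r ?powR_ge0//; lra.
Unshelve. all: by end_near. Qed.

(** A jump level [eps x^g] makes [n G(eps x^g)] of order [x^(1 - g q)]; tilting with [a = g q - 1]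
    brings the other term to the same order. *)
Lemma tail_below : exists2 K : R, 0 < K &
  \forall x \near +oo, forall n, n%:R * mu <= x - x `^ g ->
    p n x <= K * x `^ (1 - g * q).
Proof.
have [K K0 up] := G_up.
have a0 : 0 < g * q - 1 by rewrite subr_gt0.
have [eps /andP[eps0 eps1] near_ch] := chernoff_powR a0.
exists (K * eps `^ (- q) / mu + 2).
  by rewrite addr_gt0// divr_gt0// mulr_gt0// powR_gt0.
near=> x => n nx.
have x0 : 0 < x by near: x; exact: nbhs_pinfty_gt.
have ch : forall n b, n%:R * mu <= x - x `^ g ->
    b <= eps * (x - n%:R * mu) -> exists2 theta : R, 0 <= theta &
    expR (- (theta * (x - n%:R * mu)) + n%:R * (theta `^ t * m * expR (theta * b)))
      <= 2 * x `^ (- (g * q - 1)) by near: x.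
have xg0 : 0 < x `^ g by exact: powR_gt0.
have bx : eps * x `^ g <= eps * (x - n%:R * mu) by rewrite ler_pM2l//; lra.
have [theta th0 hth] := ch n _ nx bx.
apply: le_trans (p_right n x (eps * x `^ g) th0) _.
rewrite mulrDl; apply: lerD; last by rewrite -[1 - g * q]opprB.
have nxm : n%:R <= x / mu by rewrite ler_pdivlMr// (le_trans nx)// gerBl ltW.
apply: le_trans (_ : x / mu * (K * (eps * x `^ g) `^ (- q)) <= _).
  by apply: ler_pM => //; apply: up; rewrite mulr_gt0.
rewrite powRM ?powR_ge0 ?(ltW eps0)// -powRrM mulrN.
rewrite powRB ?(gt_eqF x0) ?implybT// powRr1 ?(ltW x0)// (powRN x).
by rewrite le_eqVlt; apply/orP; left; apply/eqP; ring.
Unshelve. all: by end_near. Qed.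

(** Here the distance [x - n mu] is at least [eta x], so the jump level is a multiple of [x] and
    [G_scale] applies. With [a = q' + 1] the tilted term is below [G x], hence below [n G x] for
    [n >= 1]. *)
Lemma tail_middle eta : 0 < eta < 1 -> exists2 C : R, 0 < C &
  \forall x \near +oo, forall n, n%:R * mu <= (1 - eta) * x ->
    p n x <= C * (n%:R * G x).
Proof.
move=> /andP[eta0 eta1].
have q'10 : 0 < q' + 1 by rewrite addr_gt0.
have [eps /andP[eps0 eps1] near_ch] := chernoff_powR q'10.
have ee : 0 < eps * eta < 1 by rewrite mulr_gt0//= mulr_ilt1// ltW.
have [C C0 scale] := G_scale ee.
have near_pG := powR_le_G ltr01; have near_xg := near_powRg_le eta0.
exists (C + 1); first by rewrite addr_gt0.
near=> x => n nx.
have x0 : 0 < x by near: x; exact: nbhs_pinfty_gt.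
case: n nx => [|n] nx; first by rewrite p0 ?(ltW x0)// mul0r mulr0.
have ch : forall n b, n%:R * mu <= x - x `^ g ->
    b <= eps * (x - n%:R * mu) -> exists2 theta : R, 0 <= theta &
    expR (- (theta * (x - n%:R * mu)) + n%:R * (theta `^ t * m * expR (theta * b)))
      <= 2 * x `^ (- (q' + 1)) by near: x.
have sc : G (eps * eta * x) <= C * G x by near: x.
have pG : 2 * x `^ (- (q' + 1)) <= 1 * G x by near: x.
have xg : x `^ g <= eta * x by near: x.
have nx' : n.+1%:R * mu <= x - x `^ g by lra.
have bx : eps * eta * x <= eps * (x - n.+1%:R * mu) by rewrite -mulrA ler_pM2l//; lra.
have [theta th0 hth] := ch n.+1 _ nx' bx.
apply: le_trans (p_right n.+1 x (eps * eta * x) th0) _.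
rewrite mulrDl; apply: lerD; first by rewrite [leRHS]mulrCA ler_wpM2l.
apply: le_trans hth _; rewrite mul1r; apply: le_trans pG _.
by rewrite mul1r ler_peMl// ler1n.
Unshelve. all: by end_near. Qed.

Lemma tail_above e : 0 < e ->
  \forall x \near +oo, forall n, x + x `^ g <= n%:R * mu -> 1 - e <= p n x.
Proof.
(* The tilt is [x^(-h)] with [1 / t < h < g]: [h < g] makes the gain [theta x^g] diverge, and
   [h t > 1] keeps the error [n theta^t m] bounded at [n = (x + x^g) / mu]. Larger [n] only help,
   because [theta mu >= theta^t m]. *)
move=> e0; pose h := (t^-1 + g) / 2.
have t0 : 0 < t by exact: lt_trans t1.
have tg : t^-1 < g by rewrite -[ltLHS]mul1r ltr_pdivrMr.
have hg : 0 < g - h by rewrite /h; lra.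
have ti0 : 0 < t^-1 by rewrite invr_gt0.
have h0 : 0 < h by rewrite /h; lra.
have ht : 0 < h * t - 1.
  by rewrite subr_gt0 -ltr_pdivrMr// mul1r /h; lra.
have mm0 : 0 < 2 * m / mu + 1 by rewrite ltr_wpDl// divr_ge0 ?mulr_ge0// ltW.
have m1 : 0 < m + 1 by rewrite ltr_wpDl.
have ht1 : 0 < h * (t - 1) by rewrite mulr_gt0// subr_gt0.
have mm1 : 0 < mu / (m + 1) by rewrite divr_gt0.
have mm2 : 0 < (2 * m / mu + 1)^-1 by rewrite invr_gt0.
near=> x => n nx.
have x1 : 1 <= x by near: x; exact: near_pinfty_ge.
have x0 : 0 < x by exact: lt_le_trans x1.
set th := x `^ (- h).
have th0 : 0 <= th by exact: powR_ge0.
have thm : th `^ t * m <= th * mu.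
  have -> : th `^ t = th * x `^ (- (h * (t - 1))).
    rewrite /th -powRrM -powRD ?(gt_eqF x0) ?implybT//; congr powR; ring.
  rewrite -mulrA ler_wpM2l//.
  have : x `^ (- (h * (t - 1))) <= mu / (m + 1).
    by near: x; exact: near_powRN_le.
  rewrite ler_pdivlMr// mulrDr mulr1.
  by have := powR_ge0 x (- (h * (t - 1))); lra.
have xg : x `^ g <= x by apply: ler1_powR => //; exact: ltW.
suff : 1 - p n x <= e by lra.
apply: le_trans (p_left n x th0) _.
have thg : th * x `^ g = x `^ (g - h).
  by rewrite /th -powRD ?(gt_eqF x0) ?implybT//; congr powR; ring.
have key : th * x - n%:R * (th * mu - th `^ t * m) <= 1 - x `^ (g - h).
  have nx' : (x + x `^ g) / mu <= n%:R by rewrite ler_pdivrMr.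
  have h1 : (x + x `^ g) / mu * (th * mu - th `^ t * m) <= n%:R * (th * mu - th `^ t * m).
    by rewrite ler_wpM2r ?subr_ge0.
  have e1 : (x + x `^ g) / mu * (th * mu - th `^ t * m) =
      th * x + x `^ (g - h) - th `^ t * m * ((x + x `^ g) / mu).
    by rewrite -thg; field; rewrite gt_eqF.
  have h2 : th `^ t * m * ((x + x `^ g) / mu) <= 1.
    apply: le_trans (_ : th `^ t * m * (2 * x / mu) <= _).
      by rewrite ler_wpM2l ?mulr_ge0 ?powR_ge0// ler_pM2r ?invr_gt0//; lra.
    have -> : th `^ t * m * (2 * x / mu) = 2 * m / mu * (x * th `^ t) by ring.
    have -> : x * th `^ t = x `^ (- (h * t - 1)).
      rewrite /th -powRrM -[X in X * _]powRr1 ?(ltW x0)//.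
      by rewrite -powRD ?(gt_eqF x0) ?implybT//; congr powR; ring.
    have : x `^ (- (h * t - 1)) <= (2 * m / mu + 1)^-1.
      by near: x; exact: near_powRN_le.
    rewrite -[leRHS]mul1r ler_pdivlMr// => h3.
    have := powR_ge0 x (- (h * t - 1)); lra.
  lra.
apply: le_trans (_ : expR (1 - x `^ (g - h)) <= _); first by rewrite ler_expR.
rewrite -[leRHS]lnK ?posrE// ler_expR.
have : 1 - ln e <= x `^ (g - h) by near: x; exact: near_powR_ge.
lra.
Unshelve. all: by end_near. Qed.

(** With [v = n u], the chain [(1 - u)^n <= (1 + u)^(-n) <= 1 / (1 + v) <= 1 - v + v^2]. *)
Lemma pow_onem_le n (u : R) : 0 <= u <= 1 -> n%:R * u - (n%:R * u) ^+ 2 <= 1 - (1 - u) ^+ n.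
Proof.
move=> /andP[u0 u1]; set v := n%:R * u.
have v0 : 0 <= v by rewrite mulr_ge0.
have h1 : 1 + v <= (1 + u) ^+ n.
  rewrite /v; elim: n {v v0} => [|n IH]; first by rewrite mul0r addr0 expr0.
  rewrite exprS -natr1 mulrDl mul1r.
  have : (1 + u) * (1 + n%:R * u) <= (1 + u) * (1 + u) ^+ n by rewrite ler_wpM2l// addr_ge0.
  have : 0 <= n%:R * u * u by rewrite !mulr_ge0.
  lra.
have h2 : (1 - u) ^+ n * (1 + u) ^+ n <= 1.
  by rewrite -exprMn exprn_ile1//; nra.
have w0 : 0 <= (1 - u) ^+ n by rewrite exprn_ge0// subr_ge0.
have h3 : (1 - u) ^+ n * (1 + v) <= 1.
  by apply: le_trans h2; rewrite ler_wpM2l.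
have h4 : (1 - u) ^+ n * (1 + v) <= (1 - v + v ^+ 2) * (1 + v).
  apply: le_trans h3 _; have : 0 <= v ^+ 3 by rewrite exprn_ge0.
  by rewrite !exprS expr0; lra.
have : (1 - u) ^+ n <= 1 - v + v ^+ 2 by rewrite -(ler_pM2r (_ : 0 < 1 + v))// ltr_pwDl.
lra.
Qed.

Lemma tail_small e : 0 < e -> exists2 delta : R, 0 < delta &
  \forall x \near +oo, forall n, n%:R <= delta * x ->
    `|p n x - n%:R * G x| <= e * (n%:R * G x).
Proof.
move=> e0; have e30 : 0 < e / 3 by rewrite divr_gt0.
have q'10 : 0 < q' + 1 by rewrite addr_gt0.
have [eps /andP[eps0 eps1] near_ch] := chernoff_powR q'10.
have [K K0 up] := G_up.
have [eta /andP[eta0 eta1] near_cont] := G_cont e30.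
have ee : 0 < eps / 2 < 1 by rewrite divr_gt0//=; lra.
have [C C0 near_scale] := G_scale ee.
have near_pG := powR_le_G e30.
have h20 : 0 < 2^-1 :> R by rewrite invr_gt0.
have near_xg := near_powRg_le h20.
have q10 : 0 < q - 1.
  by rewrite subr_gt0 (lt_trans gq1)// gtr_pMl.
(* In the one-jump bound the second term carries the factor [n mu / (eta x)], at most
   [delta mu / eta]; the last condition makes it worth [e / 3] after [G (eps / 2 * x)] is replaced
   by [C * G x]. The other two thirds go to [G_cont] and to the tilted term. *)
have [delta [d0 d1 dmu dC]] : exists delta : R,
    [/\ 0 < delta, delta <= 1, delta * mu <= 2^-1 & delta * mu / eta * C <= e / 3].
  pose D := mu / eta * C; have D0 : 0 < D by rewrite mulr_gt0// divr_gt0.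
  exists (Num.min 1 (Num.min (2^-1 / mu) (e / 3 / D))); split.
  - by rewrite !lt_min ltr01 !divr_gt0.
  - by rewrite ge_min lexx.
  - by rewrite -ler_pdivlMr// !ge_min lexx !orbT.
  - have -> (u : R) : u * mu / eta * C = u * D by rewrite /D; ring.
    by rewrite -ler_pdivlMr// !ge_min lexx !orbT.
exists delta => //; near=> x => n nx.
have x0 : 0 < x by near: x; exact: nbhs_pinfty_gt.
case: n nx => [|n] nx; first by rewrite p0 ?(ltW x0)// mul0r mulr0 subr0 normr0.
have ch : forall n b, n%:R * mu <= x - x `^ g ->
    b <= eps * (x - n%:R * mu) -> exists2 theta : R, 0 <= theta &
    expR (- (theta * (x - n%:R * mu)) + n%:R * (theta `^ t * m * expR (theta * b)))
      <= 2 * x `^ (- (q' + 1)) by near: x.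
have cont : G ((1 - eta) * x) <= (1 + e / 3) * G x by near: x.
have scale : G (eps / 2 * x) <= C * G x by near: x.
have pG : 2 * x `^ (- (q' + 1)) <= e / 3 * G x by near: x.
have xg : x `^ g <= 2^-1 * x by near: x.
have Kx : x * (K * x `^ (- q)) <= e.
  have -> : x * (K * x `^ (- q)) = K * x `^ (- (q - 1)).
    by rewrite opprB powRB ?(gt_eqF x0) ?implybT// powRr1 ?(ltW x0)// powRN; ring.
  rewrite mulrC -ler_pdivlMr//.
  by near: x; apply: near_powRN_le; rewrite ?divr_gt0.
set N := n.+1 in nx *.
have N1 : 1 <= N%:R :> R by rewrite ler1n.
have Nmu : N%:R * mu <= 2^-1 * x.
  apply: le_trans (_ : delta * x * mu <= _); first by rewrite ler_pM2r.
  by rewrite mulrAC ler_pM2r.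
have Gx0 := G_ge0 x.
have NG0 : 0 <= N%:R * G x by rewrite mulr_ge0.
have NGe : N%:R * G x <= e.
  apply: le_trans Kx; apply: ler_pM => //; last exact: up.
  by apply: le_trans nx _; rewrite ler_piMl// ltW.
rewrite ler_norml; apply/andP; split.
  have := pow_onem_le N (_ : 0 <= G x <= 1); rewrite G_ge0 G_le1 => /(_ isT).
  have := p_max N x; have : (N%:R * G x) ^+ 2 <= e * (N%:R * G x).
    by rewrite expr2 ler_wpM2r.
  lra.
have z0 : 0 < eta * x by rewrite mulr_gt0.
have czx : (1 - eta) * x + eta * x <= x by rewrite mulrBl mul1r subrK.
have nx' : N%:R * mu <= x - x `^ g by lra.
have bx : eps / 2 * x <= eps * (x - N%:R * mu).
  by rewrite -mulrA ler_pM2l//; lra.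
have [theta th0 hth] := ch N _ nx' bx.
have h := p_jump N (eps / 2 * x) th0 z0 czx.
have j1 : N%:R * G ((1 - eta) * x) <= (1 + e / 3) * (N%:R * G x).
  by rewrite [leRHS]mulrCA ler_wpM2l.
have j2 : N%:R * (N%:R * mu / (eta * x)) * G (eps / 2 * x) <= e / 3 * (N%:R * G x).
  apply: le_trans (_ : N%:R * (delta * mu / eta) * (C * G x) <= _).
    apply: ler_pM => //; first by rewrite mulr_ge0// divr_ge0 ?mulr_ge0// ltW.
    rewrite ler_wpM2l// ler_pdivrMr//.
    rewrite [leRHS](_ : _ = delta * x * mu); last by field; rewrite gt_eqF.
    by rewrite ler_pM2r.
  rewrite [leLHS](_ : _ = delta * mu / eta * C * (N%:R * G x)); last by ring.
  by rewrite ler_wpM2r.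
have j3 : e / 3 * G x <= e / 3 * (N%:R * G x) by rewrite ler_pM2l// ler_peMl.
lra.
Unshelve. all: by end_near. Qed.

End large_deviations.

(** * The equilibrium distribution *)

Section service_tail.
Context {R : realType}.

Lemma tail_doubling (F L : R -> R) (alpha q : R) : q + 1 < alpha ->
  slowly_varying L -> F x / (L x * x `^ (- alpha)) @[x --> +oo] --> (1 : R) ->
  (\forall x \near +oo, 0 < F x) /\
  (\forall x \near +oo, F (2 * x) <= 2 `^ (- (q + 1)) * F x) /\
  exists2 c : R, 0 < c & \forall x \near +oo, c * F x <= F (2 * x).
Proof.
move=> qa [[a [_ La]] Lslow] FL.
(* [B > 1] is the slack in [2^(-(q + 1)) = B 2^(-alpha)]. The value of [dl] is chosen so that
   [(1 + dl)^2 <= 1 + 3 dl = B (1 - dl)]. *)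
pose B : R := 2 `^ (alpha - (q + 1)).
have B1 : 1 < B.
  rewrite -(powRr0 2) /B /powR !gt_eqF// ltr_expR ltr_pM2r ?ln_gt0 ?ltr1n//; lra.
pose dl := (B - 1) / (3 + B).
have den : 0 < 3 + B by lra.
have dl0 : 0 < dl by rewrite divr_gt0// subr_gt0.
have dl1 : dl < 1 by rewrite ltr_pdivrMr//; lra.
have dlB : dl * (3 + B) = B - 1 by rewrite /dl divfK// gt_eqF.
have p2 (u : R) : 0 < 2 `^ u :> R by exact: powR_gt0.
have /cvgrPdist_le/(_ _ dl0)/near_pinfty_ex[x1 x11 near_F] := FL.
have /cvgrPdist_le/(_ _ dl0)/near_pinfty_ex[x2 x21 near_L] := Lslow 2 (ltr0Sn _ _).
pose x0 := Num.max (Num.max x1 x2) (Num.max a 1).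
have main x : x0 <= x -> exists D, [/\ 0 < D, (1 - dl) * D <= F x <= (1 + dl) * D &
    (1 - dl) ^+ 2 * 2 `^ (- alpha) * D <= F (2 * x) <= (1 + dl) ^+ 2 * 2 `^ (- alpha) * D].
  rewrite !ge_max => /andP[/andP[xx1 xx2] /andP[xa xge1]].
  have xp : 0 < x by exact: lt_le_trans xge1.
  have L0 : 0 < L x by exact: La.
  have L20 : 0 < L (2 * x) by apply: La; lra.
  have xa0 : 0 < x `^ (- alpha) by exact: powR_gt0.
  exists (L x * x `^ (- alpha)); have D0 : 0 < L x * x `^ (- alpha) by rewrite mulr_gt0.
  set D := L x * _ in D0 *.
  have D20 : 0 < L (2 * x) * (2 * x) `^ (- alpha) by rewrite mulr_gt0// powR_gt0// mulr_gt0.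
  have hF : (1 - dl) * D <= F x <= (1 + dl) * D.
    have := near_F x xx1; rewrite ler_distlC -/D ler_pdivlMr// ler_pdivrMr//.
  have hF2 : (1 - dl) * (L (2 * x) * (2 * x) `^ (- alpha)) <= F (2 * x) <=
      (1 + dl) * (L (2 * x) * (2 * x) `^ (- alpha)).
    have x12 : x1 <= 2 * x by lra.
    by have := near_F _ x12; rewrite ler_distlC ler_pdivlMr// ler_pdivrMr.
  have hL : (1 - dl) * L x <= L (2 * x) <= (1 + dl) * L x.
    by have := near_L x xx2; rewrite ler_distlC ler_pdivlMr// ler_pdivrMr.
  split => //.
  have E : (2 * x) `^ (- alpha) = 2 `^ (- alpha) * x `^ (- alpha) by rewrite powRM// ltW.
  have [/andP[l1 l2] /andP[f1 f2]] := (hL, hF2).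
  have dl10 : 0 < 1 - dl by lra.
  have dl11 : 0 < 1 + dl by lra.
  apply/andP; split.
    apply: le_trans f1; rewrite expr2 -!mulrA ler_pM2l// E.
    rewrite [leLHS](_ : _ = (1 - dl) * L x * (2 `^ (- alpha) * x `^ (- alpha))); last by rewrite /D; ring.
    by rewrite ler_pM2r// mulr_gt0.
  apply: le_trans f2 _; rewrite expr2 -!mulrA ler_pM2l// E.
  rewrite [leRHS](_ : _ = (1 + dl) * L x * (2 `^ (- alpha) * x `^ (- alpha))); last by rewrite /D; ring.
  by rewrite ler_pM2r// mulr_gt0.
have dl10 : 0 < 1 - dl by lra.
have dl11 : 0 < 1 + dl by lra.
split; [|split].
- apply: (@near_pinfty_of_ge _ _ x0) => x /main[D [D0 /andP[h _] _]].
  by apply: lt_le_trans h; rewrite mulr_gt0.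
- apply: (@near_pinfty_of_ge _ _ x0) => x /main[D [D0 /andP[h _] /andP[_ h2]]].
  apply: le_trans h2 _; apply: le_trans (_ : 2 `^ (- (q + 1)) * ((1 - dl) * D) <= _); last first.
    by rewrite ler_pM2l.
  have -> : 2 `^ (- (q + 1)) = B * 2 `^ (- alpha) :> R.
    by rewrite /B -powRD ?pnatr_eq0 ?implybT//; congr powR; ring.
  rewrite [leRHS](_ : _ = B * (1 - dl) * (2 `^ (- alpha) * D)); last by ring.
  rewrite -mulrA ler_pM2r ?mulr_gt0//.
  have : dl * dl <= dl by rewrite ler_piMr// ltW.
  rewrite expr2; lra.
exists ((1 - dl) ^+ 2 * 2 `^ (- alpha) / (1 + dl)).
  by rewrite divr_gt0// mulr_gt0// exprn_gt0.
apply: (@near_pinfty_of_ge _ _ x0) => x /main[D [D0 /andP[_ h] /andP[h2 _]]].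
apply: le_trans h2; rewrite mulrAC ler_pdivrMr// -[leRHS]mulrA.
by rewrite ler_pM2l ?mulr_gt0 ?exprn_gt0// mulrC.
Qed.
End service_tail.

Section equilibrium.
Context {R : realType} {d : measure_display} {T : measurableType d}.
Variables (P : probability T R) (V X : {RV P >-> R}).
Hypothesis V_ge0 : forall w, 0 <= V w.
Hypothesis X_density : has_density X (equilibrium_density V).

(** If [mean V] were [0], division by it would give [0] and the density would vanish, against total
    mass [1]. Since [fine] sends [+oo] to [0], this also excludes an infinite expectation. *)
Lemma equilibrium_mean_gt0 : 0 < mean V.
Proof.
have : 0 <= mean V by apply: fine_ge0; exact: expectation_ge0.
rewrite le_eqVlt => /predU1P[E0|//].
have := X_density (@measurableT _ R).
rewrite probability_setT integral0_eq => [/eqP|t _].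
  by rewrite onee_eq0.
by rewrite /equilibrium_density -E0 invr0 mulr0 if_same.
Qed.

Lemma equilibrium_ge0 : P [set w | X w <= 0] = 0%E.
Proof.
have := X_density (measurable_itv `]-oo, 0]).
rewrite integral0_eq => [<-|t /=].
  by rewrite /distribution /pushforward; congr (P _); apply/seteqP; split => w /=; rewrite in_itv.
by rewrite in_itv/= /equilibrium_density leNgt => /negbTE ->.
Qed.

Lemma equilibrium_incr u v : 0 <= u -> u <= v ->
  (v - u) * (tail P V v / mean V) <= tail P X u - tail P X v
    <= (v - u) * (tail P V u / mean V).
Proof.
move=> u0 uv; have M0 := equilibrium_mean_gt0.
have mI : measurable (`]u, v] : set R) by [].
have E : (tail P X u - tail P X v)%:E =
    (\int[lebesgue_measure]_(t in `]u, v]) (equilibrium_density V t)%:E)%E.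
  rewrite -X_density// EFinB !tailE//.
  have mXv := measurable_tail_set v (measurable_funPT X).
  have mXu := measurable_tail_set u (measurable_funPT X).
  have mXuv : measurable (X @^-1` `]u, v]).
    exact: measurable_preimage_RV.
  have -> : [set w | u < X w] = (X @^-1` `]u, v]) `|` [set w | v < X w].
    apply/seteqP; split => w /=.
      by rewrite in_itv/= => ->; case: (leP (X w) v); [left|right].
    by rewrite in_itv/= => -[/andP[]//|]; apply: le_lt_trans.
  rewrite measureU//; last first.
    apply/seteqP; split => w //= -[]; rewrite in_itv/= => /andP[_ h1] /lt_geF.
    by rewrite h1.
  by rewrite addeK// fin_num_measure.
have mu_uv : lebesgue_measure `]u, v] = (v - u)%:E.
  rewrite lebesgue_measure_itv/= lte_fin; move: uv; rewrite le_eqVlt.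
  by move=> /predU1P[->|->]; rewrite ?ltxx ?subrr.
have cstE c : ((v - u) * c)%:E = (\int[lebesgue_measure]_(t in `]u, v]) c%:E)%E.
  rewrite integral_cst// mulrC EFinM; congr (_ * _)%E; exact/esym/mu_uv.
have {}E : (tail P X u - tail P X v)%:E =
    (\int[lebesgue_measure]_(t in `]u, v]) (tail P V t / mean V)%:E)%E.
  rewrite E; apply: eq_integral => t; rewrite inE/= in_itv/= => /andP[ut _].
  by rewrite /equilibrium_density (le_lt_trans u0 ut).
have F0 t : 0 <= tail P V t / mean V by rewrite divr_ge0 ?tail_ge0// ltW.
have Fni s t : s <= t -> tail P V t / mean V <= tail P V s / mean V.
  by move=> st; rewrite ler_pM2r ?invr_gt0// tail_nonincreasing.
have mF : measurable_fun `]u, v] (fun t => (tail P V t / mean V)%:E).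
  by apply/measurable_EFinP; apply: nonincreasing_measurable.
rewrite -!lee_fin E !cstE; apply/andP; split; apply: ge0_le_integral => //.
- by move=> t _; rewrite lee_fin.
- by move=> t; rewrite /= in_itv/= lee_fin => /andP[_]; exact: Fni.
- by move=> t _; rewrite lee_fin.
- by move=> t; rewrite /= in_itv/= lee_fin => /andP[/ltW + _]; exact: Fni.
Qed.
End equilibrium.

(** * Moments of order below the tail exponent *)

Section moments.
Context {R : realType} {d : measure_display} {T : measurableType d}.
Variables (P : probability T R) (Y : {RV P >-> R}).
Hypothesis Y_ge0 : forall w, 0 <= Y w.

(** The term of the least [k] with [y <= 2^(k + 1)] is already large enough; the summand [1] serves
    [y <= 1]. *)
Lemma powR_le_dyadic (y t : R) : 0 <= y -> 0 <= t ->
  ((y `^ t)%:E <= 1 + \sum_(0 <= k <oo)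
     ((2 ^+ k.+1) `^ t * \1_(`]2 ^+ k, +oo[%classic) y)%:E)%E.
Proof.
move=> y0 t0.
have term0 k : (0 <= ((2 ^+ k.+1) `^ t * \1_(`]2 ^+ k, +oo[%classic) y)%:E :> \bar R)%E.
  by rewrite lee_fin mulr_ge0 ?powR_ge0// indicE.
have [y1|y1] := leP y 1.
  apply: le_trans (_ : 1 <= _)%E; last by rewrite leeDl// nneseries_ge0.
  rewrite lee_fin; have <- : 1 `^ t = 1 :> R by rewrite powR1.
  by apply: ge0_ler_powR; rewrite ?nnegrE.
have ex : exists k, y <= 2 ^+ k.+1.
  exists (Num.truncn y); apply: le_trans (ltW (truncnS_gt y)) _.
  by rewrite -natrX ler_nat ltnW// ltn_expl.
case: (ex_minnP ex) => k yk kmin.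
have ky : 2 ^+ k < y.
  case: k {yk} kmin => [|k] kmin; first by rewrite expr0.
  by rewrite ltNge; apply/negP => /kmin; rewrite ltnn.
apply: le_trans (_ : ((2 ^+ k.+1) `^ t * \1_(`]2 ^+ k, +oo[%classic) y)%:E <= _)%E.
  rewrite indicE mem_set/= ?in_itv/= ?ky// mulr1 lee_fin.
  by apply: ge0_ler_powR; rewrite ?nnegrE ?exprn_ge0.
apply: le_trans (_ : \sum_(0 <= i < k.+1)
    ((2 ^+ i.+1) `^ t * \1_(`]2 ^+ i, +oo[%classic) y)%:E <= _)%E.
  by rewrite big_nat_recr//= leeDr// sume_ge0.
by rewrite (le_trans (nneseries_lim_ge _ _))// leeDr.
Qed.

(** The dyadic layer [k] contributes at most [2^((k + 1) t) K 2^(- k q) = 2^t K r^k], a convergent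
    geometric series because [r = 2^(t - q) < 1]. *)
Lemma moment_lty (t q K : R) : 0 <= t < q -> 0 <= K ->
  (forall y, 0 < y -> tail P Y y <= K * y `^ (- q)) ->
  (\int[P]_w (Y w `^ t)%:E < +oo)%E.
Proof.
move=> /andP[t0 tq] K0 YK.
pose c k : R := (2 ^+ k.+1) `^ t.
pose f k w := (c k * \1_(`]2 ^+ k, +oo[%classic) (Y w)).
have c0 k : 0 <= c k by exact: powR_ge0.
have f0 k w : 0 <= f k w by rewrite mulr_ge0// indicE.
have mi k : measurable_fun setT (fun w => \1_(`]2 ^+ k, +oo[%classic : set R) (Y w) : R).
  by apply: (measurableT_comp (f := \1_(`]2 ^+ k, +oo[%classic : set R) : R -> R)).
have mf k : measurable_fun setT (fun w => (f k w)%:E).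
  by apply/measurable_EFinP; exact: measurable_funM.
pose r : R := 2 `^ (t - q).
have r0 : 0 < r by exact: powR_gt0.
have r1 : r < 1.
  by rewrite -(powRr0 2) /r /powR !gt_eqF// ltr_expR ltr_pM2r ?ln_gt0 ?ltr1n// subr_lt0.
have fk k : (\int[P]_w (f k w)%:E <= (2 `^ t * K * r ^+ k)%:E)%E.
  under eq_integral do rewrite EFinM.
  rewrite ge0_integralZl//=; last 2 first.
  - exact/measurable_EFinP.
  - by rewrite lee_fin.
  rewrite integral_indic_comp// tail_preimage.
  rewrite -EFinM lee_fin; apply: le_trans (_ : c k * (K * (2 ^+ k) `^ (- q)) <= _).
    by rewrite ler_wpM2l// YK// exprn_gt0.
  rewrite /c exprS powRM ?exprn_ge0//.
  have -> : r ^+ k = (2 ^+ k) `^ t * (2 ^+ k) `^ (- q).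
    by rewrite -powRD ?expf_neq0 ?implybT// -powR_exprn.
  by rewrite le_eqVlt; apply/orP; left; apply/eqP; ring.
have D0 : 0 <= 2 `^ t * K * (1 - r)^-1.
  by rewrite mulr_ge0 ?mulr_ge0 ?powR_ge0// invr_ge0 subr_ge0 ltW.
apply: (@le_lt_trans _ _ (1 + (2 `^ t * K * (1 - r)^-1)%:E)%E); last by rewrite -EFinD ltry.
apply: (@le_trans _ _ (\int[P]_w (1 + \sum_(0 <= k <oo) (f k w)%:E))%E).
  apply: ge0_le_integral => //.
  - by move=> w _; rewrite lee_fin powR_ge0.
  - by apply/measurable_EFinP; apply: (measurableT_comp (measurable_powR t)).
  - apply: emeasurable_funD => //; apply: ge0_emeasurable_sum => // k w _ _.
    by rewrite lee_fin.
  - by move=> w _; exact: powR_le_dyadic.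
rewrite ge0_integralD//=; last 2 first.
- by move=> w _; apply: nneseries_ge0 => k _ _; rewrite lee_fin.
- by apply: ge0_emeasurable_sum => // k w _ _; rewrite lee_fin.
rewrite integral_cst//= probability_setT mule1 leeD2l//.
rewrite integral_nneseries//; last by move=> k w _; rewrite lee_fin.
apply: lime_le.
  by apply: is_cvg_nneseries => k _ _; apply: integral_ge0 => w _; rewrite lee_fin.
near=> n.
apply: (@le_trans _ _ (\sum_(0 <= k < n) (2 `^ t * K * r ^+ k)%:E)%E); first exact: lee_sum.
rewrite sumEFin lee_fin -mulr_sumr ler_wpM2l ?mulr_ge0 ?powR_ge0//.
rewrite -[leRHS]mul1r ler_pdivlMr ?subr_gt0// mulrC mulr_sumr sum_geo// expr0.
by rewrite gerBl exprn_ge0// ltW.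
Unshelve. all: by end_near. Qed.
End moments.

(** * From nonnegative summands to the mixture *)

Section positive_part.
Context {R : realType} {d : measure_display} {T : measurableType d}.
Variables (P : probability T R) (X : nat -> {RV P >-> R}).
Hypothesis X_iid : iid X.
Hypothesis X_gt0 : P [set w | X 0%N w <= 0] = 0%E.

(* A density on [(0, oo)] makes [X] positive only almost surely. *)
Let Y n : {RV P >-> R} := ((X n)^\+)%R.

Let YE n w : Y n w = Num.max (X n w) 0.
Proof. by []. Qed.

Lemma pos_part_ge0 n w : 0 <= Y n w.
Proof. by rewrite YE le_max lexx orbT. Qed.

Let measurable_max0 : measurable_fun setT (fun x : R => Num.max x 0).
Proof. exact: measurable_maxr. Qed.

Let measurable_pre B : measurable B -> measurable ((fun x : R => Num.max x 0) @^-1` B).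
Proof. by move=> mB; rewrite -[X in measurable X]setTI; exact: measurable_max0. Qed.

Lemma pos_part_iid : iid Y.
Proof.
split=> [J B uJ mB|n B mB].
  exact: (X_iid.1 J (fun i => (fun x : R => Num.max x 0) @^-1` B i) uJ (fun i => measurable_pre (mB i))).
exact: (X_iid.2 n _ (measurable_pre mB)).
Qed.

Lemma pos_part_null n : P [set w | X n w <= 0] = 0%E.
Proof.
have := X_iid.2 n _ (measurable_itv `]-oo, 0]).
have E k : [set w | X k w <= 0] = X k @^-1` `]-oo, 0]%classic.
  by apply/seteqP; split => w /=; rewrite in_itv.
by rewrite /distribution /pushforward -!E => ->.
Qed.

Lemma measure_le_null (A B N : set T) : measurable A -> measurable B -> measurable N ->
  P N = 0%E -> A `\` N `<=` B -> (P A <= P B)%E.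
Proof.
move=> mA mB mN N0 AB; apply: (@le_trans _ _ (P (B `|` N))).
  apply: le_measure; rewrite ?inE//; first exact: measurableU.
  by move=> w Aw; case: (pselect (N w)) => [|Nw]; [right|left; apply: AB].
apply: le_trans (measureU2 _ mB mN) _.
by rewrite -[leRHS]adde0; apply: leeD2l; rewrite le_eqVlt; apply/orP; left; apply/eqP.
Qed.

Lemma pos_part_tail_sum n x :
  tail P (partial_sum Y n) x = tail P (partial_sum X n) x.
Proof.
pose N := \big[setU/set0]_(i < n) [set w | X i w <= 0].
have mXi i : measurable [set w | X i w <= 0].
  rewrite (_ : [set w | _] = X i @^-1` `]-oo, 0]%classic).
    exact: measurable_preimage_RV.
  by apply/seteqP; split => w /=; rewrite in_itv.
have mN : measurable N by apply: bigsetU_measurable => i _; exact: mXi.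
have N0 : P N = 0%E.
  apply/eqP; rewrite eq_le measure_ge0 andbT.
  have /le_trans := @Boole_inequality _ _ _ P (fun i => [set w | X i w <= 0]) n (fun i _ => mXi i).
  by apply; rewrite big1// => i _; exact: pos_part_null.
have SXY w : ~ N w -> partial_sum Y n w = partial_sum X n w.
  move=> Nw; apply: eq_bigr => i _; rewrite YE max_l// ltW// ltNge; apply/negP => Xi.
  by apply: Nw; rewrite /N -(bigcup_mkord n (fun i => [set w | X i w <= 0])); exists i => /=.
congr fine; apply/eqP; rewrite eq_le; apply/andP; split.
  apply: (measure_le_null _ _ mN N0) => [||w /= [+ Nw]].
  - exact/measurable_tail_set/measurable_partial_sum.
  - exact/measurable_tail_set/measurable_partial_sum.
  - by rewrite SXY.
apply: (measure_le_null _ _ mN N0) => [||w /= [+ Nw]].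
- exact/measurable_tail_set/measurable_partial_sum.
- exact/measurable_tail_set/measurable_partial_sum.
- by rewrite SXY.
Qed.

Lemma pos_part_tail x : tail P (Y 0%N) x = tail P (X 0%N) x.
Proof.
have := pos_part_tail_sum 1 x.
have E (Z : nat -> T -> R) : partial_sum Z 1 = Z 0%N.
  by apply/funext => w; rewrite /partial_sum big_ord1.
by rewrite !E.
Qed.

Lemma pos_part_mean (mu : R) : (\int[P]_w (Y 0%N w)%:E = mu%:E)%E -> mean (X 0%N) = mu.
Proof.
move=> Ymu; rewrite /mean unlock -[RHS]/(fine mu%:E) -Ymu; congr fine.
apply: ae_eq_integral => //.
- exact/measurable_EFinP.
- exact/measurable_EFinP.
exists [set w | X 0%N w <= 0]; split => //.
  rewrite (_ : [set w | _] = X 0%N @^-1` `]-oo, 0]%classic).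
    exact: measurable_preimage_RV.
  by apply/seteqP; split => w /=; rewrite in_itv.
move=> w /= /not_implyP[_] XY; rewrite leNgt; apply/negP => Xw; apply: XY.
by rewrite YE max_l// ltW.
Qed.
End positive_part.

Section mixture.
Context {R : realType}.

Lemma series_mixture_bounds (p : nat -> R -> R) (rho x w : R) : 0 < rho < 1 ->
  (forall n x, 0 <= p n x) -> (forall n x, p n x <= 1) ->
  series (fun n => (1 - rho) * rho ^+ n * p n x) @ \oo --> w ->
  mixture_bounds p rho x w.
Proof.
move=> rho01 p0 p1 cvg_w; have [r0 r1] := andP rho01.
have wt0 n : 0 <= (1 - rho) * rho ^+ n.
  by rewrite mulr_ge0 ?subr_ge0 ?exprn_ge0// ltW.
have cvgX : rho ^+ n @[n --> \oo] --> (0 : R) by apply: cvg_expr; rewrite ger0_norm// ltW.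
split=> [k|k e pe].
  rewrite -(cvg_lim _ cvg_w)//; apply: limr_le; first by apply/cvg_ex; exists w.
  near=> N; have kN : (k <= N)%N by near: N; exact: nbhs_infty_ge.
  rewrite seriesEnat/= (@big_cat_nat _ _ _ k)//= lerD2l.
  apply: le_trans (_ : \sum_(k <= n < N) (1 - rho) * rho ^+ n <= _).
    by apply: ler_sum => n _; rewrite ler_piMr.
  by rewrite sum_geo// gerBl exprn_ge0// ltW.
have cvg_l : (\sum_(0 <= n < k) (1 - rho) * rho ^+ n * p n x + e * (rho ^+ k - rho ^+ N))
    @[N --> \oo] --> \sum_(0 <= n < k) (1 - rho) * rho ^+ n * p n x + e * (rho ^+ k - 0).
  by apply: cvgD; [exact: cvg_cst|apply: cvgMr; apply: cvgB => //; exact: cvg_cst].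
rewrite subr0 in cvg_l.
apply: (ler_cvg_to cvg_l cvg_w).
near=> N; have kN : (k <= N)%N by near: N; exact: nbhs_infty_ge.
rewrite seriesEnat/= [leRHS](@big_cat_nat _ _ _ k)//= lerD2l -sum_geo// mulr_sumr.
apply: ler_sum_nat => n /andP[kn _].
by rewrite mulrC ler_wpM2l// pe.
Unshelve. all: by end_near. Qed.

(** Meant for suprema in the extended reals, which may be infinite away from the limit; the case
    [e = 1] shows that they are eventually finite. *)
Lemma cvge0_squeeze (T : Type) (F : set_system T) (FF : Filter F) (f : T -> \bar R) :
  (forall e : R, 0 < e -> \forall x \near F, (0 <= f x <= e%:E)%E) ->
  f @ F --> 0%E.
Proof.
move=> h; apply/fine_cvgP; split.
  have := h 1 ltr01; apply: filterS => x /andP[f0 f1].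
  by rewrite ge0_fin_numE// (le_lt_trans f1) ?ltry.
apply/cvgrPdist_le => e e0; have := h e e0; apply: filterS => x /andP[f0 fe].
have fx : f x \is a fin_num by rewrite ge0_fin_numE// (le_lt_trans fe) ?ltry.
rewrite sub0r normrN ger0_norm; first by rewrite -lee_fin fineK.
exact: fine_ge0.
Qed.
End mixture.

(** * Choice of the exponents and transfer of all estimates to the queue *)

Section heavy_tailed_queue.
Context {R : realType} {d : measure_display} {T : measurableType d}.
Variables (P : probability T R) (V : {RV P >-> R}) (X : nat -> {RV P >-> R}).
Variables (alpha : R) (L : R -> R).
Hypothesis V_ge0 : forall w, 0 <= V w.
Hypothesis X_iid : iid X.
Hypothesis X_density : has_density (X 0%N) (equilibrium_density V).
Hypothesis alpha_gt2 : 2 < alpha.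
Hypothesis L_slow : slowly_varying L.
Hypothesis V_tail : tail P V x / (L x * x `^ (- alpha)) @[x --> +oo] --> (1 : R).

Let mu := mean (X 0%N).
Let G := tail P (X 0%N).
Let p n := tail P (partial_sum X n).

Lemma beta_bounds : [/\ 0 < beta alpha, beta alpha < 1, 2^-1 <= beta alpha &
  beta alpha * (alpha - 1) >= 1].
Proof.
set k := Num.min 2 (alpha - 1).
have k1 : 1 < k by rewrite lt_min ltr1n ltrBrDr.
have k0 : 0 < k by exact: lt_trans k1.
have k2 : k <= 2 by rewrite ge_min lexx.
have ka : k <= alpha - 1 by rewrite ge_min lexx orbT.
rewrite /beta -/k; split.
- by rewrite invr_gt0.
- by rewrite invf_lt1.
- by rewrite lef_pV2 ?posrE.
- by rewrite mulrC ler_pdivlMr// mul1r.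
Qed.

(* [g] lies halfway between [beta] and [1], [beta q] halfway between [g] and
   [1], and [t] halfway between [1 / g] and [q]. *)
Lemma exponents : exists g q t : R,
  [/\ [/\ beta alpha < g, g < 1, 1 < q, g < beta alpha * q & 1 < g * q],
      q + 1 < alpha, [/\ 1 < t, t <= 2 & t < q] & 1 < g * t].
Proof.
have [b0 b1 b2 ba] := beta_bounds; set b := beta alpha in b0 b1 b2 ba *.
have g0 : 0 < (1 + b) / 2 by rewrite divr_gt0// addr_gt0.
have b4 : 0 < 4 * b by rewrite mulr_gt0.
set g := (1 + b) / 2 in g0 *.
pose q := (3 + b) / (4 * b).
have bq : b * q = (3 + b) / 4 by rewrite /q; field; rewrite gt_eqF.
have q1 : 1 < q by rewrite ltr_pdivlMr//; lra.
have q2 : q < 2 by rewrite ltr_pdivrMr//; lra.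
have qa : q < alpha - 1 by rewrite -(ltr_pM2l b0) bq; lra.
have gq : 1 < g * q.
  have -> : g * q = (1 + b) * (3 + b) / (8 * b) by rewrite /g /q; field; rewrite gt_eqF.
  have : 0 < (1 - b) * (3 - b) by rewrite mulr_gt0//; lra.
  by rewrite ltr_pdivlMr ?mulr_gt0//; nra.
have gV1 : 1 < g^-1 by rewrite invf_gt1// /g; lra.
have gVq : g^-1 < q by rewrite -[ltLHS]mulr1 ltr_pdivrMl// mulrC mulrC.
have gg : g * g^-1 = 1 by rewrite divff// gt_eqF.
exists g, q, ((q + g^-1) / 2); split; rewrite ?bq.
- by split=> //; rewrite /g; lra.
- by lra.
- by split; lra.
- by rewrite mulrA mulrDr gg; lra.
Qed.

(** The second component is a weak law with the window widened to [x]; it serves the bounded range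
    of [x] in the second limit. *)
Lemma mean_gt0_mixture_asymptotics : 0 < mu /\ (forall e : R, 0 < e ->
    \forall x \near +oo, forall n, x + x <= n%:R * mu -> 1 - e <= p n x) /\
  forall e : R, 0 < e -> \forall x \near +oo, forall rho w, 0 < rho < 1 ->
  mixture_bounds p rho x w ->
  `|w - (\sum_(0 <= n < (Num.truncn ((x - x `^ beta alpha) / mu)).+1)
           (1 - rho) * rho ^+ n * (n%:R * G (x - n.-1%:R * mu)) + rho `^ (x / mu))|
  <= e * (\sum_(0 <= n < (Num.truncn ((x - x `^ beta alpha) / mu)).+1)
           (1 - rho) * rho ^+ n * (n%:R * G (x - n.-1%:R * mu)) + rho `^ (x / mu)).
Proof.
have [b0 b1 b2 ba] := beta_bounds.
have [g [q [t [[bg g1 q1 gbq gq1] qa [t1 t2 tq] gt1]]]] := exponents.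
have [F_gt0 [F_up [c c0 F_low]]] := tail_doubling qa L_slow V_tail.
have M0 := equilibrium_mean_gt0 V_ge0 X_density.
pose F x := tail P V x / mean V.
have F_ni x y : x <= y -> F y <= F x.
  by move=> xy; rewrite ler_pM2r ?invr_gt0// tail_nonincreasing.
have F_ge0 x : 0 <= F x by rewrite divr_ge0 ?tail_ge0// ltW.
have F_up' : \forall x \near +oo, F (2 * x) <= 2 `^ (- (q + 1)) * F x.
  by move: F_up; apply: filterS => x; rewrite /F mulrA ler_pM2r ?invr_gt0.
have F_low' : \forall x \near +oo, c * F x <= F (2 * x).
  by move: F_low; apply: filterS => x; rewrite /F mulrA ler_pM2r ?invr_gt0.
have F_gt0' : \forall x \near +oo, 0 < F x.
  by move: F_gt0; apply: filterS => x Fx; rewrite divr_gt0.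
have G_incr := equilibrium_incr V_ge0 X_density.
have G_ni x y : x <= y -> G y <= G x by exact: tail_nonincreasing.
have G_ge0 x : 0 <= G x by exact: tail_ge0.
have G_le1 x : G x <= 1 by exact: tail_le1.
have G_cvg0 (e : R) : 0 < e -> \forall x \near +oo, G x <= e.
  move=> e0; have /fine_cvgP[_] := cvg_ccdfy0 (X 0%N).
  move=> /cvgrPdist_le/(_ _ e0); apply: filterS => x; rewrite sub0r normrN.
  move=> /(le_trans (ler_norm _)); apply: le_trans; rewrite le_eqVlt; apply/orP; left.
  apply/eqP; congr fine; congr (P _); apply/seteqP; split => w /=; rewrite in_itv/= andbT//.
have G_up := tail_powR_le F_ni F_ge0 G_incr G_le1 G_cvg0 q1 F_up'.
have [q' q'0 G_low] := tail_powR_ge F_ni G_incr G_ni G_ge0 c0 F_low' F_gt0'.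
have G_sc := tail_scale_le F_ni G_incr G_ni G_ge0 c0 F_low'.
have G_ct := tail_near1_le F_ni G_incr G_ge0 c0 F_low'.
have Xnull := equilibrium_ge0 X_density.
pose Y n : {RV P >-> R} := ((X n)^\+)%R.
have Y_iid : iid Y by exact: pos_part_iid.
have Y_ge0 n w : 0 <= Y n w by exact: pos_part_ge0.
have YG x : tail P (Y 0%N) x = G x by exact: pos_part_tail.
have Yp n x : tail P (partial_sum Y n) x = p n x by exact: pos_part_tail_sum.
have [K K0 G_K] := G_up.
have YK y : 0 < y -> tail P (Y 0%N) y <= K * y `^ (- q) by rewrite YG; exact: G_K.
have moment u : 0 <= u < q -> exists2 mm : R, 0 <= mm & (\int[P]_w (Y 0%N w `^ u)%:E = mm%:E)%E.
  move=> uq; have h := moment_lty (Y_ge0 0%N) uq (ltW K0) YK.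
  have h0 : (0 <= \int[P]_w (Y 0%N w `^ u)%:E)%E.
    by apply: integral_ge0 => w _; rewrite lee_fin powR_ge0.
  exists (fine (\int[P]_w (Y 0%N w `^ u)%:E)); first exact: fine_ge0.
  by rewrite fineK// ge0_fin_numE.
have [m m0 Ym] : exists2 mm : R, 0 <= mm & (\int[P]_w (Y 0%N w `^ t)%:E = mm%:E)%E.
  by apply: moment; rewrite tq (le_trans ler01)// ltW.
have [mu' mu'0 Ymu'] : exists2 mm : R, 0 <= mm & (\int[P]_w (Y 0%N w)%:E = mm%:E)%E.
  have [|mm mm0 Emm] := moment 1; first by rewrite ler01.
  by exists mm => //; rewrite -Emm; apply: eq_integral => w _; rewrite powRr1.
have muE : mu = mu' by exact: pos_part_mean.
rewrite -muE in mu'0 Ymu'.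
(* Markov's inequality at a point [x1] with [G x1 > 0]: [x1 * G x1 <= mu]. *)
have mu0 : 0 < mu.
  have [c' c'0 /near_pinfty_ex[x1 x11 low]] := G_low.
  have x10 : 0 < x1 by exact: lt_le_trans x11.
  have Gx1 : 0 < G x1 by apply: lt_le_trans (low _ (lexx _)); rewrite mulr_gt0// powR_gt0.
  rewrite -YG in Gx1; apply: lt_le_trans (mulr_gt0 x10 Gx1) _.
  rewrite -ler_pdivlMl//; apply: (prob_le (h := fun w => x1^-1 * Y 0%N w)).
  - exact: measurable_tail_set.
  - exact: measurable_funM.
  - by move=> w; rewrite mulr_ge0// invr_ge0 ltW.
  - by move=> w /= /ltW Yw; rewrite ler_pdivlMl// mulr1.
  under eq_integral do rewrite EFinM.
  rewrite ge0_integralZl//=.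
  - by rewrite Ymu' -EFinM.
  - exact/measurable_EFinP.
  - by move=> w _; rewrite lee_fin.
  - by rewrite lee_fin invr_ge0 ltW.
have t12 : 1 <= t <= 2 by rewrite t2 ltW.
have p_start x : 0 <= x -> p 0 x = 0.
  move=> x0; apply: EFin_inj; rewrite tailE; last exact: measurable_partial_sum.
  rewrite (_ : [set w | _] = set0) ?measure0//; apply/seteqP; split => w //=.
  by rewrite /partial_sum big_ord0 ltNge x0.
have p_max n x : 1 - (1 - G x) ^+ n <= p n x.
  by rewrite -YG -Yp; exact: partial_sum_tail_ge.
have p_left n x theta : 0 <= theta ->
    1 - p n x <= expR (theta * x - n%:R * (theta * mu - theta `^ t * m)).
  by move=> th0; rewrite -Yp; exact: lower_deviation.
have p_right n x b theta : 0 <= theta -> p n x <= n%:R * G b +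
    expR (- (theta * (x - n%:R * mu)) + n%:R * (theta `^ t * m * expR (theta * b))).
  by move=> th0; rewrite -Yp -YG; exact: upper_deviation.
have p_jump n (x a b z theta : R) : 0 <= theta -> 0 < z -> a + z <= x ->
    p n x <= n%:R * G a + n%:R * (n%:R * mu / z) * G b +
    expR (- (theta * (x - n%:R * mu)) + n%:R * (theta `^ t * m * expR (theta * b))).
  by move=> th0 z0 cz; rewrite -Yp -!YG; exact: upper_deviation_one_jump.
have q0 : 0 < q by exact: lt_trans q1.
have above := tail_above mu0 m0 g1 t1 gt1 p_left.
split => //; split.
  move=> e e0; near=> x => n nx.
  have ab : forall n, x + x `^ g <= n%:R * mu -> 1 - e <= p n x.
    by near: x; exact: above.
  apply: ab; apply: le_trans nx; rewrite lerD2l; apply: ler1_powR; last exact: ltW.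
  by near: x; exact: near_pinfty_ge.
move=> e e0; apply: (mixture_asymptotics mu0 b0 bg g1 q1 gbq gq1 q'0) => //.
- by move=> n x; exact: tail_ge0.
- by move=> n x; apply: tail_le1; exact: measurable_partial_sum.
- exact: (tail_small mu0 m0 g1 q0 gq1 q'0 t1 gt1 G_ge0 G_le1 G_low G_up G_sc G_ct p_start p_max p_jump).
- exact: (tail_middle mu0 m0 g1 q'0 t1 gt1 G_ge0 G_low G_sc p_start p_right).
- exact: (tail_below mu0 m0 gq1 t1 gt1 G_ge0 G_up p_right).
Unshelve. all: by end_near. Qed.

End heavy_tailed_queue.

(** * The relative error *)

Section relative_error.
Context {R : realType} {d : measure_display} {T : measurableType d}.
Variable P : probability T R.
Variable X : {RV P >-> R}.
Implicit Types (W : T -> R) (alpha rho x e : R).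

Lemma SapproxE alpha rho x : Sapprox X alpha rho x =
  \sum_(0 <= n < (Num.truncn ((x - x `^ beta alpha) / mean X)).+1)
     (1 - rho) * rho ^+ n * (n%:R * tail P X (x - n.-1%:R * mean X)).
Proof.
rewrite big_ltn// mul0r mulr0 add0r /Sapprox /M.
by apply: eq_bigr => n _; rewrite mulrA.
Qed.

Lemma Sapprox_ge0 alpha rho x : 0 < rho < 1 -> 0 <= Sapprox X alpha rho x.
Proof.
move=> /andP[r0 r1]; rewrite SapproxE; apply: sumr_ge0 => n _.
rewrite mulr_ge0 ?mulr_ge0 ?tail_ge0 ?exprn_ge0 ?(ltW r0)//.
by rewrite subr_ge0 ltW.
Qed.

Lemma relative_error_le W alpha rho x e : 0 < rho < 1 ->
  `|tail P W x - (Sapprox X alpha rho x + rho `^ (x / mean X))|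
    <= e * (Sapprox X alpha rho x + rho `^ (x / mean X)) ->
  relative_error X W alpha rho x <= e.
Proof.
move=> rho01; rewrite /relative_error.
have D0 : 0 < Sapprox X alpha rho x + rho `^ (x / mean X).
  by rewrite ltr_wpDl ?Sapprox_ge0// powR_gt0//; case/andP: rho01.
move: (_ + _) D0 => D D0 h.
have -> : tail P W x / D - 1 = (tail P W x - D) / D by field; rewrite gt_eqF.
by rewrite normrM normfV (gtr0_norm D0) ler_pdivrMr.
Qed.

Lemma bernoulli_onem rho n : 0 <= rho <= 1 -> 1 - n%:R * (1 - rho) <= rho ^+ n.
Proof.
move=> /andP[r0 r1]; elim: n => [|n IH]; first by rewrite mul0r subr0 expr0.
rewrite exprS -natr1.
have : rho * (1 - n%:R * (1 - rho)) <= rho * rho ^+ n by rewrite ler_wpM2l.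
have : 0 <= n%:R * (1 - rho) * (1 - rho) by rewrite !mulr_ge0// subr_ge0.
lra.
Qed.

Lemma relative_error_bounded_range alpha (p : nat -> R -> R) (x1 e : R) :
  0 < mean X -> 0 < e <= 2^-1 ->
  (forall n x y, x <= y -> p n y <= p n x) ->
  (forall n, x1 + x1 <= n%:R * mean X -> 1 - e <= p n x1) -> (forall n x, 0 <= p n x) ->
  \forall rho \near 1^'-, forall W x, measurable_fun setT W -> 0 <= x <= x1 ->
    mixture_bounds p rho x (tail P W x) -> relative_error X W alpha rho x <= 8 * e.
Proof.
move=> mu0 /andP[e0 e1] p_ni p_above p0; set mu := mean X in mu0 p_above *.
(* From [N] on, [p n x1 >= 1 - e]; [K] bounds both [x / mu] and the number of terms of [S]. The
   summands of [A] ensure in turn that [S], a sum of at most [K] terms each at most [(1 - rho) K],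
   that [1 - rho ^+ N], and that [1 - rho ^+ K] are at most [e]. *)
pose N := (Num.truncn ((x1 + x1) / mu)).+1; pose K := (Num.truncn (x1 / mu)).+1.
pose A : R := K%:R * K%:R + N%:R + K%:R.
have A0 : 0 < A + 1 by rewrite /A ltr_wpDl// !addr_ge0 ?mulr_ge0.
have eA : 0 < e / (A + 1) by rewrite divr_gt0.
near=> rho => W x mW /andP[x0 xx1] [_ w_lo].
have r1 : rho < 1 by near: rho; exact: nbhs_left_lt.
have rh : 2^-1 < rho by near: rho; apply: nbhs_left_gt; rewrite invf_lt1// ltr1n.
have sA : 1 - rho <= e / (A + 1).
  have : 1 - e / (A + 1) < rho by near: rho; apply: nbhs_left_gt; rewrite ltrBlDr ltrDl.
  lra.
have r0 : 0 < rho by apply: lt_trans rh; rewrite invr_gt0.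
have rho01 : 0 < rho < 1 by rewrite r0.
have rho01' : 0 <= rho <= 1 by rewrite !ltW.
have s0 : 0 <= 1 - rho by rewrite subr_ge0 ltW.
have sA' : (1 - rho) * (K%:R * K%:R + N%:R + K%:R) <= e.
  rewrite ler_pdivlMr// in sA; apply: le_trans sA.
  by rewrite ler_wpM2l// -/A lerDl.
have KK0 : 0 <= K%:R * K%:R :> R by rewrite mulr_ge0.
have sN : (1 - rho) * N%:R <= e.
  by apply: le_trans sA'; rewrite ler_wpM2l// addrAC lerDr addr_ge0.
apply: relative_error_le => //.
have w1 : tail P W x <= 1 by exact: tail_le1.
have muV : 0 < mu^-1 by rewrite invr_gt0.
have w_ge : 1 - e - e <= tail P W x.
  have pe n : (N <= n)%N -> 1 - e <= p n x.
    move=> Nn; apply: le_trans (p_above n _) (p_ni _ _ _ xx1).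
    rewrite -ler_pdivrMr// ltW//; apply: lt_le_trans (truncnS_gt _) _.
    by rewrite ler_nat.
  apply: le_trans (w_lo N (1 - e) pe).
  have sum0 : 0 <= \sum_(0 <= n < N) (1 - rho) * rho ^+ n * p n x.
    by apply: sumr_ge0 => n _; rewrite mulr_ge0 ?mulr_ge0 ?exprn_ge0 ?(ltW r0).
  have e10 : 0 <= 1 - e by lra.
  have := ler_wpM2l e10 (bernoulli_onem N rho01').
  have := ler_wpM2l e10 sN; have : 0 <= e * e by rewrite mulr_ge0// ltW.
  lra.
have xmu0 : 0 <= x / mu by rewrite divr_ge0// ltW.
have xmuK : x / mu <= K%:R.
  by apply: le_trans (ltW (truncnS_gt (x1 / mu))); rewrite ler_pM2r.
have r_le1 : rho `^ (x / mu) <= 1.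
  by rewrite -[leRHS](powRr0 rho) ger_powR// r0 ltW.
have r_ge : 1 - e <= rho `^ (x / mu).
  apply: le_trans (_ : rho ^+ K <= _).
    apply: le_trans (bernoulli_onem K rho01'); rewrite lerD2l lerN2 mulrC.
    by apply: le_trans sA'; rewrite ler_wpM2l// lerDr addr_ge0.
  by rewrite -powR_mulrn ?(ltW r0)// ger_powR// r0 ltW.
have S0 : 0 <= Sapprox X alpha rho x by exact: Sapprox_ge0.
have Se : Sapprox X alpha rho x <= e.
  rewrite SapproxE -/mu; set MM := (Num.truncn _).+1.
  have MK : (MM <= K)%N.
    rewrite ltnS le_truncn// ler_pM2r//; apply: le_trans xx1.
    by rewrite gerBl powR_ge0.
  apply: (@le_trans _ _ (\sum_(0 <= n < MM) (1 - rho) * K%:R)).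
    apply: ler_sum_nat => n /andP[_ nM]; rewrite -mulrA ler_wpM2l//.
    rewrite -[leRHS]mul1r; apply: ler_pM; rewrite ?exprn_ge0 ?exprn_ile1 ?(ltW r0) ?(ltW r1)//.
      by rewrite mulr_ge0 ?tail_ge0.
    rewrite -[leRHS]mulr1; apply: ler_pM; rewrite ?tail_ge0 ?tail_le1//.
    by rewrite ler_nat (leq_trans (ltnW nM)).
  rewrite sumr_const_nat subn0 -[leLHS]mulr_natr -mulrA; apply: le_trans sA'.
  rewrite ler_wpM2l//; apply: le_trans (_ : K%:R * K%:R <= _).
    by rewrite ler_wpM2l// ler_nat.
  by rewrite -addrA lerDl addr_ge0.
move: S0 Se r_le1 r_ge w1 w_ge e0 e1.
move: (Sapprox _ _ _ _) (rho `^ _) (tail _ _ _) => S r w.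
clear; move=> S0 Se r_le1 r_ge w1 w_ge e0 e1.
(* The difference of [w] and [S + r] is below [4 e], and [S + r >= 1 - e >= 1/2]. *)
have h : 4 * e <= 8 * e * (S + r) by nra.
by rewrite ler_norml; apply/andP; split; lra.
Unshelve. all: by end_near. Qed.
End relative_error.

Theorem theorem2p1 (R : realType) (d : measure_display) (T : measurableType d)
  (P : probability T R)
  (V X : nat -> {RV P >-> R})
  (A : R -> nat -> {RV P >-> R}) (W : R -> {RV P >-> R})
  (alpha : R) (L : R -> R)
  (V_iid : iid V)
  (V_ge0 : forall n w, 0 <= V n w)
  (X_iid : iid X)
  (X_density : has_density (X 0%N) (equilibrium_density (V 0%N)))
  (queue : forall rho, 0 < rho < 1 -> mg1_inputs V (A rho) rho)
  (W_steady : forall rho, 0 < rho < 1 -> steady_state_wait P V (A rho) (W rho))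
  (W_PK : forall rho, 0 < rho < 1 -> pollaczek_khintchine P X (W rho) rho)
  (alpha_gt2 : 2 < alpha)
  (L_slow : slowly_varying L)
  (V_tail : tail P (V 0%N) x / (L x * x `^ (- alpha)) @[x --> +oo] --> (1 : R)) :
  ereal_sup [set (relative_error (X 0%N) (W rho) alpha rho x)%:E
            | rho in `]0, 1[ ] @[x --> +oo] --> 0%E
  /\
  ereal_sup [set (relative_error (X 0%N) (W rho) alpha rho x)%:E
            | x in `[0, +oo[ ] @[rho --> 1^'-] --> 0%E.
Proof.
have [mu0 [above asym]] :=
  mean_gt0_mixture_asymptotics (V_ge0 0%N) X_iid X_density alpha_gt2 L_slow V_tail.
have err0 rho x : 0 <= relative_error (X 0%N) (W rho) alpha rho x by exact: normr_ge0.
pose p n := tail P (partial_sum X n).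
have p_ge0 n x : 0 <= p n x by exact: tail_ge0.
have p_le1 n x : p n x <= 1 by apply: tail_le1; exact: measurable_partial_sum.
have mix rho x : 0 < rho < 1 -> 0 <= x -> mixture_bounds p rho x (tail P (W rho) x).
  by move=> rho01 x0; apply: series_mixture_bounds => //; exact: W_PK.
have large e : 0 < e -> exists2 x0 : R, 1 <= x0 & forall x, x0 <= x ->
    forall rho, 0 < rho < 1 -> relative_error (X 0%N) (W rho) alpha rho x <= e.
  move=> e0; have [x0 x01 h] := near_pinfty_ex (asym e e0); exists x0 => // x x0x rho rho01.
  apply: relative_error_le => //; rewrite SapproxE.
  by apply: h => //; apply: mix => //; lra.
split; apply: cvge0_squeeze => e e0.
  have [x0 x01 h] := large e e0; apply: (@near_pinfty_of_ge _ _ x0) => x x0x; apply/andP; split.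
    (* The supremum of the empty set would be [-oo], so nonnegativity needs a member; [rho = 1/2]
       serves. *)
    apply: (@le_trans _ _ (relative_error (X 0%N) (W 2^-1) alpha 2^-1 x)%:E).
      by rewrite lee_fin.
    apply: ereal_sup_ubound; exists 2^-1 => //=.
    by rewrite in_itv/= invr_gt0 ltr0n invf_lt1 ?ltr1n.
  apply: ge_ereal_sup => _ [rho rho01 <-]; move: rho01; rewrite /= in_itv/= => rho01.
  by rewrite lee_fin h.
have [x0 x01 h] := large e e0.
pose e' := Num.min 2^-1 (e / 8).
have e'0 : 0 < e' <= 2^-1 by rewrite lt_min invr_gt0 ltr0n divr_gt0//= ge_min lexx.
have e'e : 8 * e' <= e by rewrite -ler_pdivlMl// mulrC ge_min lexx orbT.
have /andP[e'p _] := e'0.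
have [x1 x11 above1] := near_pinfty_ex (above e' e'p).
(* From [x0] on the uniform bound holds for every [rho]; the remaining [x] lie in [[0, x2]], and
   [x2 >= x1] makes the weak law valid at the endpoint. *)
pose x2 := Num.max x0 x1.
have x1x2 : x1 <= x2 by rewrite le_max lexx orbT.
have p_ni n x y : x <= y -> p n y <= p n x.
  by apply: tail_nonincreasing; exact: measurable_partial_sum.
have near_small := relative_error_bounded_range alpha mu0 e'0 p_ni (above1 x2 x1x2) p_ge0.
near=> rho.
have r1 : rho < 1 by near: rho; exact: nbhs_left_lt.
have r0 : 0 < rho by near: rho; exact: nbhs_left_gt.
have rho01 : 0 < rho < 1 by rewrite r0.
have small : forall W x, measurable_fun setT W -> 0 <= x <= x2 ->
    mixture_bounds p rho x (tail P W x) -> relative_error (X 0%N) W alpha rho x <= 8 * e'.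
  by near: rho; exact: near_small.
apply/andP; split.
  apply: (@le_trans _ _ (relative_error (X 0%N) (W rho) alpha rho 0)%:E).
    by rewrite lee_fin.
  by apply: ereal_sup_ubound; exists 0 => //=; rewrite in_itv/= lexx.
apply: ge_ereal_sup => _ [x x0' <-]; move: x0'; rewrite /= in_itv/= andbT => x_ge0.
rewrite lee_fin; have [x0x|/ltW xx0] := leP x0 x; first exact: h.
apply: le_trans e'e; apply: small => //; last exact: mix.
by rewrite x_ge0 le_max xx0.
Unshelve. all: by end_near. Qed.
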